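(* Let $2\le m\le n$ be integers, and consider the set $\mathcal{D}$ of all normalized (trace-one) decomposable entanglement witnesses $W$ on $\mathbb{C}^m\otimes\mathbb{C}^n$, with eigenvalues $\lambda_1(W)\ge\cdots\ge\lambda_{mn}(W)$. Then: (i) For each $x\in(\frac{1}{mn-1},1]$ there is $W\in\mathcal{D}$ with $\operatorname{tr}(W^2)=x$. The infimum of $\operatorname{tr}(W^2)$ over $\mathcal{D}$ is $\frac{1}{mn-1}$ and is not attained; the supremum is $1$ and is attained. (ii) For $W\in\mathcal{D}$, $\operatorname{tr}(W^2)=1$ if and only if $W=|\psi\rangle\langle\psi|^\Gamma$ for some entangled unit vector $|\psi\rangle\in\mathbb{C}^m\otimes\mathbb{C}^n$. (iii) For each $x\in[-\frac12,0)$ there is $W\in\mathcal{D}$ with $\lambda_{mn}(W)=x$. The infimum of $\lambda_{mn}$ over $\mathcal{D}$ is $-\frac12$ and is attained; the supremum is $0$ and is not attained. (iv) For $W\in\mathcal{D}$, $\lambda_{mn}(W)=-\frac12$ if and only if $W=|\psi\rangle\langle\psi|^\Gamma$ for a unit vector $|\psi\rangle$ having exactly two nonzero Schmidt coefficients, both equal to $\frac{\sqrt2}{2}$. (v) For each $x\in(\frac{1}{mn-1},1)$ there is $W\in\mathcal{D}$ with $\lambda_1(W)=x$. The infimum of $\lambda_1$ over $\mathcal{D}$ is $\frac{1}{mn-1}$ and is not attained; the supremum is $1$ and is not attained. (vi) Every $W\in\mathcal{D}$ satisfies $0<\mathcal{N}(W)\le\frac{m-1}{2}$. For each $x\in(0,\frac{m-1}{2}]$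 there is $W\in\mathcal{D}$ with $\mathcal{N}(W)=x$. The supremum $\frac{m-1}{2}$ is attained and the infimum $0$ is not attained. (vii) For integers $1\le j\le\lfloor n/m\rfloor$ let $|\Phi_j\rangle:=\frac{1}{\sqrt m}\sum_{i=1}^m|i\rangle\otimes|i+(j-1)m\rangle\in\mathbb{C}^m\otimes\mathbb{C}^n$. Then for $W\in\mathcal{D}$, $\mathcal{N}(W)=\frac{m-1}{2}$ if and only if there exist unitaries $U\in M_m(\mathbb{C})$, $V\in M_n(\mathbb{C})$ and an integer $1\le k\le\lfloor n/m\rfloor$ such that $(U\otimes V)W(U\otimes V)^\dagger$ is a convex combination of $|\Phi_1\rangle\langle\Phi_1|^\Gamma,\dots,|\Phi_k\rangle\langle\Phi_k|^\Gamma$. (viii) Let $m=2$. The infimum of $\sum_{i=3}^{2n}\lambda_i(W)$ over $\mathcal{D}$ is $-\frac{1}{2+2\sqrt2}$, and it is attained by $W=|\phi\rangle\langle\phi|^\Gamma$ with $|\phi\rangle=x_1|11\rangle+x_2|22\rangle$, where $x_1,x_2>0$, $x_1^2+x_2^2=1$ and $x_1^2+x_1x_2=1+\frac{1}{2+2\sqrt2}$ (numerically $x_1\approx0.92388$, $x_2\approx0.382683$). For every $4\le k\le 2n$, the infimum of $\sum_{i=k}^{2n}\lambda_i(W)$ over $\mathcal{D}$ is $-\frac12$, attained by the partial transpose of a maximally entangled pure state of $\mathbb{C}^2\otimes\mathbb{C}^n$ (i.e. a unit vector with Schmidt coefficients $\frac{1}{\sqrt2},\frac{1}{\sqrt2}$).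 (ix) Let $3\le m\le n$. The infimum of $\lambda_{mn}+\lambda_{mn-1}$ over $\mathcal{D}$ is $-\frac{\sqrt2}{2}$, attained by $|\psi\rangle\langle\psi|^\Gamma$ for a unit vector $|\psi\rangle$ whose nonzero Schmidt coefficients are $\frac{\sqrt2}{2},\frac12,\frac12$. The infimum of $\lambda_{mn}+\lambda_{mn-1}+\lambda_{mn-2}$ over $\mathcal{D}$ is $-1$, attained by the partial transpose of a two-qutrit maximally entangled state (a unit vector with three nonzero Schmidt coefficients all equal to $\frac{1}{\sqrt3}$).
   Context: For $M\in M_m(\mathbb{C})\otimes M_n(\mathbb{C})$, the partial transpose is $M^\Gamma:=(T\otimes \mathrm{id})(M)$, where $T$ is the transpose on the first factor (with respect to the standard basis). A Hermitian $W\in M_m(\mathbb{C})\otimes M_n(\mathbb{C})$ is block-positive if $\langle a,b|W|a,b\rangle\ge0$ for all $|a\rangle\in\mathbb{C}^m,|b\rangle\in\mathbb{C}^n$; it is an entanglement witness (EW) if it is block-positive and has at least one negative eigenvalue. An EW is decomposable (DEW) if $W=P+Q^\Gamma$ for some positive semidefinite $P,Q$, and nondecomposable otherwise. Normalized means $\operatorname{tr}W=1$. Eigenvalues of a Hermitian matrix are listed in non-increasing order $\lambda_1\ge\lambda_2\ge\cdots$. For Hermitian trace-one $M$, $\mathcal{N}(M):=\frac{\|M\|_1-1}{2}$, i.e. the absolute value of the sum of the negative eigenvalues of $M$, where $\|\cdot\|_1$ is the trace norm. $|i\rangle$ denotes the standard basis vectors; $|ij\rangle=|i\rangle\otimes|j\rangle$.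 *)

(* Defs.v *)
From HB Require Import structures.
From mathcomp Require Import all_boot all_order all_algebra.
From mathcomp Require Import reals complex.
Set Implicit Arguments. Unset Strict Implicit. Unset Printing Implicit Defensive.
Import Order.TTheory GRing.Theory Num.Theory.
Local Open Scope ring_scope.

(* ---------- tensor indexing: |i j> <-> index i*n + j of C^(m*n) ---------- *)

Lemma idx1_lt m n (a : 'I_(m * n)) : (a %/ n < m)%N.
Proof.
case: n a => [|n] a; first by case: a => k; rewrite muln0.
by rewrite ltn_divLR // mulnC (ltn_ord a).
Qed.

Lemma idx2_lt m n (a : 'I_(m * n)) : (a %% n < n)%N.
Proof.
case: n a => [|n] a; first by case: a => k; rewrite muln0.
by rewrite ltn_pmod.
Qed.

Definition idx1 m n (a : 'I_(m * n)) : 'I_m := Ordinal (idx1_lt a).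
Definition idx2 m n (a : 'I_(m * n)) : 'I_n := Ordinal (idx2_lt a).

Lemma tidx_lt m n (i : 'I_m) (j : 'I_n) : (i * n + j < m * n)%N.
Proof.
apply: (@leq_trans (i * n + n)); first by rewrite ltn_add2l.
by rewrite addnC -mulSn leq_mul2r ltn_ord orbT.
Qed.

Definition tidx m n (i : 'I_m) (j : 'I_n) : 'I_(m * n) := Ordinal (tidx_lt i j).

Definition mxadj (R : realType) p q (A : 'M[R[i]]_(p, q)) : 'M[R[i]]_(q, p) :=
  map_mx Num.conj A^T.

Definition kron (R : realType) m n (a : 'cV[R[i]]_m) (b : 'cV[R[i]]_n)
  : 'cV[R[i]]_(m * n) := \col_k (a (idx1 k) 0 * b (idx2 k) 0).

Definition tensmx (R : realType) m n (U : 'M[R[i]]_m) (V : 'M[R[i]]_n)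
  : 'M[R[i]]_(m * n) :=
  \matrix_(k, l) (U (idx1 k) (idx1 l) * V (idx2 k) (idx2 l)).

(* standard basis vector |i j> of C^m (x) C^n (0-indexed: i < m, j < n) *)
Definition ket (R : realType) m n (i j : nat) : 'cV[R[i]]_(m * n) :=
  \col_k (((idx1 k == i :> nat) && (idx2 k == j :> nat))%:R).

(* partial transpose  M^Gamma = (T (x) id)(M):
   <i j| M^Gamma |k l> = <k j| M |i l> *)
Definition ptrans (R : realType) m n (M : 'M[R[i]]_(m * n)) : 'M[R[i]]_(m * n) :=
  \matrix_(a, b) M (tidx (idx1 b) (idx2 a)) (tidx (idx1 a) (idx2 b)).

Definition hermitian (R : realType) p (A : 'M[R[i]]_p) : Prop := mxadj A = A.

Definition psd (R : realType) p (P : 'M[R[i]]_p) : Prop :=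
  forall x : 'cV[R[i]]_p, 0 <= (mxadj x *m P *m x) 0 0.

Definition block_positive (R : realType) m n (W : 'M[R[i]]_(m * n)) : Prop :=
  hermitian W /\
  forall (a : 'cV[R[i]]_m) (b : 'cV[R[i]]_n),
    0 <= (mxadj (kron a b) *m W *m kron a b) 0 0.

Definition EW (R : realType) m n (W : 'M[R[i]]_(m * n)) : Prop :=
  block_positive W /\ exists l : R[i], eigenvalue W l /\ l < 0.

Definition DEW (R : realType) m n (W : 'M[R[i]]_(m * n)) : Prop :=
  EW W /\ exists P Q : 'M[R[i]]_(m * n), psd P /\ psd Q /\ W = P + ptrans Q.

Definition inD (R : realType) m n (W : 'M[R[i]]_(m * n)) : Prop :=
  DEW W /\ \tr W = 1.

Definition spectrum (R : realType) p (W : 'M[R[i]]_p) (s : seq R) : Prop :=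
  size s = p /\ sorted (fun x y => y <= x) s /\
  char_poly W = \prod_(x <- s) ('X - ((x%:C)%C)%:P).

Definition lam (R : realType) (s : seq R) (k : nat) : R := nth 0 s k.-1.

(* tr(W^2) (a real number for Hermitian W) *)
Definition trsq (R : realType) p (W : 'M[R[i]]_p) : R := complex.Re (\tr (W *m W)).

(* N(W) = (||W||_1 - 1)/2, the trace norm of Hermitian W being the sum of the
   absolute values of its eigenvalues s *)
Definition negativity (R : realType) (s : seq R) : R :=
  (\sum_(x <- s) `|x| - 1) / 2.

Definition unit_vec (R : realType) p (psi : 'cV[R[i]]_p) : Prop :=
  mxadj psi *m psi = 1%:M.

Definition entangled (R : realType) m n (psi : 'cV[R[i]]_(m * n)) : Prop :=
  ~ exists (a : 'cV[R[i]]_m) (b : 'cV[R[i]]_n), psi = kron a b.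

Definition proj (R : realType) p (psi : 'cV[R[i]]_p) : 'M[R[i]]_p :=
  psi *m mxadj psi.

Definition unitary (R : realType) p (U : 'M[R[i]]_p) : Prop :=
  U \is unitarymx.

Definition schmidt_coeffs (R : realType) m n (psi : 'cV[R[i]]_(m * n)) (c : seq R)
  : Prop :=
  all (fun x => 0 < x) c /\
  exists (u : 'M[R[i]]_(m, size c)) (v : 'M[R[i]]_(n, size c)),
    mxadj u *m u = 1%:M /\ mxadj v *m v = 1%:M /\
    psi = \sum_(k < size c) (c`_k)%:C%C *: kron (col k u) (col k v).

(* Phi m n j = |Phi_(j+1)> = 1/sqrt m sum_(i<m) |i> (x) |i + j m>
   (0-indexed: j < n %/ m) *)
Definition Phi (R : realType) m n (j : nat) : 'cV[R[i]]_(m * n) :=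
  \col_k (if (nat_of_ord (idx2 k) == (nat_of_ord (idx1 k) + j * m)%N)
          then ((Num.sqrt (m%:R : R))^-1)%:C%C else 0).

Definition valsW (R : realType) m n (f : 'M[R[i]]_(m * n) -> R) : R -> Prop :=
  fun y => exists W : 'M[R[i]]_(m * n), inD W /\ f W = y.

Definition valsS (R : realType) m n (f : seq R -> R) : R -> Prop :=
  fun y => exists (W : 'M[R[i]]_(m * n)) (s : seq R),
    inD W /\ spectrum W s /\ f s = y.

Definition is_inf (R : realType) (P : R -> Prop) (a : R) : Prop :=
  (forall y, P y -> a <= y) /\
  (forall e, 0 < e -> exists y, P y /\ y < a + e).

Definition is_sup (R : realType) (P : R -> Prop) (a : R) : Prop :=
  (forall y, P y -> y <= a) /\
  (forall e, 0 < e -> exists y, P y /\ a - e < y).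

Arguments valsW {R} m n f _.
Arguments valsS {R} m n f _.

(* Main.v *)
(** By Ky Fan's principle, sums of extreme eigenvalues of a Hermitian [W], and its
    negativity, are extrema of [tr (W T)] over the operators [0 <= T <= 1] with a
    prescribed (or free) trace. For [W = P + Q^Gamma] one has
    [tr (W T) >= tr (Q^Gamma T)], so a lower bound [- c] valid for all
    [|psi><psi|^Gamma] holds for [W] with the factor [tr Q <= 1]. In Schmidt form
    [psi = sum a_i |ii>], [tr (|psi><psi|^Gamma T) = sum a_i a_k Re <ki|T|ik>], where
    the off-diagonal entries of [T] are controlled by the diagonal ones; what remains
    are elementary inequalities in the sorted coefficients [a_i].

    Equality forces [P = 0] and puts the range of [Q] in the kernel of the positive
    operator [T^Gamma + c]. For the smallest eigenvalue, [T = |x><x|], and by duality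
    that kernel is the [-1/2]-eigenspace of [|x><x|^Gamma], a line. For the
    negativity, every kernel vector, seen as an [m x n] matrix [A], satisfies
    [A A^* = |A|^2 / m]; polarizing, orthonormal kernel vectors stack to a matrix with
    orthonormal rows, and completing it to a unitary maps them to the [Phi_j]. *)
Require Import Defs.
From HB Require Import structures.
From mathcomp Require Import all_boot all_order all_algebra.
From mathcomp Require Import reals complex.
From mathcomp Require Import perm ring lra.
Import Order.TTheory GRing.Theory Num.Theory.
Local Open Scope ring_scope.

Set Implicit Arguments.
Unset Strict Implicit.
Unset Printing Implicit Defensive.

(** * Adjoints, real traces and positive semidefinite forms *)

Section Adjoint.
Variable R : realType.
Local Notation C := R[i].

(** The eigenvalues of |psi><psi|^Gamma are a_i^2 on |ii> and +-a_i a_k on (|ik> +- |ki>)/sqrt 2,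
    but no spectrum is computed: one inequality comes from a bound over all [T], the other from an
    explicit [T], typically a sum of projectors on such vectors.

    The bounds are a small linear program. An off-diagonal entry r of [T] obeys |2r| <= d_ik + d_ki,
    which costs trace, and |2r| <= 1, which does not; the dual variables are a threshold for the
    products a_i a_k and the excesses above it. The constants are maxima, over unit vectors, of sums
    of a_i a_k along a graph: one edge gives 1/2, two edges with a common vertex sqrt 2 / 2, a
    triangle 1, the complete graph (m - 1)/2. For m = 2, the tail from the third eigenvalue is 1
    minus the two largest, and these are bounded by the top eigenvalue (1 + sqrt 2)/2 of the form
    x^2 + x y.

    The statements on tr (W^2) lie outside this scheme. They rest on Cauchy-Schwarz, for the
    eigenvalues in the lower bound and for the pair P, Q^Gamma in the upper one. *)

Lemma mxadjE p q (A : 'M[C]_(p, q)) i j : mxadj A i j = Num.conj (A j i).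
Proof. by rewrite !mxE. Qed.

Lemma mxadjK p q (A : 'M[C]_(p, q)) : mxadj (mxadj A) = A.
Proof. by apply/matrixP => i j; rewrite !mxadjE conjCK. Qed.

Lemma mxadjM p q r (A : 'M[C]_(p, q)) (B : 'M[C]_(q, r)) :
  mxadj (A *m B) = mxadj B *m mxadj A.
Proof. by rewrite /mxadj trmx_mul map_mxM. Qed.

Lemma mxadjD p q (A B : 'M[C]_(p, q)) : mxadj (A + B) = mxadj A + mxadj B.
Proof. by rewrite /mxadj linearD map_mxD. Qed.

Lemma mxadjN p q (A : 'M[C]_(p, q)) : mxadj (- A) = - mxadj A.
Proof. by apply/matrixP => i j; rewrite !mxE rmorphN. Qed.

Lemma mxadjB p q (A B : 'M[C]_(p, q)) : mxadj (A - B) = mxadj A - mxadj B.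
Proof. by rewrite mxadjD mxadjN. Qed.

Lemma mxadjZ p q a (A : 'M[C]_(p, q)) : mxadj (a *: A) = Num.conj a *: mxadj A.
Proof. by apply/matrixP => i j; rewrite !mxE rmorphM. Qed.

Lemma conj_real (x : R) : Num.conj (x%:C)%C = (x%:C)%C :> C.
Proof. exact: conjc_real. Qed.

Lemma mxadj1 p : mxadj (1%:M : 'M[C]_p) = 1%:M.
Proof. by apply/matrixP => i j; rewrite !mxE rmorph_nat eq_sym. Qed.

Lemma mxadj0 p q : mxadj (0 : 'M[C]_(p, q)) = 0.
Proof. by apply/matrixP => i j; rewrite !mxE rmorph0. Qed.

Lemma mxadj_sum I (r : seq I) (P : pred I) p q (F : I -> 'M[C]_(p, q)) :
  mxadj (\sum_(i <- r | P i) F i) = \sum_(i <- r | P i) mxadj (F i).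
Proof. by elim/big_rec2: _ => [|i y1 y2 _ <-]; rewrite ?mxadj0 ?mxadjD. Qed.

Lemma mxadj_diag p (d : 'I_p -> R) :
  mxadj (diag_mx (\row_i (d i)%:C%C)) = diag_mx (\row_i (d i)%:C%C) :> 'M[C]_p.
Proof.
apply/matrixP => i j; rewrite !mxE eq_sym; case: eqP => [->|_].
  by rewrite !mulr1n conj_real.
by rewrite !mulr0n rmorph0.
Qed.

Lemma mxadj_tr p (A : 'M[C]_p) : \tr (mxadj A) = Num.conj (\tr A).
Proof. by rewrite /mxtrace rmorph_sum; apply: eq_bigr => i _; rewrite mxadjE. Qed.

Lemma ReD (x y : C) : complex.Re (x + y) = complex.Re x + complex.Re y.
Proof. by case: x; case: y. Qed.

Lemma ReN (x : C) : complex.Re (- x) = - complex.Re x.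
Proof. by case: x. Qed.

Lemma ReZ (a : R) (x : C) : complex.Re ((a%:C)%C * x) = a * complex.Re x.
Proof. by case: x => x y /=; rewrite mul0r subr0. Qed.

Lemma Re_sum I (r : seq I) (P : pred I) (F : I -> C) :
  complex.Re (\sum_(i <- r | P i) F i) = \sum_(i <- r | P i) complex.Re (F i).
Proof. by elim/big_rec2: _ => [//|i y1 y2 _ <-]; rewrite ReD. Qed.

Lemma Re_conj (x : C) : complex.Re (Num.conj x) = complex.Re x.
Proof. by case: x. Qed.

(** The squared modulus as an element of [R]; the norm of [R[i]] takes its values in [R[i]]. *)
Definition nc (z : C) : R := complex.Re z ^+ 2 + complex.Im z ^+ 2.

Lemma nc_ge0 z : 0 <= nc z. Proof. by rewrite addr_ge0 ?sqr_ge0. Qed.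

Lemma ncE z : Num.conj z * z = ((nc z)%:C)%C.
Proof. by case: z => x y; apply/eqP; rewrite eq_complex /= /nc /=; apply/andP; split; apply/eqP; ring. Qed.

Lemma nc_eq0 z : (nc z == 0) = (z == 0).
Proof.
apply/eqP/eqP => [h|->]; last by rewrite /nc /= expr0n addr0.
apply/eqP; have := congr1 (fun x => (x%:C)%C) h.
rewrite -ncE => /eqP; rewrite mulf_eq0 conjC_eq0 orbb; exact.
Qed.

Lemma ncM y z : nc (y * z) = nc y * nc z.
Proof. by case: y => a b; case: z => c d; rewrite /nc /=; ring. Qed.

Lemma nc_conj z : nc (Num.conj z) = nc z.
Proof. by case: z => a b; rewrite /nc /=; ring. Qed.

Lemma nc_real (x : R) : nc (x%:C)%C = x ^+ 2.
Proof. by rewrite /nc /= expr0n addr0. Qed.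

Lemma Re_cross (y z : C) : `|2 * complex.Re (Num.conj y * z)| <= nc y + nc z.
Proof.
case: y => a b; case: z => c d; rewrite /nc /= ler_norml.
have := sqr_ge0 (a - c); have := sqr_ge0 (b - d).
have := sqr_ge0 (a + c); have := sqr_ge0 (b + d).
by rewrite !expr2 => *; apply/andP; split; nra.
Qed.

Definition nsq p (x : 'cV[C]_p) : R := \sum_i nc (x i 0).

Lemma nsq_ge0 p (x : 'cV[C]_p) : 0 <= nsq x.
Proof. by apply: sumr_ge0 => i _; apply: nc_ge0. Qed.

Lemma nsqE p (x : 'cV[C]_p) : mxadj x *m x = ((nsq x)%:C)%C%:M.
Proof.
apply/matrixP => i j; rewrite !ord1 !mxE eqxx mulr1n rmorph_sum.
by apply: eq_bigr => k _; rewrite mxadjE ncE.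
Qed.

Lemma nsqE0 p (x : 'cV[C]_p) : (mxadj x *m x) 0 0 = ((nsq x)%:C)%C.
Proof. by rewrite nsqE mxE eqxx mulr1n. Qed.

Lemma nsq_eq0 p (x : 'cV[C]_p) : nsq x = 0 -> x = 0.
Proof.
move=> h; apply/matrixP => i j; rewrite ord1 mxE; apply/eqP; rewrite -nc_eq0.
by apply/eqP; move/psumr_eq0P: h => -> // k _; apply: nc_ge0.
Qed.

Lemma nsqZ p a (x : 'cV[C]_p) : nsq (a *: x) = nc a * nsq x.
Proof. by rewrite /nsq mulr_sumr; apply: eq_bigr => i _; rewrite mxE ncM. Qed.

Lemma unit_vecP p (x : 'cV[C]_p) : unit_vec x <-> nsq x = 1.
Proof.
rewrite /unit_vec nsqE; split=> [/matrixP /(_ 0 0)|->]; last by [].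
by rewrite !mxE eqxx !mulr1n => -[].
Qed.

(* Real parts of traces and forms, so that all inequalities live in the ordered
   field [R] rather than in [R[i]], whose order is partial. *)
Definition rtr p (M : 'M[C]_p) : R := complex.Re (\tr M).

Lemma rtrD p (A B : 'M[C]_p) : rtr (A + B) = rtr A + rtr B.
Proof. by rewrite /rtr raddfD ReD. Qed.

Lemma rtrN p (A : 'M[C]_p) : rtr (- A) = - rtr A.
Proof. by rewrite /rtr raddfN ReN. Qed.

Lemma rtrB p (A B : 'M[C]_p) : rtr (A - B) = rtr A - rtr B.
Proof. by rewrite rtrD rtrN. Qed.

Lemma rtrZ p a (A : 'M[C]_p) : rtr ((a%:C)%C *: A) = a * rtr A.
Proof. by rewrite /rtr linearZ ReZ. Qed.

Lemma rtr_sum p I (r : seq I) (P : pred I) (F : I -> 'M[C]_p) :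
  rtr (\sum_(i <- r | P i) F i) = \sum_(i <- r | P i) rtr (F i).
Proof. by rewrite /rtr (raddf_sum (@mxtrace C p)) Re_sum. Qed.

Lemma rtrC p q (A : 'M[C]_(p, q)) (B : 'M[C]_(q, p)) : rtr (A *m B) = rtr (B *m A).
Proof. by rewrite /rtr mxtrace_mulC. Qed.

Lemma rtr1 p : rtr (1%:M : 'M[C]_p) = p%:R.
Proof. by rewrite /rtr mxtrace1 -(rmorph_nat (real_complex R)). Qed.

Lemma rtr0 p : rtr (0 : 'M[C]_p) = 0.
Proof. by rewrite /rtr mxtrace0. Qed.

(** The form is a trace against [proj x], so that a vector serves directly as a rank-one test
    operator. *)
Definition qf p (M : 'M[C]_p) (x : 'cV[C]_p) : R := rtr (M *m proj x).

Lemma qfE p (M : 'M[C]_p) x : qf M x = complex.Re ((mxadj x *m M *m x) 0 0).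
Proof. by rewrite /qf /proj mulmxA rtrC mulmxA /rtr /mxtrace big_ord1. Qed.

Lemma qfD p (A B : 'M[C]_p) x : qf (A + B) x = qf A x + qf B x.
Proof. by rewrite /qf mulmxDl rtrD. Qed.

Lemma qfB p (A B : 'M[C]_p) x : qf (A - B) x = qf A x - qf B x.
Proof. by rewrite /qf mulmxBl rtrB. Qed.

Lemma qfZ p a (A : 'M[C]_p) x : qf ((a%:C)%C *: A) x = a * qf A x.
Proof. by rewrite /qf -scalemxAl rtrZ. Qed.

Lemma qf1 p (x : 'cV[C]_p) : qf 1%:M x = nsq x.
Proof. by rewrite qfE mulmx1 nsqE0. Qed.

Lemma qf_mul p q (A : 'M[C]_p) (F : 'M[C]_(p, q)) x :
  qf A (F *m x) = qf (mxadj F *m A *m F) x.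
Proof. by rewrite !qfE mxadjM !mulmxA. Qed.

Lemma rtr_proj p (x : 'cV[C]_p) : rtr (proj x) = nsq x.
Proof. by rewrite -qf1 /qf mul1mx. Qed.

Lemma mxadj_proj p (x : 'cV[C]_p) : mxadj (proj x) = proj x.
Proof. by rewrite /proj mxadjM mxadjK. Qed.

Lemma qf_proj p (x y : 'cV[C]_p) : qf (proj y) x = nc ((mxadj y *m x) 0 0).
Proof.
rewrite qfE /proj mulmxA -mulmxA.
have -> : mxadj x *m y = mxadj (mxadj y *m x) by rewrite mxadjM mxadjK.
by rewrite mxE big_ord1 mxadjE ncE.
Qed.

Lemma qfEC p (M : 'M[C]_p) x : mxadj M = M ->
  (mxadj x *m M *m x) 0 0 = ((qf M x)%:C)%C.
Proof.
move=> hM; rewrite qfE; set z := (_ *m x) 0 0.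
have : Num.conj z = z.
  by rewrite /z -mxadjE !mxadjM mxadjK hM mulmxA.
by case: z => a b [h]; apply/eqP; rewrite eq_complex /= eqxx /=; apply/eqP; lra.
Qed.

(* Polarization: both [x = e_a + e_b] and [x = e_a + i e_b] are needed to kill
   the (a, b) entry. *)
Lemma form0 p (H : 'M[C]_p) :
  (forall x : 'cV[C]_p, (mxadj x *m H *m x) 0 0 = 0) -> H = 0.
Proof.
move=> h0; pose e (a : 'I_p) : 'cV[C]_p := delta_mx a 0.
have hb a b : (mxadj (e a) *m H *m e b) 0 0 = H a b.
  have -> : mxadj (e a) = delta_mx 0 a.
    by apply/matrixP => i j; rewrite !mxE andbC rmorph_nat.
  by rewrite -rowE -colE !mxE.
have hs a b c : Num.conj c * H b a + c * H a b = 0.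
  have := h0 (e a + c *: e b).
  rewrite mxadjD mxadjZ !(mulmxDl, mulmxDr) -!scalemxAl -!scalemxAr.
  have mxD (A B : 'M[C]_1) : (A + B) 0 0 = A 0 0 + B 0 0 by rewrite mxE.
  have mxZ k (A : 'M[C]_1) : (k *: A) 0 0 = k * A 0 0 by rewrite mxE.
  rewrite !mxD !mxZ !hb.
  by have := h0 (e a); have := h0 (e b); rewrite !hb => -> ->; rewrite add0r !mulr0 addr0 addrC.
apply/matrixP => a b; rewrite mxE.
have h1 := hs a b 1; have h2 := hs a b 'i.
rewrite conjCi in h2; rewrite rmorph1 !mul1r in h1.
have h3 : 'i * (2 * H a b) = 0.
  by rewrite -h2; move/eqP: h1; rewrite addr_eq0 => /eqP ->; ring.
move/eqP: h3; rewrite mulf_eq0 (negPf (neq0Ci _)) /= mulf_eq0 pnatr_eq0 /=.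
by move/eqP.
Qed.

(** In [R[i]], [0 <= z] includes that [z] is real. The form of [P - mxadj P] therefore vanishes
    identically and [form0] applies. *)
Lemma psd_herm p (P : 'M[C]_p) : psd P -> mxadj P = P.
Proof.
move=> hP; apply/esym/eqP; rewrite -subr_eq0; apply/eqP/form0 => x.
have hc : (mxadj x *m mxadj P *m x) 0 0 = Num.conj ((mxadj x *m P *m x) 0 0).
  by rewrite -mxadjE !mxadjM mxadjK mulmxA.
have -> : (mxadj x *m (P - mxadj P) *m x) 0 0 =
    (mxadj x *m P *m x) 0 0 - (mxadj x *m mxadj P *m x) 0 0.
  by rewrite mulmxBr mulmxBl !mxE.
by rewrite hc (conj_Creal (ger0_real (hP x))) subrr.
Qed.

Lemma psdP p (P : 'M[C]_p) : psd P <-> mxadj P = P /\ forall x, 0 <= qf P x.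
Proof.
split=> [hP|[hP h] x]; last by rewrite qfEC // ler0c.
split=> [|x]; first exact: psd_herm.
by have := hP x; rewrite (qfEC x (psd_herm hP)) ler0c.
Qed.

Lemma psdD p (A B : 'M[C]_p) : psd A -> psd B -> psd (A + B).
Proof. by move=> hA hB x; rewrite mulmxDr mulmxDl mxE addr_ge0. Qed.

Lemma psdZ p a (A : 'M[C]_p) : 0 <= a -> psd A -> psd ((a%:C)%C *: A).
Proof. by move=> ha hA x; rewrite -scalemxAr -scalemxAl mxE mulr_ge0 // ler0c. Qed.

Lemma psd0 p : psd (0 : 'M[C]_p).
Proof. by move=> x; rewrite mulmx0 mul0mx mxE. Qed.

Lemma psd_sum I (r : seq I) (P : pred I) p (F : I -> 'M[C]_p) :
  (forall i, P i -> psd (F i)) -> psd (\sum_(i <- r | P i) F i).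
Proof. by move=> h; elim/big_rec: _ => [|i A Pi hA]; [exact: psd0 | apply: psdD => //; exact: h]. Qed.

Lemma psd_proj p (x : 'cV[C]_p) : psd (proj x).
Proof. by apply/psdP; split=> [|y]; rewrite ?mxadj_proj // qf_proj nc_ge0. Qed.

Lemma psd_congr p q (A : 'M[C]_p) (F : 'M[C]_(p, q)) : psd A -> psd (mxadj F *m A *m F).
Proof. by move=> hA x; have := hA (F *m x); rewrite mxadjM !mulmxA. Qed.

Lemma psd1 p : psd (1%:M : 'M[C]_p).
Proof. by apply/psdP; split=> [|x]; rewrite ?mxadj1 // qf1 nsq_ge0. Qed.

End Adjoint.

(** * Spectral decomposition, effects and Ky Fan's inequality *)

Section Spectral.
Variable R : realType.
Local Notation C := R[i].

Lemma unitaryP p (U : 'M[C]_p) :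
  unitary U <-> U *m mxadj U = 1%:M /\ mxadj U *m U = 1%:M.
Proof.
split=> [/unitarymxP h|[h _]]; last by apply/unitarymxP.
by split=> //; apply: mulmx1C.
Qed.

(* The columns of [U] are eigenvectors of [W]. *)
Definition eigdec p (W : 'M[C]_p) (d : 'I_p -> R) (U : 'M[C]_p) :=
  unitary U /\ W = U *m diag_mx (\row_i (d i)%:C%C) *m mxadj U.

Lemma udiag_sum p (d : 'I_p -> R) (U : 'M[C]_p) :
  U *m diag_mx (\row_i (d i)%:C%C) *m mxadj U =
  \sum_i (d i)%:C%C *: proj (col i U).
Proof.
apply/matrixP => a b; rewrite mul_mx_diag !mxE summxE; apply: eq_bigr => i _.
by rewrite !mxE big_ord1 !mxE mulrAC mulrC.
Qed.

Lemma unitary_sum p (U : 'M[C]_p) : unitary U -> \sum_i proj (col i U) = 1%:M.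
Proof.
move=> /unitaryP [h _]; rewrite -{}h; apply/matrixP => a b.
by rewrite summxE mxE; apply: eq_bigr => i _; rewrite !mxE big_ord1 !mxE.
Qed.

Lemma unitary_col p (U : 'M[C]_p) i j : unitary U ->
  (mxadj (col i U) *m col j U) 0 0 = (i == j)%:R.
Proof.
move=> /unitaryP [_ /matrixP /(_ i j)]; rewrite [in RHS]mxE => <-.
by rewrite !mxE; apply: eq_bigr => k _; rewrite !mxE.
Qed.

Lemma nsq_col p (U : 'M[C]_p) i : unitary U -> nsq (col i U) = 1.
Proof.
by move=> hU; have := unitary_col i i hU; rewrite eqxx nsqE0 => -[].
Qed.

Lemma rtr_eig p (W : 'M[C]_p) d U T : eigdec W d U ->
  rtr (W *m T) = \sum_i d i * qf T (col i U).
Proof.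
move=> [_ ->]; rewrite udiag_sum mulmx_suml rtr_sum.
by apply: eq_bigr => i _; rewrite -scalemxAl rtrZ rtrC.
Qed.

Lemma rtr_col p (T U : 'M[C]_p) : unitary U -> rtr T = \sum_i qf T (col i U).
Proof.
move=> hU; rewrite -{1}[T]mulmx1 -(unitary_sum hU) mulmx_sumr rtr_sum.
exact: eq_bigr.
Qed.

Lemma qf_eig p (W : 'M[C]_p) d U i : eigdec W d U -> qf W (col i U) = d i.
Proof.
move=> hW; rewrite /qf (rtr_eig _ hW) (bigD1 i) //= big1 ?addr0 => [|j ji].
  by rewrite qf_proj unitary_col ?eqxx; [rewrite (nc_real (1 : R)) expr1n mulr1 | case: hW].
rewrite qf_proj unitary_col; last by case: hW.
by rewrite eq_sym (negPf ji) (nc_real (0 : R)) expr0n mulr0.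
Qed.

Lemma eig_mul_col p (W : 'M[C]_p) d U i : eigdec W d U ->
  W *m col i U = (d i)%:C%C *: col i U.
Proof.
move=> [hU ->]; rewrite udiag_sum mulmx_suml (bigD1 i) //= big1 ?addr0 => [|j ji].
  rewrite -scalemxAl /proj -mulmxA [mxadj _ *m _]mx11_scalar unitary_col // eqxx.
  by rewrite mulmx1.
rewrite -scalemxAl /proj -mulmxA [mxadj _ *m _]mx11_scalar unitary_col //.
by rewrite (negPf ji) -scalemx1 scale0r mulmx0 scaler0.
Qed.

Lemma herm_eig p (W : 'M[C]_p) : mxadj W = W -> exists d U, eigdec W d U.
Proof.
move=> hW.
have hH : W \is hermsymmx.
  by apply/is_hermitianmxP; rewrite expr0 scale1r; apply/esym.
have /orthomx_spectralP hE := hermitian_normalmx hH.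
have hr := hermitian_spectral_diag_real hH.
have hU := spectral_unitarymx W.
move: (spectralmx W) (spectral_diag W) hE hr hU => P sp hE hr hU.
rewrite (invmx_unitary hU) in hE.
(* The spectral theorem diagonalizes with eigenvectors in the rows of [P], up to conjugation;
   [eigdec] wants them as columns, hence the adjoint. *)
exists (fun i => complex.Re (sp 0 i)), (mxadj P); split.
  by apply/unitaryP; rewrite mxadjK; split; [apply: mulmx1C|]; apply/unitarymxP.
have -> : \row_i (complex.Re (sp 0 i))%:C%C = sp.
  apply/rowP => i; rewrite mxE; apply/eqP.
  have := mxOverP hr 0 i; rewrite realE !lecE /=.
  by case: (sp 0 i) => a b /= /orP[/andP[/eqP -> _]|/andP[/eqP <- _]]; rewrite eq_complex /= !eqxx.
by rewrite mxadjK.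
Qed.

Lemma eig_char_poly p (W : 'M[C]_p) d U : eigdec W d U ->
  char_poly W = \prod_i ('X - ((d i)%:C%C)%:P).
Proof.
move=> [/unitaryP [hU _] ->]; set D := diag_mx _.
have -> : char_poly (U *m D *m mxadj U) = char_poly D.
  rewrite /char_poly /char_poly_mx.
  have hX : 'X%:M - map_mx polyC (U *m D *m mxadj U) =
     map_mx polyC U *m ('X%:M - map_mx polyC D) *m map_mx polyC (mxadj U).
    rewrite mulmxBr mulmxBl -!map_mxM; congr (_ - _).
    by rewrite scalar_mxC -mulmxA -map_mxM hU map_mx1 mulmx1.
  rewrite hX !det_mulmx mulrAC -det_mulmx -map_mxM hU map_mx1 det1 mul1r //.
rewrite char_poly_trig ?diag_mx_is_trig //.
by apply: eq_bigr => i _; rewrite !mxE eqxx mulr1n.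
Qed.

Definition ge_rel : rel R := fun x y => y <= x.

Lemma spectrum_exists p (W : 'M[C]_p) : mxadj W = W -> exists s, spectrum W s.
Proof.
move=> /herm_eig [d [U hW]]; exists (sort ge_rel (codom d)); split; last split.
- by rewrite size_sort size_codom card_ord.
- by apply: sort_sorted => x y; rewrite /ge_rel le_total.
- rewrite (eig_char_poly hW) (perm_big (codom d)) ?perm_sort //.
  by rewrite /= big_image.
Qed.

(** [spectrum] ties [s] to [W] through the characteristic polynomial only. Unique factorization
    makes [s] a permutation of any list of eigenvalues, and the columns of [U] are permuted
    accordingly. *)
Lemma spectrum_eig p (W : 'M[C]_p) s : mxadj W = W -> spectrum W s ->
  exists U, eigdec W (fun i => s`_i) U.
Proof.
move=> /herm_eig [d [U hW]] [hs [_ hc]].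
have : perm_eq s (codom d).
  apply: (perm_map_inj (@complexI R)); apply: prod_XsubC_eq.
  by rewrite [LHS]big_map [RHS]big_map -hc (eig_char_poly hW) big_image.
have -> : codom d = [tuple d i | i < p] by rewrite /= /codom /image_mem.
move=> /tuple_permP [q hq].
have hq' (i : 'I_p) : s`_i = d (q i).
  rewrite hq; have /= := tnth_nth 0 [tuple tnth [tuple d i | i < p] (q i) | i < p] i.
  by move=> <-; rewrite !tnth_mktuple.
case: hW => hU hW; exists (col_perm q U); split.
  apply/unitarymxP; apply/matrixP => a b.
  have /unitaryP [/matrixP /(_ a b) h _] := hU.
  rewrite -h !mxE [RHS](reindex_inj (@perm_inj _ q)) /=.
  by apply: eq_bigr => k _; rewrite !mxE.
rewrite hW !udiag_sum (reindex_inj (@perm_inj _ q)) /=; apply: eq_bigr => i _.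
rewrite hq'; congr (_ *: proj _).
by apply/matrixP => a b; rewrite !mxE.
Qed.

Lemma spectrum_le p (W : 'M[C]_p) s i j : spectrum W s -> (i <= j < p)%N -> s`_j <= s`_i.
Proof.
move=> [hs [hso _]] /andP[ij jp].
have hr : reflexive (fun x y : R => y <= x) by move=> x /=; apply: lexx.
have ht : transitive (fun x y : R => y <= x) by move=> y x z /= h1 h2; apply: le_trans h2 h1.
by apply: (sorted_leq_nth ht hr 0 hso) => //; rewrite inE hs // (leq_ltn_trans ij).
Qed.

Lemma spectrum_sum p (W : 'M[C]_p) s : mxadj W = W -> spectrum W s ->
  \sum_(i < p) s`_i = rtr W.
Proof.
move=> hW /(spectrum_eig hW) [U hU]; rewrite -[W in RHS]mulmx1 (rtr_eig _ hU).
by apply: eq_bigr => i _; rewrite qf1 nsq_col ?mulr1 //; case: hU.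
Qed.

Lemma spectrum_sqr p (W : 'M[C]_p) s : mxadj W = W -> spectrum W s ->
  \sum_(i < p) s`_i ^+ 2 = trsq W.
Proof.
move=> hW /(spectrum_eig hW) [U hU]; rewrite /trsq -/(rtr _) (rtr_eig _ hU).
by apply: eq_bigr => i _; rewrite (qf_eig _ hU) expr2.
Qed.

Lemma spectrum_neg p (W : 'M[C]_p.+1) s : spectrum W s ->
  (exists l : C, eigenvalue W l /\ l < 0) -> s`_p < 0.
Proof.
move=> hs [l [hl l0]]; have [hz [_ hc]] := hs.
move: hl; rewrite eigenvalue_root_char hc.
rewrite -(big_map (fun x => (x%:C)%C) xpredT (fun x => 'X - x%:P)) root_prod_XsubC.
move=> /mapP [x xs lx]; rewrite lx ltcR in l0.
have [ i ] := nthP 0 xs; rewrite hz => hi xi.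
by apply: le_lt_trans l0; rewrite -xi; apply: (spectrum_le hs); rewrite -ltnS hi /=.
Qed.

Lemma neg_eigenvalue p (W : 'M[C]_p) x : mxadj W = W -> qf W x < 0 ->
  exists l : C, eigenvalue W l /\ l < 0.
Proof.
move=> hW hx; have [d [U hU]] := herm_eig hW.
have [i hi] : exists i, d i < 0.
  apply/existsP; rewrite -[X in is_true X]negbK negb_exists; apply/negP => /forallP h.
  move: hx; rewrite /qf (rtr_eig _ hU) ltNge sumr_ge0 // => i _.
  by rewrite mulr_ge0 // ?qf_proj ?nc_ge0 // leNgt.
exists ((d i)%:C)%C; rewrite ltcR; split=> //.
rewrite eigenvalue_root_char (eig_char_poly hU) rootE horner_prod.
by rewrite (bigD1 i) //= !hornerE subrr mul0r.
Qed.

Lemma eig_psd_ge0 p (W : 'M[C]_p) d U i : eigdec W d U -> psd W -> 0 <= d i.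
Proof. by move=> hU /psdP [_ h]; rewrite -(qf_eig i hU). Qed.

Lemma psd_trace_mul p (A B : 'M[C]_p) : psd A -> psd B -> 0 <= rtr (A *m B).
Proof.
move=> hA /psdP [_ hB]; have [d [U hU]] := herm_eig (psd_herm hA).
rewrite (rtr_eig _ hU); apply: sumr_ge0 => i _.
by rewrite mulr_ge0 // (eig_psd_ge0 i hU).
Qed.

Lemma psd_trace_ge0 p (A : 'M[C]_p) : psd A -> 0 <= rtr A.
Proof. by move=> hA; rewrite -[A]mulmx1 psd_trace_mul //; apply: psd1. Qed.

Lemma psd_trace0 p (A : 'M[C]_p) : psd A -> rtr A = 0 -> A = 0.
Proof.
move=> hA; have [d [U hU]] := herm_eig (psd_herm hA).
rewrite (rtr_col _ (proj1 hU)) => /psumr_eq0P h0.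
have hd i : d i = 0.
  by rewrite -(qf_eig i hU) h0 // => j _; rewrite (qf_eig j hU) (eig_psd_ge0 j hU).
case: hU => _ ->; rewrite udiag_sum big1 // => i _.
by rewrite hd scale0r.
Qed.

Lemma psd_kernel p (M : 'M[C]_p) x : psd M -> qf M x = 0 -> M *m x = 0.
Proof.
move=> hM; have [d [U hU]] := herm_eig (psd_herm hM).
rewrite /qf (rtr_eig _ hU) => /psumr_eq0P h0.
case: (hU) => _ ->; rewrite udiag_sum mulmx_suml big1 // => i _.
rewrite -scalemxAl /proj -mulmxA.
have /eqP := h0 (fun j _ => mulr_ge0 (eig_psd_ge0 j hU hM) (proj2 (proj1 (psdP _) (psd_proj x)) (col j U))) i isT.
rewrite mulf_eq0 => /orP[/eqP ->|]; first by rewrite scale0r.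
rewrite qf_proj nc_eq0 => /eqP h1.
have -> : mxadj (col i U) *m x = 0.
  rewrite [LHS]mx11_scalar -[X in mxadj X *m _]mxadjK.
  rewrite mxadjK -[mxadj (col i U) *m x]mxadjK mxadjM mxadjK mxadjE h1 rmorph0.
  by rewrite -scalemx1 scale0r.
by rewrite mulmx0 scaler0.
Qed.

(** Effects rather than projections serve as test operators because they are stable under
    compression to a subspace. *)
Definition effect p (T : 'M[C]_p) := psd T /\ psd (1%:M - T).

Lemma effectC p (T : 'M[C]_p) : effect T -> effect (1%:M - T).
Proof. by move=> [h1 h2]; split=> //; rewrite opprB addrC subrK. Qed.

Lemma effectP p (T : 'M[C]_p) x : effect T -> 0 <= qf T x <= nsq x.
Proof.
move=> [/psdP [_ h1] /psdP [_ h2]]; rewrite h1 /=.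
by have := h2 x; rewrite qfB qf1 subr_ge0.
Qed.

Lemma effect_theta p (U : 'M[C]_p) (t : 'I_p -> R) : unitary U ->
  (forall i, 0 <= t i <= 1) ->
  exists T, [/\ effect T, rtr T = \sum_i t i &
     forall W d, eigdec W d U -> rtr (W *m T) = \sum_i d i * t i].
Proof.
move=> hU ht; pose T := U *m diag_mx (\row_i (t i)%:C%C) *m mxadj U.
have hT : eigdec T t U by [].
exists T; split.
- split; first by rewrite /T udiag_sum; apply: psd_sum => i _; apply: psdZ; [case/andP: (ht i) | apply: psd_proj].
  rewrite /T udiag_sum -(unitary_sum hU) -sumrB; apply: psd_sum => i _.
  have -> : proj (col i U) - (t i)%:C%C *: proj (col i U) = ((1 - t i)%:C)%C *: proj (col i U).
    by rewrite rmorphB /= scalerBl scale1r.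
  by apply: psdZ; [rewrite subr_ge0; case/andP: (ht i) | apply: psd_proj].
- by rewrite (rtr_col _ hU); apply: eq_bigr => i _; rewrite (qf_eig i hT).
- by move=> W d hW; rewrite (rtr_eig _ hW); apply: eq_bigr => i _; rewrite (qf_eig i hT).
Qed.

Lemma spectrum_effect p (W : 'M[C]_p) s (t : 'I_p -> R) :
  mxadj W = W -> spectrum W s -> (forall i, 0 <= t i <= 1) ->
  exists T, [/\ effect T, rtr T = \sum_i t i & rtr (W *m T) = \sum_(i < p) s`_i * t i].
Proof.
move=> hW hs ht; have [U hU] := spectrum_eig hW hs.
have [T [h1 h2 h3]] := effect_theta (proj1 hU) ht.
by exists T; split=> //; apply: h3.
Qed.

(** Only the diagonal of [T] in an eigenbasis of [W] matters. With [spectrum_effect], the values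
    [rtr (W *m T)] over effects are exactly the sums of eigenvalues with weights in [0, 1]. *)
Lemma effect_spectrum p (W T : 'M[C]_p) s :
  mxadj W = W -> spectrum W s -> effect T ->
  exists t : 'I_p -> R, [/\ forall i, 0 <= t i <= 1, rtr T = \sum_i t i &
     rtr (W *m T) = \sum_(i < p) s`_i * t i].
Proof.
move=> hW hs hT; have [U hU] := spectrum_eig hW hs.
exists (fun i => qf T (col i U)); split.
- by move=> i; have := effectP (col i U) hT; rewrite nsq_col //; case: hU.
- by rewrite (rtr_col _ (proj1 hU)).
- exact: rtr_eig.
Qed.

Lemma effect_proj p (x : 'cV[C]_p) : nsq x = 1 -> effect (proj x).
Proof.
move=> hx; split; first exact: psd_proj.
have hi : proj x *m proj x = proj x.
  by rewrite /proj mulmxA -[_ *m mxadj x *m x]mulmxA nsqE hx mulmx1.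
set E := _ - _.
have hE : mxadj E = E by rewrite mxadjB mxadj1 mxadj_proj.
have hEE : E *m E = E.
  by rewrite {1}/E mulmxBl mul1mx /E mulmxBr mulmx1 hi subrr subr0.
have -> : E = mxadj E *m 1%:M *m E by rewrite mulmx1 hE hEE.
exact/psd_congr/psd1.
Qed.

(* Termwise, with the pivot [s`_k.-1]. *)
Lemma fan_ineq p (s : seq R) (t : 'I_p -> R) k :
  (forall i j, (i <= j < p)%N -> s`_j <= s`_i) -> (0 < k <= p)%N ->
  (forall i, 0 <= t i <= 1) -> \sum_i t i = k%:R ->
  \sum_(i < p) s`_i * t i <= \sum_(0 <= i < k) s`_i.
Proof.
move=> hs /andP[k0 kp] ht hk.
have -> : \sum_(0 <= i < k) s`_i = \sum_(i < p) s`_i * ((i < k)%N)%:R.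
  rewrite (big_nat_widen _ _ _ _ _ kp) big_mkord [LHS]big_mkcond /=.
  by apply: eq_bigr => i _; case: (i < k)%N; rewrite ?mulr1 ?mulr0.
have hk' : \sum_(i < p) ((i < k)%N)%:R = k%:R :> R.
  rewrite -natr_sum; congr (_%:R).
  rewrite -(big_mkord xpredT (fun i => nat_of_bool (i < k)%N)) (big_cat_nat (n := k)) //=.
  rewrite (eq_big_nat _ _ (F2 := fun=> 1%N)) => [|i /andP[_ ->]] //.
  rewrite sum_nat_const_nat subn0 muln1 big_nat big1 ?addn0 // => i /andP[h _].
  by rewrite ltnNge h.
rewrite -subr_le0 -sumrB.
have -> : \sum_(i < p) (s`_i * t i - s`_i * ((i < k)%N)%:R) =
   \sum_(i < p) (s`_i - s`_k.-1) * (t i - ((i < k)%N)%:R).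
  apply/eqP; rewrite -subr_eq0 -sumrB.
  rewrite (eq_bigr (fun i : 'I_p => s`_k.-1 * (t i - ((i < k)%N)%:R))); last by move=> i _; ring.
  by rewrite -mulr_sumr sumrB hk hk' subrr mulr0.
apply: sumr_le0 => i _; have /andP[t0 t1] := ht i.
case: ltnP => ik.
  by rewrite mulr_ge0_le0 ?subr_ge0 ?subr_le0 //; apply: hs;
     apply/andP; split; [rewrite -ltnS (prednK k0) | rewrite (prednK k0)].
rewrite subr0 mulr_le0_ge0 // subr_le0; apply: hs.
by rewrite ltn_ord andbT (leq_trans _ ik) // leq_pred.
Qed.

Lemma fan_spectrum p (W T : 'M[C]_p) s k :
  mxadj W = W -> spectrum W s -> effect T -> rtr T = k%:R -> (0 < k <= p)%N ->
  rtr (W *m T) <= \sum_(0 <= i < k) s`_i.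
Proof.
move=> hW hs hT hk kp; have [t [h1 h2 ->]] := effect_spectrum hW hs hT.
apply: fan_ineq => //; last by rewrite -h2.
by move=> i j; apply: (spectrum_le hs).
Qed.

End Spectral.

(** * Tensor indices, partial transpose and Schmidt form *)

Section Tensor.
Variable R : realType.
Local Notation C := R[i].

Lemma idx1_tidx m n (i : 'I_m) (j : 'I_n) : idx1 (tidx i j) = i.
Proof.
apply: val_inj => /=; case: n j => [|n] j; first by case: j.
by rewrite divnMDl // divn_small ?addn0.
Qed.

Lemma idx2_tidx m n (i : 'I_m) (j : 'I_n) : idx2 (tidx i j) = j.
Proof. by apply: val_inj => /=; rewrite modnMDl modn_small. Qed.

Lemma tidxK m n (a : 'I_(m * n)) : tidx (idx1 a) (idx2 a) = a.
Proof. by apply: val_inj => /=; rewrite -divn_eq. Qed.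

Lemma tidx_eq m n (i i' : 'I_m) (j j' : 'I_n) :
  (tidx i j == tidx i' j') = (i == i') && (j == j').
Proof.
apply/eqP/andP => [h|[/eqP -> /eqP ->] //].
by rewrite -(idx1_tidx i j) -{2}(idx2_tidx i j) h idx1_tidx idx2_tidx !eqxx.
Qed.

Lemma sum_tidx (V : nmodType) m n (F : 'I_(m * n) -> V) :
  \sum_a F a = \sum_i \sum_j F (tidx i j).
Proof.
rewrite pair_bigA /= (reindex (fun p : 'I_m * 'I_n => tidx p.1 p.2)) //=.
exists (fun a => (idx1 a, idx2 a)) => [[i j] _|a _] /=; last exact: tidxK.
by rewrite idx1_tidx idx2_tidx.
Qed.

(** A rectangular counterpart of [tensmx]: Schmidt bases become isometries out of the small space
    C^s (x) C^s. *)
Definition tens p q m n (u : 'M[C]_(p, m)) (w : 'M[C]_(q, n)) : 'M[C]_(p * q, m * n) :=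
  \matrix_(k, l) (u (idx1 k) (idx1 l) * w (idx2 k) (idx2 l)).

Lemma tensE p q m n (u : 'M[C]_(p, m)) (w : 'M[C]_(q, n)) i j k l :
  tens u w (tidx i j) (tidx k l) = u i k * w j l.
Proof. by rewrite mxE !idx1_tidx !idx2_tidx. Qed.

Lemma tens_mul p q m n r s (u : 'M[C]_(p, m)) (w : 'M[C]_(q, n))
    (u' : 'M[C]_(m, r)) (w' : 'M[C]_(n, s)) :
  tens u w *m tens u' w' = tens (u *m u') (w *m w').
Proof.
apply/matrixP => a b; rewrite !mxE sum_tidx big_distrl /=; apply: eq_bigr => i _.
rewrite big_distrr /=; apply: eq_bigr => j _.
by rewrite !mxE !idx1_tidx !idx2_tidx mulrACA.
Qed.

Lemma tens1 m n : tens (1%:M : 'M[C]_m) (1%:M : 'M[C]_n) = 1%:M.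
Proof.
apply/matrixP => a b; rewrite !mxE -natrM mulnb; congr ((nat_of_bool _)%:R).
by rewrite -[in RHS](tidxK a) -[in RHS](tidxK b) tidx_eq.
Qed.

Lemma mxadj_tens p q m n (u : 'M[C]_(p, m)) (w : 'M[C]_(q, n)) :
  mxadj (tens u w) = tens (mxadj u) (mxadj w).
Proof. by apply/matrixP => a b; rewrite !mxE rmorphM. Qed.

Lemma tens_isometry p q m n (u : 'M[C]_(p, m)) (w : 'M[C]_(q, n)) :
  mxadj u *m u = 1%:M -> mxadj w *m w = 1%:M -> mxadj (tens u w) *m tens u w = 1%:M.
Proof. by move=> hu hw; rewrite mxadj_tens tens_mul hu hw tens1. Qed.

Definition cnj p q (u : 'M[C]_(p, q)) : 'M[C]_(p, q) := map_mx Num.conj u.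

Lemma cnj_isometry p q (u : 'M[C]_(p, q)) :
  mxadj u *m u = 1%:M -> mxadj (cnj u) *m cnj u = 1%:M.
Proof.
move=> h; have -> : mxadj (cnj u) = cnj (mxadj u).
  by apply/matrixP => i j; rewrite !mxE.
by rewrite /cnj -map_mxM h map_mx1.
Qed.

Lemma ptransE m n (M : 'M[C]_(m * n)) i j k l :
  ptrans M (tidx i j) (tidx k l) = M (tidx k j) (tidx i l).
Proof. by rewrite mxE !idx1_tidx !idx2_tidx. Qed.

Lemma ptransD m n (A B : 'M[C]_(m * n)) : ptrans (A + B) = ptrans A + ptrans B.
Proof. by apply/matrixP => a b; rewrite !mxE. Qed.

Lemma ptransZ m n a (A : 'M[C]_(m * n)) : ptrans (a *: A) = a *: ptrans A.
Proof. by apply/matrixP => i j; rewrite !mxE. Qed.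

Lemma ptrans0 m n : ptrans (0 : 'M[C]_(m * n)) = 0.
Proof. by apply/matrixP => i j; rewrite !mxE. Qed.

Lemma ptrans_sum m n I (r : seq I) (P : pred I) (F : I -> 'M[C]_(m * n)) :
  ptrans (\sum_(i <- r | P i) F i) = \sum_(i <- r | P i) ptrans (F i).
Proof. by elim/big_rec2: _ => [|i y1 y2 _ <-]; rewrite ?ptrans0 ?ptransD. Qed.

Lemma ptransK m n (A : 'M[C]_(m * n)) : ptrans (ptrans A) = A.
Proof. by apply/matrixP => a b; rewrite -(tidxK a) -(tidxK b) !ptransE. Qed.

Lemma ptrans1 m n : ptrans (1%:M : 'M[C]_(m * n)) = 1%:M.
Proof.
apply/matrixP => a b; rewrite -(tidxK a) -(tidxK b) ptransE !mxE !tidx_eq.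
by rewrite [in LHS](eq_sym (idx1 b)).
Qed.

Lemma mxadj_ptrans m n (A : 'M[C]_(m * n)) : mxadj (ptrans A) = ptrans (mxadj A).
Proof. by apply/matrixP => a b; rewrite !mxE. Qed.

(** Both sides are the same fourfold sum after exchanging the two first-factor indices. So the
    partial transpose can be moved from the state to the test operator, and it preserves the
    Hilbert-Schmidt product. *)
Lemma tr_ptrans_mul m n (A B : 'M[C]_(m * n)) :
  \tr (ptrans A *m B) = \tr (A *m ptrans B).
Proof.
have hE (X Y : 'M[C]_(m * n)) : \tr (X *m Y) = \sum_i \sum_k \sum_j \sum_l
    X (tidx i j) (tidx k l) * Y (tidx k l) (tidx i j).
  rewrite /mxtrace sum_tidx; apply: eq_bigr => i _.
  rewrite exchange_big /=; apply: eq_bigr => j _.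
  rewrite mxE sum_tidx; apply: eq_bigr => k _.
  by [].
rewrite !hE exchange_big /=; apply: eq_bigr => i _; apply: eq_bigr => k _.
by apply: eq_bigr => j _; apply: eq_bigr => l _; rewrite !ptransE.
Qed.

Lemma tr_ptrans m n (A : 'M[C]_(m * n)) : \tr (ptrans A) = \tr A.
Proof. by rewrite -[ptrans A]mulmx1 tr_ptrans_mul ptrans1 mulmx1. Qed.

Lemma rtr_ptrans_mul m n (A B : 'M[C]_(m * n)) :
  rtr (ptrans A *m B) = rtr (A *m ptrans B).
Proof. by rewrite /rtr tr_ptrans_mul. Qed.

Lemma rtr_ptrans m n (A : 'M[C]_(m * n)) : rtr (ptrans A) = rtr A.
Proof. by rewrite /rtr tr_ptrans. Qed.

(** Transposing u A u^* gives conj(u) A^T u^T, again a conjugation, now by [cnj u]. Local isometries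
    thus pass through the partial transpose. *)
Lemma ptrans_tens p q m n (u : 'M[C]_(p, m)) (w : 'M[C]_(q, n)) M :
  ptrans (tens u w *m M *m mxadj (tens u w)) =
  tens (cnj u) w *m ptrans M *m mxadj (tens (cnj u) w).
Proof.
have mul3E (A B : 'M[C]_(p * q, m * n)) (X : 'M[C]_(m * n)) a b :
    (A *m X *m mxadj B) a b = \sum_i \sum_k \sum_j \sum_l
      A a (tidx i j) * X (tidx i j) (tidx k l) * Num.conj (B b (tidx k l)).
  rewrite mxE sum_tidx exchange_big /= [LHS](eq_bigr (fun l => \sum_k \sum_i \sum_j
     A a (tidx i j) * X (tidx i j) (tidx k l) * Num.conj (B b (tidx k l)))).
    rewrite exchange_big /= [RHS]exchange_big /=; apply: eq_bigr => k _.
    rewrite exchange_big /=; apply: eq_bigr => i _.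
    by rewrite exchange_big.
  move=> l _; apply: eq_bigr => k _.
  rewrite mxE sum_tidx big_distrl /=; apply: eq_bigr => i _.
  by rewrite big_distrl /=; apply: eq_bigr => j _; rewrite mxadjE.
apply/matrixP => a b; rewrite -(tidxK a) -(tidxK b) ptransE !mul3E exchange_big /=.
apply: eq_bigr => i _; apply: eq_bigr => k _; apply: eq_bigr => j _.
apply: eq_bigr => l _; rewrite !tensE !ptransE !mxE !rmorphM /= conjCK; ring.
Qed.

Lemma proj_mul p q (F : 'M[C]_(p, q)) x : proj (F *m x) = F *m proj x *m mxadj F.
Proof. by rewrite /proj mxadjM !mulmxA. Qed.

Lemma effect_range p q (F : 'M[C]_(p, q)) : mxadj F *m F = 1%:M -> effect (F *m mxadj F).
Proof.
move=> hF; split.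
  by have := psd_congr (mxadj F) (@psd1 R q); rewrite mxadjK mulmx1.
set E := _ - _.
have hE : mxadj E = E by rewrite mxadjB mxadj1 mxadjM mxadjK.
have hEE : E *m E = E.
  rewrite {1}/E mulmxBl mul1mx /E mulmxBr mulmx1 -mulmxA [mxadj F *m (_ *m _)]mulmxA hF.
  by rewrite mul1mx subrr subr0.
have -> : E = mxadj E *m 1%:M *m E by rewrite mulmx1 hE hEE.
exact/psd_congr/psd1.
Qed.

(** The trace can only drop, because tr (F^* T F) = tr (T F F^* ) and F F^* <= 1. *)
Lemma effect_compress p q (F : 'M[C]_(p, q)) T : mxadj F *m F = 1%:M -> effect T ->
  effect (mxadj F *m T *m F) /\ rtr (mxadj F *m T *m F) <= rtr T.
Proof.
move=> hF [h1 h2]; split; first split; first exact: psd_congr.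
  by have := psd_congr F h2; rewrite mulmxBr mulmxBl mulmx1 hF.
rewrite -mulmxA rtrC -mulmxA -subr_ge0 -[X in 0 <= rtr X - _]mulmx1 -rtrB -mulmxBr.
by apply: psd_trace_mul => //; case: (effect_range hF).
Qed.

Lemma effect_extend p q (F : 'M[C]_(p, q)) T : mxadj F *m F = 1%:M -> effect T ->
  effect (F *m T *m mxadj F) /\ rtr (F *m T *m mxadj F) = rtr T.
Proof.
move=> hF [h1 h2]; split; last by rewrite rtrC mulmxA hF mul1mx.
split; first by have := psd_congr (mxadj F) h1; rewrite mxadjK.
have -> : 1%:M - F *m T *m mxadj F =
   (1%:M - F *m mxadj F) + F *m (1%:M - T) *m mxadj F.
  by rewrite mulmxBr mulmxBl mulmx1 addrA subrK.
apply: psdD; first by case: (effect_range hF).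
by have := psd_congr (mxadj F) h2; rewrite mxadjK.
Qed.

(** The Schmidt form sum_i a_i |ii>. *)
Definition dvec s (a : 'I_s -> R) : 'cV[C]_(s * s) :=
  \col_k (if idx1 k == idx2 k then ((a (idx1 k))%:C)%C else 0).

(** A weighted swap: |kl> goes to a_k a_l |lk>. *)
Lemma PT_dvec s (a : 'I_s -> R) i j k l :
  ptrans (proj (dvec a)) (tidx i j) (tidx k l) =
  ((a i * a k)%:C)%C * ((j == k) && (l == i))%:R.
Proof.
rewrite ptransE mxE big_ord1 !mxE !idx1_tidx !idx2_tidx.
rewrite (eq_sym j) (eq_sym l); case: eqP => [->|_]; last by rewrite mul0r mulr0.
case: eqP => [->|_] /=; last by rewrite rmorph0 !mulr0.
by rewrite conj_real mulr1 rmorphM /= mulrC.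
Qed.

Lemma rtr_PT_dvec s (a : 'I_s -> R) T :
  rtr (ptrans (proj (dvec a)) *m T) =
  \sum_i \sum_k a i * a k * complex.Re (T (tidx k i) (tidx i k)).
Proof.
rewrite /rtr /mxtrace sum_tidx Re_sum; apply: eq_bigr => i _.
rewrite Re_sum; apply: eq_bigr => k _.
rewrite mxE sum_tidx (bigD1 k) //= (bigD1 i) //= PT_dvec !eqxx mulr1.
rewrite !big1 ?addr0 ?ReZ // => [k' hk|l hl].
  by rewrite big1 // => l _; rewrite PT_dvec (eq_sym k) (negPf hk) mulr0 mul0r.
by rewrite PT_dvec (negPf hl) andbF mulr0 mul0r.
Qed.

Lemma PT_tens m n s (u : 'M[C]_(m, s)) (w : 'M[C]_(n, s)) (d : 'cV[C]_(s * s)) :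
  ptrans (proj (tens u w *m d)) =
  tens (cnj u) w *m ptrans (proj d) *m mxadj (tens (cnj u) w).
Proof. by rewrite proj_mul ptrans_tens. Qed.

Lemma qf_delta2 p (T : 'M[C]_p) a b (x : R) : mxadj T = T ->
  qf T (delta_mx a 0 + (x%:C)%C *: delta_mx b 0) =
  complex.Re (T a a) + x ^+ 2 * complex.Re (T b b) + 2 * x * complex.Re (T a b).
Proof.
move=> hT; rewrite qfE.
have hd c : mxadj (delta_mx c 0 : 'cV[C]_p) = delta_mx 0 c.
  by apply/matrixP => i j; rewrite !mxE andbC rmorph_nat.
have hb c d : ((delta_mx 0 c : 'rV[C]_p) *m T *m (delta_mx d 0 : 'cV[C]_p)) 0 0 = T c d.
  by rewrite -rowE -colE !mxE.
rewrite mxadjD mxadjZ conj_real !hd !(mulmxDl, mulmxDr) -!scalemxAl -!scalemxAr.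
have mxD (A B : 'M[C]_1) : (A + B) 0 0 = A 0 0 + B 0 0 by rewrite mxE.
have mxZ k (A : 'M[C]_1) : (k *: A) 0 0 = k * A 0 0 by rewrite mxE.
rewrite !mxD -?scalemxAl !mxZ !hb !ReD !ReZ.
have -> : complex.Re (T b a) = complex.Re (T a b) by rewrite -{1}hT mxadjE Re_conj.
ring.
Qed.

Lemma nsq_delta2 p a b (x : R) : a != b ->
  nsq (delta_mx a 0 + (x%:C)%C *: delta_mx b 0 : 'cV[C]_p) = 1 + x ^+ 2.
Proof.
move=> ab; rewrite -qf1 qf_delta2 ?mxadj1 // !mxE !eqxx (negPf ab) /=; ring.
Qed.

Lemma effect_diag p (T : 'M[C]_p) a : effect T -> 0 <= complex.Re (T a a) <= 1.
Proof.
move=> hT; have := effectP (delta_mx a 0 + ((0 : R)%:C)%C *: delta_mx a 0) hT.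
have hh := psd_herm (proj1 hT).
rewrite -qf1 !qf_delta2 ?mxadj1 // !mxE eqxx /=.
by rewrite expr0n /= !(mul0r, mulr0, addr0).
Qed.

(** Testing 0 <= T <= 1 on e_a +- e_b gives |2 Re T_ab| <= w and w + |2 Re T_ab| <= 2, where w =
    T_aa + T_bb; averaging the two gives the bound by 1. *)
Lemma effect_offdiag p (T : 'M[C]_p) a b : effect T -> a != b ->
  `|2 * complex.Re (T a b)| <= complex.Re (T a a) + complex.Re (T b b) /\
  `|2 * complex.Re (T a b)| <= 1.
Proof.
move=> hT ab; have hh := psd_herm (proj1 hT).
have := effectP (delta_mx a 0 + ((1 : R)%:C)%C *: delta_mx b 0) hT.
have := effectP (delta_mx a 0 + ((-1 : R)%:C)%C *: delta_mx b 0) hT.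
rewrite !nsq_delta2 // !qf_delta2 // sqrrN expr1n !mul1r mulr1 mulrN1.
rewrite !ler_norml => /andP[h1 h2] /andP[h3 h4].
by split; apply/andP; split; lra.
Qed.

(* [d i k = <ik|T|ik>] and [r i k = Re <ki|T|ik>] for an operator [0 <= T <= 1] of
   trace at most [t]. *)
Definition swapdata s (t : R) (d r : 'I_s -> 'I_s -> R) :=
  [/\ forall i k, 0 <= d i k <= 1, forall i, r i i = d i i,
      forall i k, r i k = r k i,
      forall i k, i != k -> `|2 * r i k| <= d i k + d k i /\ `|2 * r i k| <= 1
    & \sum_i \sum_k d i k <= t].

(** The data depend on the Schmidt bases and on [T], not on the coefficients, so the trace becomes a
    quadratic form in [a]. Compressing [T] to the span of the Schmidt bases may lose trace, whence
    the inequality in [swapdata]. *)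
Lemma PT_data m n s (u : 'M[C]_(m, s)) (w : 'M[C]_(n, s)) T :
  mxadj u *m u = 1%:M -> mxadj w *m w = 1%:M -> effect T ->
  exists d r, swapdata (rtr T) d r /\ forall a,
    rtr (ptrans (proj (tens u w *m dvec a)) *m T) = \sum_i \sum_k a i * a k * r i k.
Proof.
move=> hu hw hT; pose F := tens (cnj u) w.
have hF : mxadj F *m F = 1%:M by apply: tens_isometry => //; apply: cnj_isometry.
have [hT' ht] := effect_compress hF hT; set T' := (_ *m F) in hT' ht.
exists (fun i k => complex.Re (T' (tidx k i) (tidx k i))),
  (fun i k => complex.Re (T' (tidx k i) (tidx i k))); split.
  split=> //.
  - by move=> i k; apply: effect_diag.
  - by move=> i k; rewrite -{1}(psd_herm (proj1 hT')) mxadjE Re_conj.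
  - move=> i k ik; apply: effect_offdiag => //.
    by rewrite tidx_eq negb_and eq_sym ik.
  - apply: le_trans ht; rewrite /rtr /mxtrace sum_tidx Re_sum exchange_big /=.
    by under [leRHS]eq_bigr do rewrite Re_sum.
move=> a; rewrite PT_tens -/F -mulmxA -mulmxA rtrC !mulmxA -rtr_PT_dvec.
by rewrite /T' !mulmxA.
Qed.

End Tensor.

(** * Completion to a unitary and singular value decomposition *)

Section Svd.
Variable R : realType.
Local Notation C := R[i].

(* The eigenvectors of [B^* B] for the eigenvalue 0 complete the rows of [B]. *)
Lemma unitary_complete k n (B : 'M[C]_(k, n)) : B *m mxadj B = 1%:M ->
  (k <= n)%N /\ exists2 V : 'M[C]_n, unitary V &
    forall (i : 'I_k) (i' : 'I_n), i = i' :> nat -> forall j, V i' j = B i j.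
Proof.
move=> hB; pose P := mxadj B *m B.
have hP : mxadj P = P by rewrite mxadjM mxadjK.
have eP : effect P by have := effect_range (F := mxadj B); rewrite mxadjK => /(_ hB).
have [s hs] := spectrum_exists hP; have [U hU] := spectrum_eig hP hs.
have hUU := proj1 hU.
have s01 (i : 'I_n) : s`_i = 0 \/ s`_i = 1.
  have hBB : B *m (P *m col i U) = B *m col i U by rewrite /P !mulmxA hB mul1mx.
  rewrite (eig_mul_col i hU) -scalemxAr in hBB.
  have h0 : ((s`_i - 1)%:C)%C *: (B *m col i U) = 0.
    by rewrite rmorphB /= scalerBl hBB scale1r subrr.
  move: h0 => /eqP; rewrite scaler_eq0 => /orP[/eqP [] /eqP|/eqP h0].
    by rewrite subr_eq0 => /eqP; right.
  by left; rewrite -(qf_eig i hU) /P qfE mulmxA -mulmxA h0 mulmx0 mxE.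
have hk : \sum_(i < n) s`_i = k%:R.
  by rewrite (spectrum_sum hP hs) rtrC hB rtr1.
have hge i : 0 <= s`_i.
  case: (ltnP i n) => hi; last by rewrite nth_default // (proj1 hs).
  by have [] := s01 (Ordinal hi) => /= ->; rewrite ?ler01.
(* The eigenvalues are sorted, lie in {0, 1} and sum to [k]. A 1 at an index [i >= k] would make the
   first [i.+1] of them equal to 1, which exceeds the sum. *)
have s0 (i : 'I_n) : (k <= i)%N -> B *m col i U = 0.
  move=> ki; have hi : s`_i = 0.
    have [//|h1] := s01 i; exfalso.
    have : \sum_(j < n | (j < i.+1)%N) s`_j <= k%:R.
      by rewrite -hk [leRHS](bigID (fun j : 'I_n => (j < i.+1)%N)) /= lerDl sumr_ge0.
    rewrite (eq_bigr (fun=> 1)) => [|j ji].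
      rewrite -(big_ord_widen n (fun=> 1)) // sumr_const card_ord ler_nat.
      by rewrite leqNgt ltnS ki.
    have h2 : 1 <= s`_j by rewrite -h1; apply: (spectrum_le hs); apply/andP; split.
    by have [h3|//] := s01 j; rewrite h3 ler10 in h2.
  apply: nsq_eq0; rewrite -qf1 qf_mul mulmx1 (qf_eig i hU) //.
split.
  rewrite -(ler_nat R) -hk -[n in _ <= n%:R]card_ord -sum1_card natr_sum.
  by apply: ler_sum => i _; have [] := s01 i => ->; rewrite ?ler01.
(* The rows of [B] come first; each later row is the conjugate of an eigenvector in the kernel of
   [B]. *)
pose V : 'M[C]_n := \matrix_(i, j)
  if insub (val i) is Some i' then B i' j else Num.conj (U j i).
have hV (i : 'I_n) (i' : 'I_k) j : i' = i :> nat -> V i j = B i' j.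
  by move=> h; rewrite mxE; case: insubP => [i'' _ h'|/negP []]; [congr (B _ _); apply: val_inj; apply: etrans h' (esym h) | have := ltn_ord i'; rewrite h].
have hV' (i : 'I_n) j : (k <= i)%N -> V i j = Num.conj (U j i).
  by move=> h; rewrite mxE insubF // ltnNge h.
clearbody V; exists V; last by move=> i i' h j; apply: hV.
apply/unitarymxP; apply/matrixP => a b.
have hBU (i : 'I_k) (j : 'I_n) : (k <= j)%N -> \sum_l B i l * U l j = 0.
  by move=> h; have /matrixP /(_ i 0) := s0 j h; rewrite !mxE => h1; apply: etrans h1; apply: eq_bigr => l _; rewrite [col _ _ _ _]mxE.
rewrite !mxE; case: (ltnP a k) => ha; case: (ltnP b k) => hb.
- have /matrixP /(_ (Ordinal ha) (Ordinal hb)) := hB; rewrite !mxE => h.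
  rewrite (_ : (a == b) = (Ordinal ha == Ordinal hb)) // -h.
  by apply: eq_bigr => j _; rewrite (hV a (Ordinal ha)) // 2!mxE (hV b (Ordinal hb)) // !mxE.
- have -> : (a == b) = false by apply/negP => /eqP h; move: ha; rewrite h ltnNge hb.
  apply: etrans (hBU (Ordinal ha) b hb); apply: eq_bigr => j _.
  by rewrite (hV a (Ordinal ha)) // 2!mxE hV' // conjCK.
- have -> : (a == b) = false by apply/negP => /eqP h; move: hb; rewrite -h ltnNge ha.
  transitivity (Num.conj (\sum_l B (Ordinal hb) l * U l a)); last by rewrite hBU // rmorph0.
  rewrite rmorph_sum; apply: eq_bigr => j _.
  by rewrite 2!mxE (hV b (Ordinal hb)) // hV' // rmorphM mulrC.
- have := unitary_col a b hUU; rewrite mxE => <-; apply: eq_bigr => j _.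
  by rewrite 2!mxE !hV' // conjCK !mxE.
Qed.

(** The coefficients as a matrix: (u (x) w) psi becomes u A w^T, and a Schmidt decomposition becomes
    a singular value decomposition. *)
Definition cmat m n (psi : 'cV[C]_(m * n)) : 'M[C]_(m, n) :=
  \matrix_(i, j) psi (tidx i j) 0.

Lemma cmat_inj m n : injective (@cmat m n).
Proof.
move=> x y h; apply/matrixP => k l; rewrite ord1 -(tidxK k).
by have /matrixP /(_ (idx1 k) (idx2 k)) := h; rewrite !mxE.
Qed.

Lemma cmat_tens m n s (u : 'M[C]_(m, s)) (w : 'M[C]_(n, s)) (a : 'I_s -> R) :
  cmat (tens u w *m dvec a) = u *m diag_mx (\row_i (a i)%:C%C) *m w^T.
Proof.
apply/matrixP => i j; rewrite mul_mx_diag !mxE sum_tidx; apply: eq_bigr => k _.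
rewrite (bigD1 k) //= big1 ?addr0 => [|l lk].
  by rewrite tensE !mxE idx1_tidx idx2_tidx eqxx mulrAC.
by rewrite [dvec _ _ _]mxE idx1_tidx idx2_tidx eq_sym (negPf lk) mulr0.
Qed.

Lemma nsq_dvec s (a : 'I_s -> R) : nsq (dvec a) = \sum_i a i ^+ 2.
Proof.
rewrite /nsq sum_tidx; apply: eq_bigr => i _; rewrite (bigD1 i) //= big1 ?addr0 => [|j ji].
  by rewrite mxE idx1_tidx idx2_tidx eqxx nc_real.
by rewrite mxE idx1_tidx idx2_tidx eq_sym (negPf ji) (nc_real (0 : R)) expr0n.
Qed.

Lemma nsq_isometry p q (F : 'M[C]_(p, q)) x : mxadj F *m F = 1%:M -> nsq (F *m x) = nsq x.
Proof. by move=> hF; rewrite -qf1 qf_mul mulmx1 hF qf1. Qed.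

(** In an eigenbasis U of A A^*, the rows of Y = U^* A are orthogonal with squared norms s_i. The
    nonzero rows are normalized and completed to a unitary, which supplies right singular vectors
    for the zero singular values as well. *)
Lemma svd m n (A : 'M[C]_(m, n)) : (m <= n)%N ->
  exists (u : 'M[C]_m) (a : 'I_m -> R) (v : 'M[C]_(m, n)),
  [/\ unitary u, v *m mxadj v = 1%:M, forall i, 0 <= a i,
      forall i j : 'I_m, (i <= j)%N -> a j <= a i
    & A = u *m diag_mx (\row_i (a i)%:C%C) *m v].
Proof.
move=> mn; pose G := A *m mxadj A.
have pG : psd G by have := psd_congr (mxadj A) (@psd1 R n); rewrite mxadjK mulmx1.
have hG := psd_herm pG.
have [s hs] := spectrum_exists hG; have [U hU] := spectrum_eig hG hs.
have [hUU hUV] := proj1 (unitaryP _) (proj1 hU).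
have s0 (i : 'I_m) : 0 <= s`_i by apply: (eig_psd_ge0 i hU).
(* The rank: the eigenvalues are sorted and nonnegative, so the first one that is [<= 0] starts the
   zeros. *)
pose r := find (fun x => x <= 0) s.
have rm : (r <= m)%N by rewrite -(proj1 hs) find_size.
have hr1 i : (i < r)%N -> 0 < s`_i by move=> /(before_find 0) /negbT; rewrite -ltNge.
have hr2 (i : 'I_m) : (r <= i)%N -> s`_i = 0.
  move=> ri; apply/eqP; rewrite eq_le s0 andbT.
  have hr : (r < size s)%N by rewrite (proj1 hs) (leq_ltn_trans ri).
  apply: le_trans (nth_find 0 (_ : has (fun x => x <= 0) s)); last by rewrite has_find.
  by apply: (spectrum_le hs); rewrite ri ltn_ord.
pose Y := mxadj U *m A.
have hY : Y *m mxadj Y = diag_mx (\row_i (s`_i)%:C%C).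
  rewrite mxadjM mxadjK -mulmxA [A *m _]mulmxA -/G (proj2 hU) !mulmxA hUV mul1mx.
  by rewrite -mulmxA hUV mulmx1.
have hYE (i j : 'I_m) : \sum_l Y i l * Num.conj (Y j l) = ((s`_i)%:C)%C *+ (i == j).
  by have /matrixP /(_ i j) := hY; rewrite !mxE => <-; apply: eq_bigr => l _; rewrite mxadjE.
pose a i := Num.sqrt s`_i.
have ha i : (i < r)%N -> a i != 0 by move=> /hr1; rewrite -sqrtr_gt0 lt0r => /andP[].
pose wd := widen_ord rm.
pose B : 'M[C]_(r, n) := \matrix_(i, j) (((a i)^-1)%:C%C * Y (wd i) j).
have hB : B *m mxadj B = 1%:M.
  apply/matrixP => i j; rewrite [LHS]mxE.
  rewrite (eq_bigr (fun l => ((a i)^-1 * (a j)^-1)%:C%C * (Y (wd i) l * Num.conj (Y (wd j) l)))).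
    rewrite -mulr_sumr hYE mxE -(inj_eq val_inj) /= -(inj_eq val_inj i j) /=.
    case: eqP => [ij|_]; last by rewrite mulr0n mulr0.
    rewrite !mulr1n -rmorphM /= -ij -invfM -expr2 sqr_sqrtr ?mulVf //.
      by rewrite gt_eqF // hr1.
    by rewrite ltW // hr1.
  move=> l _; rewrite mxadjE !mxE rmorphM /= conj_real rmorphM /= !mulrA; congr (_ * _).
  by rewrite mulrAC.
have [rn [V hV hVB]] := unitary_complete hB.
pose v : 'M[C]_(m, n) := \matrix_(i, j) V (widen_ord mn i) j.
exists U, (fun i => a i), v; split.
- exact: (proj1 hU).
- apply/matrixP => i j; have /unitaryP [/matrixP /(_ (widen_ord mn i) (widen_ord mn j)) h _] := hV.
  move: h; rewrite !mxE => h; rewrite -(inj_eq val_inj) /= in h; rewrite -(inj_eq val_inj) -h.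
  by apply: eq_bigr => l _; rewrite !mxadjE !mxE.
- by move=> i; apply: sqrtr_ge0.
- by move=> i j ij; rewrite ler_wsqrtr //; apply: (spectrum_le hs); rewrite ij ltn_ord.
have -> : A = U *m Y by rewrite mulmxA hUU mul1mx.
rewrite -mulmxA; congr (_ *m _); apply/matrixP => i j.
have -> : (diag_mx (\row_i (a i)%:C%C) *m v) i j = (a i)%:C%C * V (widen_ord mn i) j.
  by rewrite mul_diag_mx !mxE.
case: (ltnP i r) => hi.
  rewrite (hVB (Ordinal hi)) // [B _ _]mxE mulrA -rmorphM /= mulfV ?ha // mul1r.
  by congr (Y _ _); apply: val_inj.
(* Beyond the rank, the row of [Y] has norm 0, hence vanishes, and the vector supplied by [V] is
   multiplied by 0. *)
rewrite /a hr2 // sqrtr0 mul0r; apply/eqP; rewrite -nc_eq0; apply/eqP.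
have h := hYE i i; rewrite hr2 // mul0rn in h.
have h' : \sum_l nc (Y i l) = 0.
  have := congr1 (@complex.Re R) h; rewrite Re_sum /= => h1; apply: etrans h1; apply: eq_bigr => l _.
  by rewrite mulrC ncE.
by move/psumr_eq0P: h' => -> // l _; apply: nc_ge0.
Qed.

Lemma svd_vec m n (psi : 'cV[C]_(m * n)) : (m <= n)%N ->
  exists (u : 'M[C]_m) (w : 'M[C]_(n, m)) (a : 'I_m -> R),
  [/\ mxadj u *m u = 1%:M, mxadj w *m w = 1%:M, forall i, 0 <= a i,
      forall i j : 'I_m, (i <= j)%N -> a j <= a i
    & psi = tens u w *m dvec a].
Proof.
move=> mn; have [u [a [v [hu hv a0 ha hA]]]] := svd (cmat psi) mn.
exists u, v^T, a; split=> //; first by case/unitaryP: hu.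
  apply/matrixP => i j; have /matrixP /(_ j i) := hv; rewrite !mxE eq_sym => <-.
  by apply: eq_bigr => l _; rewrite !mxE mulrC.
by apply: cmat_inj; rewrite cmat_tens trmxK.
Qed.

Lemma nsq_tens_dvec m n s (u : 'M[C]_(m, s)) (w : 'M[C]_(n, s)) (a : 'I_s -> R) :
  mxadj u *m u = 1%:M -> mxadj w *m w = 1%:M ->
  nsq (tens u w *m dvec a) = \sum_i a i ^+ 2.
Proof. by move=> hu hw; rewrite nsq_isometry ?nsq_dvec //; apply: tens_isometry. Qed.

End Svd.

(** * Bounds for partial transposes of pure states *)

Section Bounds.
Variable R : realType.
Local Notation C := R[i].

(** Weak duality. The part of a_i a_k up to [th] is charged to |2r| <= d_ik + d_ki, which adds up to
    the trace; the excess [F i k] is charged to |2r| <= 1. Diagonal terms are nonnegative, so the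
    hypothesis on the products concerns distinct indices only. *)
Lemma swapdata_lower s (a : 'I_s -> R) t d r (th : R) (F : 'I_s -> 'I_s -> R) :
  (forall i, 0 <= a i) -> swapdata t d r -> 0 <= th -> (forall i k, 0 <= F i k) ->
  (forall i k, i != k -> a i * a k <= th + F i k) ->
  - (th * t + (\sum_i \sum_k F i k) / 2) <= \sum_i \sum_k a i * a k * r i k.
Proof.
move=> a0 [hd hrd hrs hr hdt] th0 F0 hF.
have hsum : \sum_i \sum_k (d i k + d k i) / 2 = \sum_i \sum_k d i k.
  rewrite (eq_bigr (fun i => (\sum_k d i k) / 2 + (\sum_k d k i) / 2)); last first.
    by move=> i _; rewrite -mulr_suml big_split mulrDl.
  rewrite big_split /= -!mulr_suml [X in _ + X / 2]exchange_big /=; lra.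
apply: (@le_trans _ _ (- (th * (\sum_i \sum_k d i k) + (\sum_i \sum_k F i k) / 2))).
  by rewrite lerN2 lerD2r ler_wpM2l.
rewrite -hsum mulr_sumr mulr_suml -big_split -sumrN; apply: ler_sum => i _ /=.
rewrite mulr_sumr mulr_suml -big_split -sumrN; apply: ler_sum => k _ /=.
have /andP[d0 _] := hd i k; have /andP[d0' _] := hd k i.
have F0' := F0 i k; have x0 : 0 <= a i * a k by rewrite mulr_ge0.
have [->|ik] := eqVneq i k.
  have h1 : 0 <= a k * a k * r k k by rewrite hrd !mulr_ge0 // (andP (hd k k)).1.
  have h2 : 0 <= th * ((d k k + d k k) / 2) by rewrite mulr_ge0 // divr_ge0 // addr_ge0 // (andP (hd k k)).1.
  have := F0 k k; lra.
have [] := hr _ _ ik; rewrite !ler_norml => /andP[h1 h2] /andP[h3 h4].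
have := hF _ _ ik; move: (a i * a k) (r i k) (d i k) (d k i) (F i k) x0 F0' d0 d0' h1 h2 h3 h4.
move=> x y u v f x0 f0 u0 v0 h1 h2 h3 h4 h5.
(* Below the threshold the trace term alone pays; above it the product splits into [th] and the
   excess. *)
have [xt|tx] := leP x th; first by nra.
have e : x * y = th * y + (x - th) * y by ring.
have e1 : - (th * ((u + v) / 2)) <= th * y by nra.
have e2 : - (f / 2) <= (x - th) * y by nra.
by rewrite e; lra.
Qed.

Lemma swapdata_upper s (a : 'I_s -> R) t d r (c : R) :
  swapdata t d r -> 0 <= c -> (forall i k, `|a i * a k| <= c) ->
  \sum_i \sum_k a i * a k * r i k <= c * t.
Proof.
move=> [hd hrd hrs hr hdt] c0 hc.
have hsum : \sum_i \sum_k (d i k + d k i) / 2 = \sum_i \sum_k d i k.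
  rewrite (eq_bigr (fun i => (\sum_k d i k) / 2 + (\sum_k d k i) / 2)); last first.
    by move=> i _; rewrite -mulr_suml big_split mulrDl.
  rewrite big_split /= -!mulr_suml [X in _ + X / 2]exchange_big /=; lra.
apply: (@le_trans _ _ (c * (\sum_i \sum_k d i k))); last by rewrite ler_wpM2l.
rewrite -hsum mulr_sumr; apply: ler_sum => i _; rewrite mulr_sumr.
apply: ler_sum => k _; have := hc i k; rewrite ler_norml => /andP[c1 c2].
have /andP[d0 _] := hd i k; have /andP[d0' _] := hd k i.
have [ik|ik] := eqVneq i k.
  by move: c2 d0; rewrite -ik hrd => c2 d0; nra.
have [] := hr _ _ ik; rewrite !ler_norml => /andP[h1 h2] _.
move: (a i * a k) (r i k) (d i k) (d k i) c1 c2 d0 d0' h1 h2 => x y u v c1 c2 u0 v0 h1 h2.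
have [y0|y0] := leP 0 y; nra.
Qed.

Lemma pair_le_sumsq s (a : 'I_s -> R) i k : i != k -> a i ^+ 2 + a k ^+ 2 <= \sum_j a j ^+ 2.
Proof.
move=> ik; rewrite (bigD1 i) //= lerD2l (bigD1 k) 1?eq_sym //= lerDl.
by apply: sumr_ge0 => j _; apply: sqr_ge0.
Qed.

(** The exact defect in Cauchy-Schwarz for (sum a_i)^2 <= s sum a_i^2. It serves the negativity with
    its equality case, and the lower bound on tr (W^2). *)
Lemma sum_sqr_diff s (a : 'I_s -> R) :
  \sum_i \sum_k (a i - a k) ^+ 2 = 2 * s%:R * (\sum_i a i ^+ 2) - 2 * (\sum_i \sum_k a i * a k).
Proof.
have -> : \sum_i \sum_k (a i - a k) ^+ 2 =
    \sum_i (s%:R * a i ^+ 2 + (\sum_k a k ^+ 2) - 2 * \sum_k a i * a k).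
  apply: eq_bigr => i _; rewrite (eq_bigr (fun k => (a i ^+ 2 + a k ^+ 2) - 2 * (a i * a k))).
    by rewrite sumrB big_split /= sumr_const card_ord mulr_natl -mulr_sumr.
  by move=> k _; ring.
rewrite sumrB big_split /= -!mulr_sumr sumr_const card_ord -mulr_natl; ring.
Qed.

(** Threshold 0: trace is then free and every product is charged to |2r| <= 1. The defect is kept,
    since equality will force all the coefficients to agree. *)
Lemma swapdata_lowerN s (a : 'I_s -> R) t d r :
  (forall i, 0 <= a i) -> swapdata t d r ->
  - ((s%:R - 1) / 2 * \sum_i a i ^+ 2) + (\sum_i \sum_k (a i - a k) ^+ 2) / 4
    <= \sum_i \sum_k a i * a k * r i k.
Proof.
move=> a0 hdr.
have := swapdata_lower (th := 0) (F := fun i k => if i == k then 0 else a i * a k) a0 hdr.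
rewrite mul0r add0r => h; apply: le_trans (h _ _ _) => //; last 2 first.
- by move=> i k; case: eqP => // _; rewrite mulr_ge0.
- by move=> i k /negPf ->; rewrite add0r.
have -> : \sum_i \sum_k (if i == k then 0 else a i * a k) =
    \sum_i \sum_k a i * a k - \sum_i a i ^+ 2.
  rewrite -sumrB; apply: eq_bigr => i _.
  rewrite (bigD1 i) //= eqxx add0r [in RHS](bigD1 i) //= -expr2 addrC addrK.
  by apply: eq_bigr => k /negPf; rewrite eq_sym => ->.
rewrite sum_sqr_diff; lra.
Qed.

(** Replaces the root by a variable with polynomial properties, the form that arithmetic tactics can
    use. *)
Lemma sqrt2_spec : exists q : R, [/\ Num.sqrt 2 = q, 0 <= q & q ^+ 2 = 2].
Proof. by exists (Num.sqrt 2); rewrite sqrtr_ge0 sqr_sqrtr. Qed.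

Section Pure.
Variables (m n : nat).
Hypothesis mn : (m <= n)%N.
Implicit Types (psi : 'cV[C]_(m * n)) (T : 'M[C]_(m * n)).

Lemma PT_lower1 psi T : effect T -> rtr T <= 1 ->
  - (2^-1 * nsq psi) <= rtr (ptrans (proj psi) *m T).
Proof.
move=> hT ht; have [u [w [a [hu hw a0 _ ->]]]] := svd_vec psi mn.
rewrite nsq_tens_dvec //; have [d [r [hdr ->]]] := PT_data hu hw hT.
set S := \sum_i a i ^+ 2.
have S0 : 0 <= S by apply: sumr_ge0 => i _; apply: sqr_ge0.
(* By the arithmetic-geometric mean, a_i a_k <= S / 2 for distinct indices, so no excess remains. *)
have := swapdata_lower (th := 2^-1 * S) (F := fun _ _ => 0) a0 hdr.
rewrite big1 => [|i _]; last by rewrite big1.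
rewrite mul0r addr0 => h; apply: le_trans (h _ _ _) => //.
- by rewrite addr0 lerN2 -[leRHS]mulr1 ler_wpM2l // mulr_ge0 // invr_ge0.
- by rewrite mulr_ge0 // invr_ge0.
- move=> i k ik; clear h; have := pair_le_sumsq a ik; rewrite -/S.
  have := sqr_ge0 (a i - a k); nra.
Qed.

Lemma PT_lowerN psi T : effect T ->
  - ((m%:R - 1) / 2 * nsq psi) <= rtr (ptrans (proj psi) *m T).
Proof.
move=> hT; have [u [w [a [hu hw a0 _ ->]]]] := svd_vec psi mn.
rewrite nsq_tens_dvec //; have [d [r [hdr ->]]] := PT_data hu hw hT.
have := swapdata_lowerN a0 hdr.
have : 0 <= \sum_i \sum_k (a i - a k) ^+ 2.
  by apply: sumr_ge0 => i _; apply: sumr_ge0 => k _; apply: sqr_ge0.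
lra.
Qed.

(** Equality kills the defect of [swapdata_lowerN]. All Schmidt coefficients are then equal, and the
    coefficient matrix is a scalar multiple of [u *m w^T], which has orthonormal rows. *)
Lemma PT_lowerN_eq psi T : effect T ->
  rtr (ptrans (proj psi) *m T) = - ((m%:R - 1) / 2 * nsq psi) ->
  cmat psi *m mxadj (cmat psi) = ((nsq psi / m%:R)%:C)%C%:M.
Proof.
move=> hT; have [u [w [a [hu hw a0 _ ->]]]] := svd_vec psi mn.
rewrite nsq_tens_dvec //; have [d [r [hdr ->]]] := PT_data hu hw hT => heq.
have h := swapdata_lowerN a0 hdr; rewrite heq in h.
have hz : \sum_i \sum_k (a i - a k) ^+ 2 = 0.
  apply/eqP; rewrite eq_le; apply/andP; split; first by lra.
  by apply: sumr_ge0 => i _; apply: sumr_ge0 => k _; apply: sqr_ge0.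
have ha i k : a i = a k.
  move/psumr_eq0P: hz => hz; have /psumr_eq0P h2 := hz (fun i _ => sumr_ge0 _ (fun k _ => sqr_ge0 _)) i isT.
  have /eqP := h2 (fun k _ => sqr_ge0 _) k isT.
  by rewrite sqrf_eq0 subr_eq0 => /eqP.
have haS i : a i ^+ 2 = (\sum_k a k ^+ 2) / m%:R.
  rewrite (eq_bigr (fun=> a i ^+ 2)) => [|k _]; last by rewrite (ha k i).
  rewrite sumr_const card_ord -[_ *+ m]mulr_natr mulfK //.
  by rewrite pnatr_eq0 -lt0n; apply: leq_ltn_trans (ltn_ord i).
rewrite cmat_tens; set D := diag_mx _.
have hww : w^T *m mxadj w^T = 1%:M.
  apply/matrixP => i j; have /matrixP /(_ j i) := hw; rewrite !mxE eq_sym => <-.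
  by apply: eq_bigr => l _; rewrite !mxE mulrC.
rewrite !mxadjM mulmxA -[u *m D *m w^T *m _]mulmxA hww mulmx1 mxadj_diag.
have hDD : D *m D = ((\sum_k a k ^+ 2) / m%:R)%:C%C%:M.
  apply/matrixP => i j; rewrite mul_diag_mx !mxE; case: eqP => _.
    by rewrite !mulr1n -rmorphM /= -expr2 haS.
  by rewrite !mulr0n mulr0.
by rewrite mulmxA -[u *m D *m D]mulmxA hDD scalar_mxC -mulmxA (mulmx1C hu) mulmx1.
Qed.

Lemma PT_upper T (c : R) s (u : 'M[C]_(m, s)) (w : 'M[C]_(n, s)) a :
  mxadj u *m u = 1%:M -> mxadj w *m w = 1%:M -> effect T ->
  0 <= c -> (forall i k, `|a i * a k| <= c) ->
  rtr (ptrans (proj (tens u w *m dvec a)) *m T) <= c * rtr T.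
Proof.
move=> hu hw hT c0 hc; have [d [r [hdr ->]]] := PT_data hu hw hT.
exact: swapdata_upper hdr c0 hc.
Qed.

(* Products of the sorted Schmidt coefficients: [a0 a1] and [a0 a2] dominate all
   the others, which are at most [th = max(a1 a2, a0 a3)]. *)
Lemma PT_lower_sorted psi T : (3 <= m)%N -> effect T ->
  exists a0 a1 a2 a3 th : R, [/\ [/\ 0 <= a2, a2 <= a1, a1 <= a0 & 0 <= a3],
    (th == a1 * a2) || (th == a0 * a3), a0 ^+ 2 + a1 ^+ 2 + a2 ^+ 2 + a3 ^+ 2 <= nsq psi, 0 <= th
    & - (th * (rtr T - 2) + a0 * a1 + a0 * a2) <= rtr (ptrans (proj psi) *m T)].
Proof.
move=> m3 hT; have [u [w [a [hu hw a0 hs ->]]]] := svd_vec psi mn.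
rewrite nsq_tens_dvec //; have [d [r [hdr ->]]] := PT_data hu hw hT.
pose i0 := Ordinal (ltnW (ltnW m3)); pose i1 := Ordinal (ltnW m3); pose i2 := Ordinal m3.
(* [b] is the fourth coefficient, or 0 when [m] is 3. *)
have [b [b0 hb b2 hbS]] : exists b, [/\ 0 <= b, forall i : 'I_m, (3 <= i)%N -> a i <= b,
    b <= a i2 & a i0 ^+ 2 + a i1 ^+ 2 + a i2 ^+ 2 + b ^+ 2 <= \sum_i a i ^+ 2].
  have hS : \sum_i a i ^+ 2 = a i0 ^+ 2 + a i1 ^+ 2 + a i2 ^+ 2 + \sum_(i < m | (3 <= i)%N) a i ^+ 2.
    rewrite (bigD1 i0) //= (bigD1 i1) //= (bigD1 i2) //= !addrA; congr (_ + _).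
    apply: eq_bigl => i; rewrite -!(inj_eq val_inj) /=.
    by case: (val i) => [|[|[|]]].
  case: (ltnP 3 m) => m4.
    exists (a (Ordinal m4)); split=> //; [by move=> i i3; apply: hs | by apply: hs |].
    rewrite hS lerD2l (bigD1 (Ordinal m4)) //= lerDl.
    by apply: sumr_ge0 => i _; apply: sqr_ge0.
  exists 0; split=> //.
    by move=> i i3; have := leq_trans (ltn_ord i) m4; rewrite ltnNge i3.
  by rewrite expr0n addr0 hS lerDl; apply: sumr_ge0 => i _; apply: sqr_ge0.
have s01 : a i1 <= a i0 by apply: hs.
have s12 : a i2 <= a i1 by apply: hs.
pose th := Num.max (a i1 * a i2) (a i0 * b).
have th0 : 0 <= th by rewrite le_max mulr_ge0.
have th1 : a i1 * a i2 <= th by rewrite le_max lexx.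
have th2 : a i0 * b <= th by rewrite le_max lexx orbT.
have th3 : th <= a i0 * a i2.
  by rewrite ge_max; apply/andP; split; [apply: ler_wpM2r | apply: ler_wpM2l].
have th4 : a i0 * a i2 <= a i0 * a i1 by apply: ler_wpM2l.
exists (a i0), (a i1), (a i2), b, th; split=> //.
  by rewrite /th; case: (leP (a i1 * a i2)) => _; rewrite eqxx ?orbT.
pose x := a i0 * a i1 - th; pose y := a i0 * a i2 - th.
have x0 : 0 <= x by rewrite subr_ge0 (le_trans th3).
have y0 : 0 <= y by rewrite subr_ge0.
(* The excess sits on the pairs {0, 1} and {0, 2}, in both orders. *)
pose F (i k : 'I_m) := x * ((i == i0) && (k == i1))%:R + x * ((i == i1) && (k == i0))%:R
   + y * ((i == i0) && (k == i2))%:R + y * ((i == i2) && (k == i0))%:R.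
have hF0 i k : 0 <= F i k by rewrite /F !addr_ge0 // mulr_ge0 // ler0n.
have hFC i k : F i k = F k i by rewrite /F ![(k == _) && _]andbC; ring.
have hFs : \sum_i \sum_k F i k = 2 * x + 2 * y.
  have hd (z : R) (p q : 'I_m) : \sum_i \sum_k z * ((i == p) && (k == q))%:R = z.
    rewrite (bigD1 p) //= (bigD1 q) //= !eqxx mulr1 !big1 ?addr0 // => [i ip|k kq].
      by rewrite big1 // => k _; rewrite (negPf ip) mulr0.
    by rewrite (negPf kq) mulr0.
  rewrite /F (eq_bigr (fun i => \sum_k (x * ((i == i0) && (k == i1))%:R) +
    \sum_k (x * ((i == i1) && (k == i0))%:R) + \sum_k (y * ((i == i0) && (k == i2))%:R) +
    \sum_k (y * ((i == i2) && (k == i0))%:R))); last by move=> i _; rewrite !big_split.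
  by rewrite !big_split /= !hd; ring.
have hlt (i k : 'I_m) : (i < k)%N -> a i * a k <= th + F i k.
  move=> ik; have Fp := hF0 i k.
  have [hi|hi] := eqVneq i i0.
    have hk0 : k != i0 by rewrite -(inj_eq val_inj) /= -lt0n (leq_ltn_trans _ ik).
    have [hk|hk] := eqVneq k i1.
      by rewrite /F hi hk !eqxx /= !mulr1 !mulr0 /x; lra.
    have [hk'|hk'] := eqVneq k i2.
      by rewrite /F hi hk' !eqxx /= !mulr1 !mulr0 /y; lra.
    have k3 : (3 <= k)%N.
      move: hk0 hk hk'; rewrite -!(inj_eq val_inj) /=.
      by case: (val k) => [|[|[|]]].
    apply: (@le_trans _ _ th); last by rewrite lerDl.
    by apply: le_trans th2; rewrite hi ler_wpM2l // hb.
  have hi1 : (0 < i)%N by rewrite lt0n; move: hi; rewrite -(inj_eq val_inj).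
  have hk2 : (1 < k)%N by apply: leq_trans ik.
  apply: (@le_trans _ _ th); last by rewrite lerDl.
  by apply: le_trans th1; apply: ler_pM => //; apply: hs.
have hF i k : i != k -> a i * a k <= th + F i k.
  rewrite -(inj_eq val_inj) neq_ltn => /orP[|h]; first exact: hlt.
  by rewrite mulrC hFC; apply: hlt.
apply: le_trans (swapdata_lower a0 hdr th0 hF0 hF); rewrite hFs /x /y; lra.
Qed.

Lemma PT_lower2 psi T : (3 <= m)%N -> effect T -> rtr T <= 2 ->
  - (Num.sqrt 2 / 2 * nsq psi) <= rtr (ptrans (proj psi) *m T).
Proof.
move=> m3 hT hT2; have [a0 [a1 [a2 [a3 [th [[h1 h2 h3 h3'] _ h4 h5 h6]]]]]] := PT_lower_sorted psi m3 hT.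
apply: le_trans h6.
have [q [-> q0 q2]] := sqrt2_spec.
(* Both squares vanish when a1 = a2 = a0 / sqrt 2, the coefficients sqrt 2 / 2, 1/2, 1/2 up to
   scale. *)
have g1 : 0 <= (a0 - q / 2 * (a1 + a2)) ^+ 2 by apply: sqr_ge0.
have g2 : 0 <= (a1 - a2) ^+ 2 by apply: sqr_ge0.
have g3 : q * (a0 * (a1 + a2)) <= a0 ^+ 2 + a1 ^+ 2 + a2 ^+ 2 by nra.
have g4 : q * (a0 * (a1 + a2)) <= nsq psi by have := sqr_ge0 a3; lra.
have g5 : q / 2 * (q * (a0 * (a1 + a2))) <= q / 2 * nsq psi by apply: ler_wpM2l => //; lra.
have g6 : q / 2 * (q * (a0 * (a1 + a2))) = a0 * (a1 + a2).
  by transitivity (q ^+ 2 / 2 * (a0 * (a1 + a2))); [ring | rewrite q2; field].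
have g7 : th * (rtr T - 2) <= 0 by rewrite mulr_ge0_le0 // subr_le0.
lra.
Qed.

Lemma PT_lower3 psi T : (3 <= m)%N -> effect T -> rtr T <= 3 ->
  - nsq psi <= rtr (ptrans (proj psi) *m T).
Proof.
move=> m3 hT hT2; have [a0 [a1 [a2 [a3 [th [[h1 h2 h3 h3'] ht h4 h5 h6]]]]]] := PT_lower_sorted psi m3 hT.
apply: le_trans h6.
have g7 : th * (rtr T - 2) <= th by rewrite -[leRHS]mulr1 ler_wpM2l //; lra.
(* Three edges form a triangle or a star according to [th]. The squares of differences bound a0 a1 +
   a0 a2 + a1 a2; the squares centred at a0 / 2 bound a0 (a1 + a2 + a3) by 3/4 a0^2 + a1^2 + a2^2 +
   a3^2. *)
have e1 := sqr_ge0 (a0 - a1); have e2 := sqr_ge0 (a0 - a2); have e3 := sqr_ge0 (a1 - a2).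
have e4 := sqr_ge0 (a1 - a0 / 2); have e5 := sqr_ge0 (a2 - a0 / 2); have e6 := sqr_ge0 (a3 - a0 / 2).
have e7 := sqr_ge0 a3; have e8 := sqr_ge0 a0.
by case/orP: ht => /eqP ht; move: g7; rewrite {2}ht; nra.
Qed.

(** Trace 2 is best spent on |00> and (|01> + |10>)/sqrt 2, with value x^2 + x y. The constant (1 +
    sqrt 2)/2 is the largest eigenvalue of this quadratic form. *)
Lemma PT_upper2 psi T : m = 2%N -> effect T -> rtr T <= 2 ->
  rtr (ptrans (proj psi) *m T) <= (1 + (2 + 2 * Num.sqrt 2)^-1) * nsq psi.
Proof.
move=> m2 hT hT2; have [u [w [a [hu hw a0 hs ->]]]] := svd_vec psi mn.
rewrite nsq_tens_dvec //; have [d [r [hdr ->]]] := PT_data hu hw hT.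
case: hdr => hd hrd hrs hr; clear u w hu hw; move: hT2.
move: (rtr T) => t t2.
move: a a0 hs d r hd hrd hrs hr; rewrite m2 => a a0 hs d r hd hrd hrs hr.
rewrite !big_ord_recl !big_ord0 !addr0; set i1 := lift _ _.
have := hr ord0 i1 isT; rewrite !ler_norml => -[/andP[h1 h2] /andP[h3 h4]] h5.
have := hs ord0 i1 isT; have := a0 i1; have := a0 ord0.
have := hd ord0 ord0; have := hd i1 i1; have := hd ord0 i1; have := hd i1 ord0.
rewrite (hrs i1 ord0) !hrd => /andP[d1 d1'] /andP[d2 d2'] /andP[d3 d3'] /andP[d4 d4'] p0 p1 p01.
move: (a ord0) (a i1) (r ord0 i1) (d ord0 ord0) (d i1 i1) (d ord0 i1) (d i1 ord0) h1 h2 h3 h4 h5 d1 d1' d2 d2' d3 d3' d4 d4' p0 p1 p01.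
move=> x y z d00 d11 d01 d10 h1 h2 h3 h4 h5 d1 d1' d2 d2' d3 d3' d4 d4' p0 p1 p01.
have xy0 : 0 <= x * y by rewrite mulr_ge0.
have k1 : y ^+ 2 <= x * y by rewrite expr2 ler_wpM2r.
have k2 : x * y <= x ^+ 2 by rewrite expr2 ler_wpM2l.
(* As y^2 <= x y <= x^2, the weight on |11> is valued at x y, and [d00 <= 1] limits the use of the
   best value x^2. *)
have g1 : x * x * d00 + x * y * z + (y * x * z + y * y * d11) <= x ^+ 2 + x * y.
  have f1 : y ^+ 2 * d11 <= x * y * d11 by rewrite ler_wpM2r.
  have f2 : 2 * z + d11 + d00 <= 2 by lra.
  have f3 : (x * y) * (2 * z + d11) <= x * y * (2 - d00) by rewrite ler_wpM2l //; lra.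
  have f4 : (x ^+ 2 - x * y) * d00 <= (x ^+ 2 - x * y) * 1 by rewrite ler_wpM2l // subr_ge0.
  have -> : x * x * d00 + x * y * z + (y * x * z + y * y * d11) =
     (x ^+ 2 - x * y) * d00 + x * y * d00 + (x * y) * (2 * z) + y ^+ 2 * d11 by ring.
  lra.
apply: le_trans g1 _.
have [q [-> q0 q2]] := sqrt2_spec.
have -> : (2 + 2 * q)^-1 = (q - 1) / 2.
  have : 2 + 2 * q != 0 by apply: lt0r_neq0; lra.
  move=> hq; apply: (mulfI hq); rewrite mulfV //.
  transitivity (q ^+ 2 - 1); [by rewrite q2; ring | by field].
have q1 : 1 <= q by rewrite -(ler_pXn2r (n := 2)) ?nnegrE // q2 expr1n ler1n.
(* The square vanishes at x = (1 + sqrt 2) y, the top eigenvector of x^2 + x y. *)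
have f0 : 0 <= (q - 1) / 2 * (x - (1 + q) * y) ^+ 2.
  by rewrite mulr_ge0 ?sqr_ge0 // divr_ge0 // subr_ge0.
have f1 : (q - 1) / 2 * (x - (1 + q) * y) ^+ 2 =
   (q - 1) / 2 * x ^+ 2 - (q ^+ 2 - 1) * (x * y) + (q ^+ 2 - 1) * (1 + q) / 2 * y ^+ 2 by field.
rewrite f1 q2 in f0; lra.
Qed.

End Pure.
End Bounds.

(** * From pure states to decomposable witnesses; the upper bound on tr (W^2) *)

Section Witness.
Variable R : realType.
Local Notation C := R[i].

Lemma ptrans_bound m n (T Q : 'M[C]_(m * n)) (c : R) :
  (forall psi : 'cV_(m * n), c * nsq psi <= rtr (ptrans (proj psi) *m T)) -> psd Q ->
  c * rtr Q <= rtr (ptrans Q *m T).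
Proof.
move=> hc hQ; have [d [U hU]] := herm_eig (psd_herm hQ).
rewrite (rtr_col Q (proj1 hU)) {2}(proj2 hU) udiag_sum ptrans_sum mulmx_suml rtr_sum mulr_sumr.
apply: ler_sum => i _; rewrite (qf_eig i hU) ptransZ -scalemxAl rtrZ mulrC.
apply: ler_wpM2l; first exact: (eig_psd_ge0 i hU).
by have := hc (col i U); rewrite nsq_col ?mulr1 //; case: hU.
Qed.

Lemma tr_herm_real p (A : 'M[C]_p) : mxadj A = A -> \tr A = ((rtr A)%:C)%C.
Proof.
move=> hA; have := mxadj_tr A; rewrite hA /rtr; case: (\tr A) => a b /= [h].
by apply/eqP; rewrite eq_complex /= eqxx /=; apply/eqP; lra.
Qed.

(** Product projectors stay projectors. This yields block-positivity of P + Q^Gamma, and shows that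
    a product vector never produces a witness. *)
Lemma kron_ptrans m n (a : 'cV[C]_m) (b : 'cV[C]_n) :
  ptrans (proj (kron a b)) = proj (kron (cnj a) b).
Proof.
apply/matrixP => x y; rewrite -(tidxK x) -(tidxK y) ptransE !mxE !big_ord1 !mxE.
rewrite !idx1_tidx !idx2_tidx !rmorphM /= conjCK; ring.
Qed.

Lemma form_tr p (M : 'M[C]_p) x : (mxadj x *m M *m x) 0 0 = \tr (M *m proj x).
Proof. by rewrite /proj mulmxA mxtrace_mulC mulmxA /mxtrace big_ord1. Qed.

Lemma inD_dec m n (W : 'M[C]_(m * n)) : inD W ->
  exists P Q : 'M[C]_(m * n), [/\ psd P, psd Q, W = P + ptrans Q, rtr P + rtr Q = 1 &
    mxadj W = W /\ (rtr W = 1 /\ exists l : C, eigenvalue W l /\ l < 0)].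
Proof.
move=> [[[[hW _] hl] [P [Q [hP [hQ h]]]]] htr].
have h1 : rtr W = 1 by rewrite /rtr htr.
by exists P, Q; split=> //; rewrite -(rtr_ptrans Q) -rtrD -h.
Qed.

Lemma inD_herm m n (W : 'M[C]_(m * n)) : inD W -> mxadj W = W.
Proof. by case/inD_dec=> P [Q [_ _ _ _ []]]. Qed.

Lemma inD_rtr m n (W : 'M[C]_(m * n)) : inD W -> rtr W = 1.
Proof. by case/inD_dec=> P [Q [_ _ _ _ [_ []]]]. Qed.

(** Block-positivity comes for free from the form P + Q^Gamma: moving the transpose onto |a, b>
    leaves a product projector. A single negative value of the form then provides the eigenvalue. *)
Lemma inD_intro m n (W P Q : 'M[C]_(m * n)) x : psd P -> psd Q -> W = P + ptrans Q ->
  rtr W = 1 -> qf W x < 0 -> inD W.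
Proof.
move=> hP hQ hW ht hx.
have hh : mxadj W = W.
  by rewrite hW mxadjD mxadj_ptrans (psd_herm hP) (psd_herm hQ).
split; last by rewrite tr_herm_real // ht.
split; last by exists P, Q.
split; last exact: neg_eigenvalue hh hx.
split=> // a b; rewrite form_tr hW mulmxDl mxtraceD tr_ptrans_mul kron_ptrans -!form_tr.
by rewrite addr_ge0.
Qed.

Lemma D_not_psd m n (W : 'M[C]_(m * n)) : inD W -> ~ psd W.
Proof.
move=> hW hP; have [P [Q [_ _ _ _ [hh [_ [l [hl l0]]]]]]] := inD_dec hW.
have [d [U hU]] := herm_eig hh.
move: hl; rewrite eigenvalue_root_char (eig_char_poly hU) -(big_map (fun i => ((d i)%:C)%C) xpredT (fun x => 'X - x%:P)) root_prod_XsubC.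
move=> /mapP [i _ hi]; rewrite hi ltcR ltNge in l0.
by move: l0; rewrite (eig_psd_ge0 i hU).
Qed.

(** The factor [rtr Q] is kept because explicit mixtures with [rtr Q = t] need the sharp bound -c
    t. *)
Lemma D_lower m n (P Q T : 'M[C]_(m * n)) (c : R) : psd P -> psd Q -> effect T ->
  (forall psi : 'cV_(m * n), - (c * nsq psi) <= rtr (ptrans (proj psi) *m T)) ->
  - (c * rtr Q) <= rtr ((P + ptrans Q) *m T).
Proof.
move=> hP hQ [hT _] hc; rewrite mulmxDl rtrD.
have h1 := psd_trace_mul hP hT.
have h2 : - c * rtr Q <= rtr (ptrans Q *m T).
  by apply: ptrans_bound hQ => psi; rewrite mulNr.
by rewrite mulNr in h2; lra.
Qed.

Lemma inD_lower m n (W T : 'M[C]_(m * n)) (c : R) : inD W -> effect T -> 0 <= c ->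
  (forall psi : 'cV_(m * n), - (c * nsq psi) <= rtr (ptrans (proj psi) *m T)) ->
  - c <= rtr (W *m T).
Proof.
case/inD_dec=> P [Q [hP hQ -> htr _]] hT c0 hc.
apply: le_trans (D_lower hP hQ hT hc); rewrite lerN2 -[leRHS]mulr1 ler_wpM2l //.
have := psd_trace_ge0 hP; lra.
Qed.

(* In the equality case [Q] lives in the kernel of the positive form
   [T^Gamma + c]. *)
Lemma inD_lower_eq m n (W T : 'M[C]_(m * n)) (c : R) : inD W -> effect T -> 0 < c ->
  (forall psi : 'cV_(m * n), - (c * nsq psi) <= rtr (ptrans (proj psi) *m T)) ->
  rtr (W *m T) = - c ->
  exists d U, [/\ W = \sum_i ((d i)%:C)%C *: ptrans (proj (col i U)), unitary U,
     \sum_i d i = 1, forall i, 0 <= d i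
   & psd (ptrans T + (c%:C)%C%:M) /\
     forall i, d i != 0 -> qf (ptrans T + (c%:C)%C%:M) (col i U) = 0].
Proof.
case/inD_dec=> P [Q [hP hQ hW htr _]] hT c0 hc heq.
have h1 := psd_trace_mul hP (proj1 hT).
have h2 : - c * rtr Q <= rtr (ptrans Q *m T).
  by apply: ptrans_bound hQ => psi; rewrite mulNr.
have h3 := psd_trace_ge0 hP.
rewrite hW mulmxDl rtrD in heq.
have hP0 : rtr P = 0.
  have hp : rtr P = 1 - rtr Q by lra.
  have : c * rtr P <= 0 by rewrite hp mulrBr mulr1; lra.
  by rewrite pmulr_rle0 // => h4; apply/eqP; rewrite eq_le h4 h3.
have P0 := psd_trace0 hP hP0.
have Q1 : rtr Q = 1 by lra.
have [d [U hU]] := herm_eig (psd_herm hQ).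
exists d, U; have d0 i := eig_psd_ge0 i hU hQ.
set M := ptrans T + _.
have hM : psd M.
  apply/psdP; split=> [|x].
    rewrite mxadjD mxadj_ptrans (psd_herm (proj1 hT)); congr (_ + _).
    by rewrite -scalemx1 mxadjZ mxadj1 conj_real.
  rewrite qfD /qf rtr_ptrans_mul rtrC -scalemx1 -scalemxAl rtrZ mul1mx rtr_proj.
  by have := hc x; lra.
split=> //.
- by rewrite hW P0 add0r (proj2 hU) udiag_sum ptrans_sum; apply: eq_bigr => i _; rewrite ptransZ.
- exact: (proj1 hU).
- by rewrite -Q1 (rtr_col _ (proj1 hU)); apply: eq_bigr => i _; rewrite (qf_eig i hU).
split=> // i di.
have h0 : \sum_i d i * qf M (col i U) = 0.
  rewrite -(rtr_eig _ hU) mulmxDr rtrD -rtr_ptrans_mul.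
  rewrite -scalemx1 -scalemxAr mulmx1 rtrZ Q1 mulr1.
  by rewrite P0 mul0mx rtr0 add0r in heq; rewrite heq addNr.
have hq j : 0 <= d j * qf M (col j U) by rewrite mulr_ge0 //; case/psdP: hM.
move/psumr_eq0P: h0 => h0; have /eqP := h0 (fun j _ => hq j) i isT.
by rewrite mulf_eq0 (negPf di) /= => /eqP.
Qed.

Lemma bottom_effect p (W : 'M[C]_p) s k : mxadj W = W -> spectrum W s -> (k <= p)%N ->
  exists T, [/\ effect T, rtr T = (p - k)%:R & rtr (W *m T) = \sum_(k <= i < p) s`_i].
Proof.
move=> hW hs kp.
have ht (i : 'I_p) : 0 <= (((k <= i)%N)%:R : R) <= 1 by rewrite ler0n lern1 leq_b1.
have [T [h1 h2 h3]] := spectrum_effect hW hs ht; exists T; split=> //.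
  rewrite h2 -natr_sum -(big_mkord xpredT (fun i => nat_of_bool (k <= i)%N)).
  rewrite (big_cat_nat (n := k)) //= big_nat big1 ?add0n => [|i /andP[_ h]]; last by rewrite leqNgt h.
  rewrite (eq_big_nat _ _ (F2 := fun=> 1%N)) => [|i /andP[-> _]] //.
  by rewrite sum_nat_const_nat muln1.
rewrite h3 -(big_mkord xpredT (fun i => s`_i * ((k <= i)%N)%:R)).
rewrite (big_cat_nat (n := k)) //= big_nat big1 ?add0r => [|i /andP[_ h]]; last by rewrite leqNgt h mulr0.
by apply: eq_big_nat => i /andP[-> _]; rewrite mulr1.
Qed.

Lemma negativityE p (W : 'M[C]_p) s : mxadj W = W -> spectrum W s -> rtr W = 1 ->
  negativity s = - \sum_(i < p) Num.min s`_i 0.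
Proof.
move=> hW hs h1; rewrite /negativity (big_nth 0) big_mkord (proj1 hs) -[X in _ - X]h1 -(spectrum_sum hW hs).
rewrite -sumrB mulr_suml -sumrN; apply: eq_bigr => i _.
case: (leP s`_i 0) => h; [rewrite ler0_norm //|rewrite ger0_norm ?ltW //]; lra.
Qed.

(** The test operator projects onto the nonpositive eigenspace. With [negativity_ge], the negativity
    is the maximum of - tr (W T) over effects of arbitrary trace. *)
Lemma neg_effect p (W : 'M[C]_p) s : mxadj W = W -> spectrum W s -> rtr W = 1 ->
  exists T, effect T /\ rtr (W *m T) = - negativity s.
Proof.
move=> hW hs h1.
have ht (i : 'I_p) : 0 <= ((s`_i <= 0)%R%:R : R) <= 1 by rewrite ler0n lern1 leq_b1.
have [T [h2 _ h3]] := spectrum_effect hW hs ht; exists T; split=> //.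
rewrite h3 (negativityE hW hs h1) opprK; apply: eq_bigr => i _.
by case: (leP s`_i 0) => h; rewrite ?mulr1 ?mulr0.
Qed.

Lemma negativity_ge p (W T : 'M[C]_p) s : mxadj W = W -> spectrum W s -> rtr W = 1 ->
  effect T -> - rtr (W *m T) <= negativity s.
Proof.
move=> hW hs h1 hT; have [t [h2 _ ->]] := effect_spectrum hW hs hT.
rewrite (negativityE hW hs h1) lerN2; apply: ler_sum => i _.
have /andP[t0 t1] := h2 i; case: (leP s`_i 0) => h; first by nra.
by rewrite mulr_ge0 // ltW.
Qed.

Lemma herm_sqr_ge0 p (A : 'M[C]_p) : mxadj A = A -> 0 <= rtr (A *m A).
Proof.
move=> /herm_eig [d [U hU]]; rewrite (rtr_eig _ hU); apply: sumr_ge0 => i _.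
by rewrite (qf_eig i hU) -expr2 sqr_ge0.
Qed.

Lemma herm_sqr_eq0 p (A : 'M[C]_p) : mxadj A = A -> rtr (A *m A) = 0 -> A = 0.
Proof.
move=> /herm_eig [d [U hU]]; rewrite (rtr_eig _ hU).
rewrite (eq_bigr (fun i => d i ^+ 2)) => [|i _]; last by rewrite (qf_eig i hU) expr2.
move=> /psumr_eq0P h; rewrite (proj2 hU) udiag_sum big1 // => i _.
have /eqP := h (fun j _ => sqr_ge0 _) i isT.
by rewrite sqrf_eq0 => /eqP ->; rewrite scale0r.
Qed.

Lemma psd_sqr_le p (A : 'M[C]_p) : psd A -> rtr (A *m A) <= rtr A ^+ 2.
Proof.
move=> hA; have [d [U hU]] := herm_eig (psd_herm hA).
have d0 i := eig_psd_ge0 i hU hA.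
rewrite (rtr_eig _ hU) (rtr_col A (proj1 hU)) expr2 mulr_suml; apply: ler_sum => i _.
rewrite (qf_eig i hU) ler_wpM2l // (eq_bigr d) => [|j _]; last by rewrite (qf_eig j hU).
by rewrite (bigD1 i) //= lerDl sumr_ge0.
Qed.

(** The sum of d_i (1 - d_i) vanishes with nonnegative terms, so the eigenvalues are 0 or 1 and
    exactly one of them is 1. *)
Lemma psd_sqr_eq1 p (A : 'M[C]_p) : psd A -> rtr A = 1 -> rtr (A *m A) = 1 ->
  exists psi, nsq psi = 1 /\ A = proj psi.
Proof.
move=> hA; have [d [U hU]] := herm_eig (psd_herm hA).
have d0 i := eig_psd_ge0 i hU hA.
have -> : rtr A = \sum_i d i.
  by rewrite (rtr_col A (proj1 hU)); apply: eq_bigr => i _; rewrite (qf_eig i hU).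
have -> : rtr (A *m A) = \sum_i d i ^+ 2.
  by rewrite (rtr_eig _ hU); apply: eq_bigr => i _; rewrite (qf_eig i hU) expr2.
move=> h1 h2.
have d1 i : d i <= 1 by rewrite -h1 (bigD1 i) //= lerDl sumr_ge0.
have hz : \sum_i d i * (1 - d i) = 0.
  by rewrite (eq_bigr (fun i => d i - d i ^+ 2)) ?sumrB ?h1 ?h2 ?subrr // => i _; ring.
have d01 i : d i = 0 \/ d i = 1.
  move/psumr_eq0P: hz => hz; have /eqP := hz (fun j _ => mulr_ge0 (d0 j) (etrans (subr_ge0 _ _) (d1 j))) i isT.
  by rewrite mulf_eq0 subr_eq0 => /orP[/eqP|/eqP]; [left|right].
have [i hi] : exists i, d i = 1.
  have [ i ] : exists i, d i == 1.
    apply/existsP; rewrite -[X in is_true X]negbK negb_exists; apply/negP => /forallP h.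
    move: h1; rewrite big1 => [/eqP|i _]; first by rewrite eq_sym oner_eq0.
    by have [//|h3] := d01 i; have := h i; rewrite h3 eqxx.
  by move=> /eqP; exists i.
exists (col i U); split; first exact: nsq_col (proj1 hU).
rewrite (proj2 hU) udiag_sum (bigD1 i) //= hi scale1r big1 ?addr0 // => j ji.
have [->|hj] := d01 j; first by rewrite scale0r.
move: h1; rewrite (bigD1 i) //= (bigD1 j) //= hi hj => h.
have : 0 <= \sum_(k | (k != i) && (k != j)) d k by apply: sumr_ge0.
by move=> h4; exfalso; lra.
Qed.

Lemma rtr_sqr_comb p (a b : R) (A B : 'M[C]_p) :
  rtr (((a%:C)%C *: A - (b%:C)%C *: B) *m ((a%:C)%C *: A - (b%:C)%C *: B)) =
  a ^+ 2 * rtr (A *m A) - 2 * a * b * rtr (A *m B) + b ^+ 2 * rtr (B *m B).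
Proof.
have hZ (x y : R) (X Y : 'M[C]_p) : rtr (((x%:C)%C *: X) *m ((y%:C)%C *: Y)) = x * y * rtr (X *m Y).
  by rewrite -scalemxAl rtrZ -scalemxAr rtrZ mulrA.
rewrite mulmxBl !mulmxBr !rtrB !hZ [rtr (B *m A)]rtrC; ring.
Qed.

(** With p = tr P and q = tr Q, tr (W^2) = tr (P^2) + 2 tr (P Q^Gamma) + tr (Q^2), to be compared
    with (p + q)^2 = 1. The cross term is strictly below p q when p, q > 0, so equality leaves p = 0
    and Q pure. *)
Lemma trsq_le1 m n (W : 'M[C]_(m * n)) : inD W -> trsq W <= 1 /\
  (trsq W = 1 -> exists psi : 'cV_(m * n),
     [/\ unit_vec psi, entangled psi & W = ptrans (proj psi)]).
Proof.
move=> hD; have [P [Q [hP hQ hW htr [hh _]]]] := inD_dec hD.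
have -> : trsq W = rtr (W *m W) by [].
pose q := rtr Q; pose p := rtr P.
have p0 : 0 <= p := psd_trace_ge0 hP.
have q0 : 0 <= q := psd_trace_ge0 hQ.
have hPP := psd_sqr_le hP; have hQQ := psd_sqr_le hQ.
have hGG : rtr (ptrans Q *m ptrans Q) = rtr (Q *m Q) by rewrite rtr_ptrans_mul ptransK.
have hWW : rtr (W *m W) = rtr (P *m P) + 2 * rtr (P *m ptrans Q) + rtr (Q *m Q).
  rewrite hW mulmxDl !mulmxDr !rtrD hGG [rtr (ptrans Q *m P)]rtrC; ring.
have [hpz|pn] := eqVneq p 0.
  have P0 := psd_trace0 hP hpz.
  have q1 : rtr Q = 1 by rewrite -/q; move: htr; rewrite -/p -/q; lra.
  rewrite hWW P0 !mul0mx !rtr0 mulr0 !add0r; rewrite q1 expr1n in hQQ.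
  split=> // h1; have [psi [n1 hpsi]] := psd_sqr_eq1 hQ q1 h1.
  exists psi; rewrite hW P0 add0r hpsi; split=> //; first exact/unit_vecP.
  move=> [a [b hab]]; apply: (D_not_psd hD); rewrite hW P0 add0r hpsi hab kron_ptrans.
  exact: psd_proj.
have [hqz|qn] := eqVneq q 0.
  exfalso; apply: (D_not_psd hD); rewrite hW (psd_trace0 hQ hqz) ptrans0 addr0 //.
have pp : 0 < p by rewrite lt0r pn.
have qp : 0 < q by rewrite lt0r qn.
(* tr (H^2) >= 0 is Cauchy-Schwarz for the cross term. It is strict: [H = 0] would make Q^Gamma
   proportional to P, and W positive. *)
pose H := (q%:C)%C *: P - (p%:C)%C *: ptrans Q.
have hH : mxadj H = H.
  by rewrite mxadjB !mxadjZ !conj_real (psd_herm hP) mxadj_ptrans (psd_herm hQ).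
have hHH : rtr (H *m H) = q ^+ 2 * rtr (P *m P) - 2 * p * q * rtr (P *m ptrans Q) + p ^+ 2 * rtr (Q *m Q).
  by rewrite rtr_sqr_comb hGG; ring.
have H0 := herm_sqr_ge0 hH.
have hHn : rtr (H *m H) != 0.
  apply/eqP => /(herm_sqr_eq0 hH) /eqP; rewrite subr_eq0 => /eqP hE.
  apply: (D_not_psd hD).
  have -> : W = ((p^-1)%:C)%C *: P.
    rewrite hW -[ptrans Q](scalerK (a := (p%:C)%C)); last by apply: contra pn => /eqP [->].
    rewrite -hE scalerA -fmorphV -rmorphM /= -[X in X + _]scale1r -scalerDl.
    rewrite -(rmorph1 (real_complex R)) -rmorphD /=; congr ((_%:C)%C *: _).
    have -> : q = 1 - p by move: htr; rewrite -/p -/q; lra.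
    by rewrite mulrBr mulr1 mulVf // addrC subrK.
  by apply: psdZ hP; rewrite invr_ge0.
have Hp : 0 < rtr (H *m H) by rewrite lt0r hHn.
rewrite hHH in Hp.
have hlt : rtr (P *m ptrans Q) < p * q.
  have h1 : q ^+ 2 * rtr (P *m P) <= q ^+ 2 * p ^+ 2 by rewrite ler_wpM2l // sqr_ge0.
  have h2 : p ^+ 2 * rtr (Q *m Q) <= p ^+ 2 * q ^+ 2 by rewrite ler_wpM2l // sqr_ge0.
  have h3 : (2 * p * q) * rtr (P *m ptrans Q) < (2 * p * q) * (p * q).
    have -> : 2 * p * q * (p * q) = q ^+ 2 * p ^+ 2 + p ^+ 2 * q ^+ 2 by ring.
    lra.
  by move: h3; rewrite ltr_pM2l // !mulr_gt0.
have hl1 : rtr (W *m W) < 1.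
  have -> : 1 = (p + q) ^+ 2 by rewrite htr expr1n.
  rewrite hWW; have -> : (p + q) ^+ 2 = p ^+ 2 + 2 * (p * q) + q ^+ 2 by ring.
  lra.
by split=> [|h]; [rewrite ltW | move: hl1; rewrite h ltxx].
Qed.

End Witness.

(** * Equality cases: smallest eigenvalue -1/2 and maximal negativity *)

Section Extremal.
Variable R : realType.
Local Notation C := R[i].

Lemma nsq_compress p q (F : 'M[C]_(p, q)) x : mxadj F *m F = 1%:M ->
  nsq (mxadj F *m x) <= nsq x /\ (nsq (mxadj F *m x) = nsq x -> F *m (mxadj F *m x) = x).
Proof.
move=> hF; have [hE1 hE2] := effect_range hF.
have hq : qf (F *m mxadj F) x = nsq (mxadj F *m x).
  by rewrite -[RHS]qf1 qf_mul mxadjK mulmx1.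
have hq2 : qf (1%:M - F *m mxadj F) x = nsq x - nsq (mxadj F *m x).
  by rewrite qfB qf1 hq.
split; first by rewrite -subr_ge0 -hq2; case/psdP: hE2.
move=> h; have h0 : qf (1%:M - F *m mxadj F) x = 0 by rewrite hq2 h subrr.
have := psd_kernel hE2 h0; rewrite mulmxBl mul1mx => /eqP; rewrite subr_eq0 => /eqP h1.
by rewrite mulmxA -h1.
Qed.

Lemma qf_PT_dvec s (a : 'I_s -> R) (z : 'cV[C]_(s * s)) :
  qf (ptrans (proj (dvec a))) z =
  \sum_i \sum_k a i * a k * complex.Re (Num.conj (z (tidx i k) 0) * z (tidx k i) 0).
Proof.
rewrite /qf rtr_PT_dvec; apply: eq_bigr => i _; apply: eq_bigr => k _.
congr (_ * complex.Re _); by rewrite mxE big_ord1 mxadjE mulrC.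
Qed.

Lemma nc_add_opp (x y : C) :
  nc (x + y) = nc x + nc y + 2 * complex.Re (Num.conj x * y).
Proof. by case: x => a b; case: y => c d; rewrite /nc /=; ring. Qed.

Lemma half_sq : (Num.sqrt 2 / 2) ^+ 2 = 2^-1 :> R.
Proof. by have [q [-> _ h]] := @sqrt2_spec R; rewrite expr_div_n h; field. Qed.

Lemma colsub_isometry p q r (f : 'I_r -> 'I_q) (u : 'M[C]_(p, q)) : injective f ->
  mxadj u *m u = 1%:M -> mxadj (colsub f u) *m colsub f u = 1%:M.
Proof.
move=> hf /matrixP hu; apply/matrixP => i j; have := hu (f i) (f j).
rewrite !mxE (inj_eq hf) => <-; apply: eq_bigr => k _; by rewrite !mxE.
Qed.

(** [g] is built from the Schmidt bases of [x] before any [psi] is given, so that all vectors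
    reaching -1/2 are multiples of the same [g]. *)
Lemma PT_extremal m n (x : 'cV[C]_(m * n)) : (2 <= m <= n)%N -> nsq x = 1 ->
  exists g : 'cV[C]_(m * n), schmidt_coeffs g [:: Num.sqrt 2 / 2; Num.sqrt 2 / 2] /\
    forall psi, nsq psi = 1 -> qf (ptrans (proj x)) psi = - 2^-1 ->
      exists c, nc c = 1 /\ psi = c *: g.
Proof.
move=> /andP[m2 mn] hx; have [u [w [a [hu hw a0 hs hxe]]]] := svd_vec x mn.
pose i0 : 'I_m := Ordinal (ltnW m2); pose i1 : 'I_m := Ordinal m2.
pose F := tens (cnj u) w.
have hcu := cnj_isometry hu.
have hF : mxadj F *m F = 1%:M by apply: tens_isometry.
have hS : \sum_i a i ^+ 2 = 1 by rewrite -hx hxe nsq_tens_dvec.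
pose f i k := kron (col i (cnj u)) (col k w).
pose h := Num.sqrt 2 / 2 : R.
have h0 : 0 < h by rewrite divr_gt0 // sqrtr_gt0.
(* The antisymmetric vector on the two leading Schmidt directions; the swap gives it the value -a_0
   a_1. *)
pose g := (h%:C)%C *: f i0 i1 - (h%:C)%C *: f i1 i0.
exists g; split.
  split; first by rewrite /= h0.
  pose f1 (k : 'I_2) := if k == ord0 then i0 else i1.
  pose f2 (k : 'I_2) := if k == ord0 then i1 else i0.
  have hf1 : injective f1 by move=> [[|[|//]] p] [[|[|//]] q] //= _; apply: val_inj.
  have hf2 : injective f2 by move=> [[|[|//]] p] [[|[|//]] q] //= _; apply: val_inj.
  (* Schmidt coefficients must be positive, so the minus sign of [g] goes into the second basis. *)
  pose sg (k : 'I_2) : R := if k == ord0 then 1 else -1.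
  pose D : 'M[C]_2 := diag_mx (\row_k (sg k)%:C%C).
  have hD : mxadj D *m D = 1%:M.
    rewrite /D mxadj_diag; apply/matrixP => p q; rewrite mul_diag_mx !mxE.
    case: eqP => _; rewrite ?mulr0n ?mulr1n ?mulr0 // -rmorphM /=; congr (_%:C)%C.
    by rewrite /sg; case: eqP => _; rewrite ?mulr1 ?mulrNN ?mulr1.
  pose V2 := colsub f2 w *m D.
  have hV2i : mxadj V2 *m V2 = 1%:M.
    by rewrite mxadjM mulmxA -[mxadj D *m _ *m _]mulmxA (colsub_isometry hf2 hw) mulmx1.
  have hV2 j k : V2 j k = w j (f2 k) * (sg k)%:C%C by rewrite /V2 /D mul_mx_diag !mxE.
  clearbody V2; exists (colsub f1 (cnj u)), V2.
  split; first exact: colsub_isometry.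
  split=> //.
  rewrite !big_ord_recl big_ord0 addr0 /=; congr (_ + _).
    apply/matrixP => p q; rewrite !mxE hV2; congr (_ * (_ * _)).
    by rewrite /sg eqxx mulr1.
  apply/matrixP => p q; rewrite !mxE hV2 -mulrN -mulrN; congr (_ * (_ * _)).
  by rewrite /sg /= rmorphN rmorph1 mulrN1.
move=> psi hpsi; rewrite hxe PT_tens -/F -[X in X *m _ *m _]mxadjK -qf_mul.
set z := mxadj F *m psi => hE.
have [hz1 hz2] := nsq_compress psi hF; rewrite -/z hpsi in hz1 hz2; clearbody z.
rewrite qf_PT_dvec in hE.
pose Z i k := z (tidx i k) 0.
pose rho i k := complex.Re (Num.conj (Z i k) * Z k i).
have ha01 : a i0 * a i1 <= 2^-1.
  have := pair_le_sumsq a (isT : i0 != i1); rewrite hS.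
  have := sqr_ge0 (a i0 - a i1); nra.
have hrho i k : - (nc (Z i k) + nc (Z k i)) <= 2 * rho i k.
  by have := Re_cross (Z i k) (Z k i); rewrite ler_norml => /andP[].
have hmax i k : i != k -> a i * a k <= a i0 * a i1.
  rewrite -(inj_eq val_inj) neq_ltn => /orP[ik|ik]; [|rewrite [X in X <= _]mulrC].
    by apply: ler_pM => //; apply: hs => //=; apply: leq_ltn_trans ik.
  by apply: ler_pM => //; apply: hs => //=; apply: leq_ltn_trans ik.
(* Each [G i k] is nonnegative, while the total is -1/2 + a_0 a_1 |z|^2 <= 0. Hence every term
   vanishes, a_0 a_1 = 1/2 and |z| = 1: the other coefficients are 0 and [z] is antisymmetric on the
   pair (0, 1). *)
pose G i k := a i * a k * rho i k + a i0 * a i1 * ((nc (Z i k) + nc (Z k i)) / 2).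
have a010 : 0 <= a i0 * a i1 by rewrite mulr_ge0.
have hG i k : 0 <= G i k.
  have n1 := nc_ge0 (Z i k); have n2 := nc_ge0 (Z k i).
  have [ik|ik] := eqVneq i k.
    rewrite /G ik; have -> : rho k k = nc (Z k k) by rewrite /rho ncE.
    have n0 := nc_ge0 (Z k k).
    by apply: addr_ge0; [rewrite !mulr_ge0 | apply: mulr_ge0 => //; lra].
  have x0 : 0 <= a i * a k by rewrite mulr_ge0.
  have := hmax _ _ ik; have := hrho i k; rewrite /G.
  move: (a i * a k) (rho i k) (a i0 * a i1) (nc (Z i k)) (nc (Z k i)) x0 a010 n1 n2.
  by move=> p q r s t p0 r0 s0 t0 h1 h2; nra.
have hZ : \sum_i \sum_k nc (Z i k) = nsq z by rewrite /nsq sum_tidx.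
have hGs : \sum_i \sum_k G i k = - 2^-1 + a i0 * a i1 * nsq z.
  rewrite -hE -hZ mulr_sumr -big_split /=.
  rewrite (eq_bigr (fun i => \sum_k a i * a k * rho i k + (\sum_k a i0 * a i1 / 2 * nc (Z i k) + \sum_k a i0 * a i1 / 2 * nc (Z k i)))); last first.
    by move=> i _; rewrite -!big_split /=; apply: eq_bigr => k _; rewrite /G; field.
  rewrite !big_split /=; congr (_ + _).
  rewrite [X in _ + X]exchange_big /= -big_split /=; apply: eq_bigr => i _.
  by rewrite -mulr_sumr; field.
have hGs0 : \sum_i \sum_k G i k = 0.
  apply/eqP; rewrite eq_le; apply/andP; split; last by apply: sumr_ge0 => i _; apply: sumr_ge0.
  rewrite hGs; have := nsq_ge0 z; move: (nsq z) (a i0 * a i1) hz1 ha01 a010 => p q p1 q1 q0 p0; nra.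
have G0 i k : G i k = 0.
  move/psumr_eq0P: hGs0 => h1; have /psumr_eq0P h2 := h1 (fun i _ => sumr_ge0 _ (fun k _ => hG i k)) i isT.
  exact: h2 (fun k _ => hG i k) k isT.
rewrite hGs0 in hGs.
have [e1 e2] : a i0 * a i1 = 2^-1 /\ nsq z = 1.
  have := nsq_ge0 z; move: (nsq z) (a i0 * a i1) hz1 ha01 a010 hGs => p q p1 q1 q0 e p0.
  by split; nra.
have ha2 i : i != i0 -> i != i1 -> a i = 0.
  move=> ni0 ni1; move: hS; rewrite (bigD1 i0) //= (bigD1 i1) //= (bigD1 i) /=; last by rewrite ni0 ni1.
  set t := \sum_(_ | _) _ => hS.
  have t0 : 0 <= t by apply: sumr_ge0 => j _; apply: sqr_ge0.
  have s0 := sqr_ge0 (a i0 - a i1); have s1 := sqr_ge0 (a i).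
  have : a i ^+ 2 = 0 by nra.
  by move/eqP; rewrite sqrf_eq0 => /eqP.
have hz0 i k : a i * a k = 0 \/ i = k -> nc (Z i k) = 0.
  have := G0 i k; rewrite /G e1; have n1 := nc_ge0 (Z i k); have n2 := nc_ge0 (Z k i).
  move=> g1 [h1|ik]; first by rewrite h1 in g1; lra.
  move: g1; rewrite ik; have -> : rho k k = nc (Z k k) by rewrite /rho ncE.
  by have := nc_ge0 (Z k k); have := mulr_ge0 (a0 k) (a0 k); nra.
have hz01 : Z i1 i0 = - Z i0 i1.
  have := G0 i0 i1; rewrite /G e1 => h1.
  have h2 : nc (Z i0 i1 + Z i1 i0) = 0 by rewrite nc_add_opp -/(rho i0 i1); lra.
  by move/eqP: h2; rewrite nc_eq0 addrC addr_eq0 => /eqP.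
have n01 : (i0 == i1) = false by [].
have hzE : z = Z i0 i1 *: (delta_mx (tidx i0 i1) 0 - delta_mx (tidx i1 i0) 0).
  apply/matrixP => k l; rewrite ord1 -(tidxK k) !mxE !tidx_eq !andbT.
  move: (idx1 k) (idx2 k) => i j; rewrite -/(Z i j).
  have [->|ni0] := eqVneq i i0.
    have [->|nj1] := eqVneq j i1; first by rewrite n01 /= subr0 mulr1.
    have hZ0 : Z i0 j = 0.
      apply/eqP; rewrite -nc_eq0; apply/eqP/hz0.
      by have [->|nj0] := eqVneq j i0; [right | left; rewrite (ha2 j) // mulr0].
    by rewrite hZ0 /= subr0 mulr0.
  have [->|ni1] := eqVneq i i1.
    have [->|nj0] := eqVneq j i0; first by rewrite /= sub0r mulrN1 hz01.
    have hZ0 : Z i1 j = 0.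
      apply/eqP; rewrite -nc_eq0; apply/eqP/hz0.
      by have [->|nj1] := eqVneq j i1; [right | left; rewrite (ha2 j) // mulr0].
    by rewrite hZ0 /= subr0 mulr0.
  have hZ0 : Z i j = 0.
    by apply/eqP; rewrite -nc_eq0; apply/eqP/hz0; left; rewrite (ha2 i) // mul0r.
  by rewrite hZ0 /= subr0 mulr0.
have hfd i k : F *m delta_mx (tidx i k) 0 = f i k.
  by rewrite -colE; apply/matrixP => j l; rewrite !mxE !idx1_tidx !idx2_tidx.
have hh : (h%:C)%C != 0 :> C by apply: contra (lt0r_neq0 h0) => /eqP [->].
exists (Z i0 i1 / (h%:C)%C); split.
  rewrite ncM; have -> : nc ((h%:C)%C^-1) = 2.
    by rewrite -fmorphV nc_real exprVn half_sq invrK.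
  have := e2; rewrite hzE nsqZ -[delta_mx _ _ - _](_ : delta_mx (tidx i0 i1) 0 + ((-1 : R)%:C)%C *: delta_mx (tidx i1 i0) 0 = _); last first.
    by rewrite rmorphN rmorph1 scaleN1r.
  by rewrite nsq_delta2 ?tidx_eq // sqrrN expr1n.
rewrite -hz2 // hzE -scalemxAr mulmxBr !hfd /g -scalerBr scalerA; congr (_ *: _).
by rewrite mulfVK.
Qed.

(** x + c y is again a kernel vector, of squared norm 1 + |c|^2, so the cross terms of its Gram
    matrix cancel for every c; c = 1 and c = i separate them. *)
Lemma kernel_ortho m n (M : 'M[C]_(m * n)) (x y : 'cV[C]_(m * n)) :
  (forall psi : 'cV_(m * n), M *m psi = 0 ->
     cmat psi *m mxadj (cmat psi) = ((nsq psi / m%:R)%:C)%C%:M) ->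
  M *m x = 0 -> M *m y = 0 -> nsq x = 1 -> nsq y = 1 -> (mxadj x *m y) 0 0 = 0 ->
  cmat x *m mxadj (cmat y) = 0.
Proof.
move=> hM hx hy nx ny hxy.
have cmatD c : cmat (x + c *: y) = cmat x + c *: cmat y.
  by apply/matrixP => i j; rewrite !mxE.
have hyx : (mxadj y *m x) 0 0 = 0.
  by rewrite -[x]mxadjK -mxadjM mxadjE hxy rmorph0.
have hn c : nsq (x + c *: y) = 1 + nc c.
  apply: (@complexI R); rewrite -nsqE0 mxadjD mxadjZ mulmxDl !mulmxDr -!scalemxAl -!scalemxAr.
  have mxD (A B : 'M[C]_1) : (A + B) 0 0 = A 0 0 + B 0 0 by rewrite mxE.
  have mxZ k (A : 'M[C]_1) : (k *: A) 0 0 = k * A 0 0 by rewrite mxE.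
  rewrite !mxD !mxZ hxy hyx !nsqE0 nx ny !mulr0 addr0 add0r rmorphD /= mulrA ncE.
  by rewrite rmorph1 mulr1.
pose A := cmat x *m mxadj (cmat y); pose B := cmat y *m mxadj (cmat x).
have hc c : Num.conj c *: A + c *: B = 0.
  have := hM (x + c *: y); rewrite mulmxDr -scalemxAr hx hy scaler0 addr0 => /(_ erefl).
  rewrite cmatD mxadjD mxadjZ mulmxDl !mulmxDr -!scalemxAl -!scalemxAr hn.
  rewrite (hM x hx) (hM y hy) nx ny scalerA [c * _]mulrC ncE -/A -/B => h1.
  have h2 : ((1 / m%:R)%:C)%C%:M + ((nc c)%:C)%C *: ((1 / m%:R)%:C)%C%:M = (((1 + nc c) / m%:R)%:C)%C%:M :> 'M[C]_m.
    by rewrite scale_scalar_mx -raddfD /= -rmorphM -rmorphD /=; congr ((_ %:C)%C %:M); ring.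
  move: h1; rewrite -h2 -!addrA => /addrI; rewrite addrA -[RHS]add0r => /addIr //.
have h1 := hc 1; have h2 := hc 'i.
rewrite rmorph1 !scale1r in h1; rewrite conjCi in h2.
have hB : B = - A by apply/eqP; rewrite -addr_eq0 addrC h1.
move: h2; rewrite hB scalerN scaleNr -opprD => /eqP; rewrite oppr_eq0 -scalerDl scaler_eq0.
rewrite -mulr2n mulrn_eq0 /= (negPf (neq0Ci _)) /=.
by move/eqP.
Qed.

Lemma Phi_neg_forward m n (W : 'M[C]_(m * n)) s : (2 <= m <= n)%N -> inD W -> spectrum W s ->
  negativity s = (m%:R - 1) / 2 ->
  exists (U : 'M[C]_m) (V : 'M[C]_n) (k : nat),
    unitary U /\ unitary V /\ (1 <= k <= n %/ m)%N /\
    exists p : 'I_k -> R, (forall j, 0 <= p j) /\ \sum_(j < k) p j = 1 /\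
      tensmx U V *m W *m mxadj (tensmx U V) =
        \sum_(j < k) ((p j)%:C)%C *: ptrans (proj (@Phi R m n j)).
Proof.
move=> /andP[m2 mn] hD hs hneg.
have m0 : 0 < m%:R :> R by rewrite ltr0n (ltnW m2).
have c0 : 0 < (m%:R - 1) / 2 :> R by rewrite divr_gt0 // subr_gt0 ltr1n.
have [T [hT hTW]] := neg_effect (inD_herm hD) hs (inD_rtr hD).
rewrite hneg in hTW.
have [d [U0 [hW hU d1 d0 [hM hK]]]] := inD_lower_eq hD hT c0 (fun psi => PT_lowerN mn psi hT) hTW.
set M := ptrans T + _ in hM hK.
have hMk psi : M *m psi = 0 -> cmat psi *m mxadj (cmat psi) = ((nsq psi / m%:R)%:C)%C%:M.
  move=> h; apply: (PT_lowerN_eq mn hT); have : qf M psi = 0 by rewrite qfE -mulmxA h mulmx0 mxE.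
  rewrite qfD /qf rtr_ptrans_mul rtrC -scalemx1 -scalemxAl rtrZ mul1mx rtr_proj.
  by move/eqP; rewrite addr_eq0 => /eqP.
pose A := [set i | d i != 0]; pose e := @enum_val _ (mem A); set k := #|A| in e.
have he j : d (e j) != 0 by have := enum_valP j; rewrite inE.
pose ps j := col (e j) U0.
have hker j : M *m ps j = 0 by apply: psd_kernel => //; apply: hK.
have hpp j l : cmat (ps j) *m mxadj (cmat (ps l)) = (((j == l)%:R / m%:R)%:C)%C%:M.
  have [->|jl] := eqVneq j l; first by rewrite hMk // nsq_col.
  rewrite mul0r rmorph0; apply: (kernel_ortho hMk) => //; rewrite ?nsq_col // unitary_col //.
  by rewrite (inj_eq enum_val_inj) (negPf jl).
pose sm : R := Num.sqrt m%:R.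
have hsm : sm ^+ 2 = m%:R by rewrite sqr_sqrtr // ltW.
have sm0 : sm != 0 by rewrite gt_eqF // sqrtr_gt0.
(* The blocks sqrt m A_j are stacked, the row (j, i) sitting at j m + i. Its [k * m] orthonormal
   rows in C^n force k <= n / m. *)
pose B : 'M[C]_(k * m, n) := \matrix_(r, l) ((sm%:C)%C * cmat (ps (idx1 r)) (idx2 r) l).
have hB : B *m mxadj B = 1%:M.
  apply/matrixP => r r'; rewrite mxE.
  have /matrixP /(_ (idx2 r) (idx2 r')) := hpp (idx1 r) (idx1 r').
  rewrite !mxE => h1.
  rewrite (eq_bigr (fun l => ((sm ^+ 2)%:C)%C * (cmat (ps (idx1 r)) (idx2 r) l * mxadj (cmat (ps (idx1 r'))) l (idx2 r')))).
    rewrite -mulr_sumr h1 hsm -[in RHS](tidxK r) -[in RHS](tidxK r') tidx_eq.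
    case: eqP => _; case: eqP => _; rewrite ?mulr0n ?mulr1n ?mulr0 //=; last by rewrite mul0r mulr0.
    by rewrite -rmorphM /= mul1r mulfV // gt_eqF.
  move=> l _; rewrite !mxadjE mxE [X in _ * Num.conj X]mxE rmorphM /= conj_real expr2 rmorphM /=; ring.
have [kmn [V0 hV0 hV]] := unitary_complete hB.
have hk : (0 < k)%N.
  rewrite lt0n cards_eq0; apply/negP => /eqP hA; move: d1; rewrite big1 => [/eqP|i _].
    by rewrite eq_sym oner_eq0.
  by apply/eqP/negPn/negP => h; have : i \in A; [rewrite inE | rewrite hA inE].
have hV0' : unitary (cnj V0).
  apply/unitaryP; have /unitaryP [_ h2] := hV0.
  by split; [apply: mulmx1C|]; apply: cnj_isometry h2.
(* The second unitary acts on coefficient matrices as A V^T. The conjugate makes this right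
   multiplication by V0^*, which sends the rows of [B] to basis vectors. *)
exists 1%:M, (cnj V0), k; split; first by apply/unitaryP; rewrite mxadj1 mulmx1.
split=> //; split; first by rewrite hk leq_divRL // (ltnW m2).
exists (fun j => d (e j)); split=> [j|]; first exact: d0.
split.
  rewrite -d1 (bigID (mem A)) /= [X in _ = _ + X]big1 ?addr0 => [|i]; last first.
    by rewrite inE negbK => /eqP.
  by rewrite [RHS]big_enum_val.
have hF : tensmx 1%:M (cnj V0) = tens 1%:M (cnj V0) by [].
have hc1 : cnj 1%:M = 1%:M :> 'M[C]_m by rewrite /cnj map_mx1.
rewrite hW hF mulmx_sumr mulmx_suml (bigID (mem A)) /= [X in _ + X]big1 ?addr0 => [|i]; last first.
  by rewrite inE negbK => /eqP ->; rewrite scale0r mulmx0 mul0mx.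
rewrite big_enum_val; apply: eq_bigr => j _.
rewrite -scalemxAr -scalemxAl; congr (_ *: _).
rewrite -{1 2}hc1 -ptrans_tens -proj_mul; congr (ptrans (proj _)).
apply: cmat_inj; apply/matrixP => i l.
(* Row (j, i) of [B] becomes the basis vector at j m + i, which is the shift defining [Phi]. *)
have hr : (j * m + i < n)%N := leq_trans (ltn_ord (tidx j i)) kmn.
have /unitaryP [/matrixP /(_ (Ordinal hr) l) hVV _] := hV0.
transitivity (((sm^-1)%:C)%C * (V0 *m mxadj V0) (Ordinal hr) l).
  rewrite !mxE sum_tidx (bigD1 i) //= [X in _ + X]big1 ?addr0 => [|i' hi]; last first.
    by rewrite big1 // => l' _; rewrite tensE !mxE eq_sym (negPf hi) !mul0r.
  rewrite mulr_sumr; apply: eq_bigr => l' _.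
  rewrite tensE [_%:M _ _]mxE eqxx mul1r (hV (tidx j i)) // !mxE !idx1_tidx !idx2_tidx.
  by rewrite !mulrA -rmorphM /= mulVf // mul1r mulrC.
rewrite hVV !mxE !idx1_tidx !idx2_tidx -(inj_eq val_inj) /= eq_sym addnC.
by case: eqP => _; rewrite ?mulr1 ?mulr0.
Qed.

End Extremal.

(** * Test operators that attain the bounds, and the vectors [Phi] *)

Section Attain.
Variable R : realType.
Local Notation C := R[i].

Definition iso p q : 'M[C]_(p, q) := \matrix_(i, j) ((i == j :> nat)%:R).

Lemma iso_isometry p q : (q <= p)%N -> mxadj (iso p q) *m iso p q = 1%:M.
Proof.
move=> qp; apply/matrixP => i j; rewrite !mxE (bigD1 (widen_ord qp i)) //= big1 ?addr0 => [|k hk].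
  by rewrite !mxE eqxx rmorph1 mul1r.
rewrite !mxE; case: eqP => [h|_]; last by rewrite rmorph0 mul0r.
by case/eqP: hk; apply: val_inj.
Qed.

Lemma tens_dvec m n s (u : 'M[C]_(m, s)) (v : 'M[C]_(n, s)) (a : 'I_s -> R) :
  tens u v *m dvec a = \sum_k ((a k)%:C)%C *: kron (col k u) (col k v).
Proof.
apply: cmat_inj; rewrite cmat_tens; apply/matrixP => i j.
rewrite mul_mx_diag !mxE summxE; apply: eq_bigr => k _.
by rewrite !mxE idx1_tidx idx2_tidx mulrCA mulrA.
Qed.

Lemma schmidt_tens m n (psi : 'cV[C]_(m * n)) (c : seq R) : schmidt_coeffs psi c ->
  exists (u : 'M[C]_(m, size c)) (v : 'M[C]_(n, size c)),
  [/\ mxadj u *m u = 1%:M, mxadj v *m v = 1%:M & psi = tens u v *m dvec (fun k => c`_k)].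
Proof. by move=> [_ [u [v [hu [hv ->]]]]]; exists u, v; split=> //; rewrite tens_dvec. Qed.

Lemma schmidt_exists m n (c : seq R) : all (fun x => 0 < x) c ->
  (size c <= m <= n)%N -> \sum_(k < size c) c`_k ^+ 2 = 1 ->
  exists psi : 'cV[C]_(m * n), unit_vec psi /\ schmidt_coeffs psi c.
Proof.
move=> hc /andP[cm mn] h1.
have hu := iso_isometry cm; have hv := iso_isometry (leq_trans cm mn).
exists (tens (iso m (size c)) (iso n (size c)) *m dvec (fun k => c`_k)); split.
  by apply/unit_vecP; rewrite nsq_tens_dvec.
by split=> //; exists (iso m (size c)), (iso n (size c)); rewrite tens_dvec.
Qed.

(** For weights symmetric in the two indices, the span of |ik> and |ki> carries the matrix with [al]
    on and [be] off the diagonal, of eigenvalues al +- be. The choice al = 1/2, be = -+1/2 is the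
    projector on (|ik> -+ |ki>)/sqrt 2. *)
Definition swapmx s (al be : 'I_s -> 'I_s -> R) : 'M[C]_(s * s) :=
  \matrix_(x, y) ((al (idx1 x) (idx2 x))%:C%C * (x == y)%:R +
    (be (idx1 x) (idx2 x))%:C%C * ((idx1 x == idx2 y) && (idx2 x == idx1 y))%:R).

Lemma swapmxE s (al be : 'I_s -> 'I_s -> R) i k j l :
  swapmx al be (tidx i k) (tidx j l) =
  (al i k)%:C%C * ((i == j) && (k == l))%:R + (be i k)%:C%C * ((i == l) && (k == j))%:R.
Proof. by rewrite mxE tidx_eq !idx1_tidx !idx2_tidx. Qed.

Lemma swapmx_mul s (al be : 'I_s -> 'I_s -> R) (x : 'cV[C]_(s * s)) i k :
  (swapmx al be *m x) (tidx i k) 0 =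
  (al i k)%:C%C * x (tidx i k) 0 + (be i k)%:C%C * x (tidx k i) 0.
Proof.
rewrite mxE (eq_bigr (fun y => (al i k)%:C%C * ((tidx i k == y)%:R * x y 0) +
   (be i k)%:C%C * ((tidx k i == y)%:R * x y 0))); last first.
  move=> y _; rewrite -(tidxK y) swapmxE !tidx_eq mulrDl !mulrA [(k == _) && _]andbC //.
have hd (a : 'I_(s * s)) : \sum_y ((a == y)%:R * x y 0) = x a 0.
  rewrite (bigD1 a) //= eqxx mul1r big1 ?addr0 // => y; rewrite eq_sym => /negPf ->.
  by rewrite mul0r.
by rewrite big_split /= -!mulr_sumr !hd.
Qed.

Lemma swapmx_psd s (al be : 'I_s -> 'I_s -> R) :
  (forall i k, al i k = al k i) -> (forall i k, be i k = be k i) ->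
  (forall i k, `|be i k| <= al i k) -> psd (swapmx al be).
Proof.
move=> hal hbe hle; apply/psdP; split.
  apply/matrixP => a b; rewrite mxadjE -(tidxK a) -(tidxK b) !swapmxE.
  move: (idx1 a) (idx2 a) (idx1 b) (idx2 b) => i k j l.
  rewrite rmorphD !rmorphM /= !conj_real !rmorph_nat (eq_sym j i) (eq_sym l k) (eq_sym j k) (eq_sym l i).
  congr (_ + _).
    by case: eqP => [->|_] /=; [case: eqP => [->|_] //= |]; rewrite ?mulr0.
  case: (eqVneq i l) => [->|_] /=; rewrite ?andbF ?mulr0 // andbT.
  by case: eqP => [->|_]; rewrite ?mulr0 // hbe.
move=> x; rewrite qfE -mulmxA mxE sum_tidx Re_sum.
rewrite (eq_bigr (fun i => \sum_k (al i k * nc (x (tidx i k) 0) +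
   be i k * complex.Re (Num.conj (x (tidx i k) 0) * x (tidx k i) 0)))); last first.
  move=> i _; rewrite Re_sum; apply: eq_bigr => k _.
  by rewrite swapmx_mul mxadjE mulrDr ReD !(mulrCA (Num.conj _)) !ReZ ncE.
apply: (@le_trans _ _ (\sum_i \sum_k (al i k * nc (x (tidx i k) 0) -
     `|be i k| * ((nc (x (tidx i k) 0) + nc (x (tidx k i) 0)) / 2)))); last first.
  apply: ler_sum => i _; apply: ler_sum => k _; rewrite lerD2l -mulrN.
  have := Re_cross (x (tidx i k) 0) (x (tidx k i) 0).
  move: (complex.Re _) (nc _ + nc _) (be i k) => r t b; rewrite ler_norml => /andP[h1 h2].
  case: (lerP 0 b) => hb; [rewrite ger0_norm // | rewrite ltr0_norm //]; nra.
have -> : \sum_i \sum_k (al i k * nc (x (tidx i k) 0) -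
     `|be i k| * ((nc (x (tidx i k) 0) + nc (x (tidx k i) 0)) / 2)) =
   \sum_i \sum_k (al i k - `|be i k|) * nc (x (tidx i k) 0).
  rewrite (eq_bigr (fun i => \sum_k (al i k - `|be i k| / 2) * nc (x (tidx i k) 0) -
     \sum_k (`|be k i| / 2) * nc (x (tidx k i) 0))); last first.
    by move=> i _; rewrite -sumrB; apply: eq_bigr => k _; rewrite (hbe k i); field.
  rewrite sumrB [X in _ - X]exchange_big /= -sumrB; apply: eq_bigr => i _.
  by rewrite -sumrB; apply: eq_bigr => k _; field.
by apply: sumr_ge0 => i _; apply: sumr_ge0 => k _; rewrite mulr_ge0 ?nc_ge0 // subr_ge0.
Qed.

Lemma swapmx_effect s (al be : 'I_s -> 'I_s -> R) :
  (forall i k, al i k = al k i) -> (forall i k, be i k = be k i) ->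
  (forall i k, `|be i k| <= al i k) -> (forall i k, al i k + `|be i k| <= 1) ->
  effect (swapmx al be).
Proof.
move=> hal hbe h1 h2; split; first exact: swapmx_psd.
have -> : 1%:M - swapmx al be = swapmx (fun i k => 1 - al i k) (fun i k => - be i k).
  apply/matrixP => a b; rewrite !mxE rmorphB rmorphN rmorph1 /=; ring.
apply: swapmx_psd => [i k|i k|i k]; rewrite ?(hal i k) ?(hbe i k) // normrN.
by have := h2 i k; rewrite hal hbe; lra.
Qed.

Lemma PT_attain m n s (u : 'M[C]_(m, s)) (v : 'M[C]_(n, s)) (al be : 'I_s -> 'I_s -> R) :
  mxadj u *m u = 1%:M -> mxadj v *m v = 1%:M ->
  (forall i k, al i k = al k i) -> (forall i k, be i k = be k i) ->
  (forall i k, `|be i k| <= al i k) -> (forall i k, al i k + `|be i k| <= 1) ->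
  exists T : 'M[C]_(m * n), [/\ effect T, rtr T = \sum_i \sum_k (al i k + (i == k)%:R * be i k) &
    forall a, rtr (ptrans (proj (tens u v *m dvec a)) *m T) =
      \sum_i \sum_k a i * a k * ((i == k)%:R * al i k + be i k)].
Proof.
move=> hu hv hal hbe h1 h2; pose F := tens (cnj u) v.
have hF : mxadj F *m F = 1%:M by apply: tens_isometry => //; apply: cnj_isometry.
have [hT ht] := effect_extend hF (swapmx_effect hal hbe h1 h2).
exists (F *m swapmx al be *m mxadj F); split=> //.
  rewrite ht /rtr /mxtrace sum_tidx Re_sum; apply: eq_bigr => i _; rewrite Re_sum.
  apply: eq_bigr => k _; rewrite swapmxE !eqxx /= ReD !ReZ (eq_sym k) andbb.
  by rewrite /= mulr1; case: (i == k); rewrite /= ?mulr1 ?mulr0 ?mul1r ?mul0r.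
move=> a; rewrite PT_tens -/F !mulmxA rtrC !mulmxA hF mul1mx -[_ *m mxadj F *m F *m _]mulmxA.
rewrite mulmxA -[ptrans _ *m _ *m _]mulmxA hF mulmx1 rtr_PT_dvec; apply: eq_bigr => i _; apply: eq_bigr => k _.
rewrite swapmxE !eqxx /= ReD !ReZ (eq_sym k i) andbb hal hbe.
by case: (i == k); rewrite /= ?mulr1 ?mulr0 ?mul1r ?mul0r.
Qed.

Definition shiftmx m n (j : nat) : 'M[C]_(n, m) := \matrix_(l, i) ((l == i + j * m :> nat)%N%:R).

Lemma Phi_tens m n j :
  @Phi R m n j = tens 1%:M (shiftmx m n j) *m dvec (fun=> (Num.sqrt m%:R)^-1).
Proof.
apply: cmat_inj; rewrite cmat_tens mul1mx; apply/matrixP => i l.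
rewrite mul_diag_mx !mxE !idx1_tidx !idx2_tidx.
by case: eqP => _; rewrite ?mulr1 ?mulr0.
Qed.

Section Phi.
Variables (m n k : nat).
Hypotheses (m0 : (0 < m)%N) (kmn : (k * m <= n)%N).

Lemma shift_iso (j : 'I_k) l i : shiftmx m n j l i = iso n (k * m) l (tidx j i).
Proof. by rewrite !mxE /= addnC. Qed.

Lemma shiftmx_isometry (j : 'I_k) : mxadj (shiftmx m n j) *m shiftmx m n j = 1%:M.
Proof.
apply/matrixP => i i'; have /matrixP /(_ (tidx j i) (tidx j i')) := iso_isometry kmn.
rewrite !mxE tidx_eq eqxx => <-; apply: eq_bigr => l _.
by rewrite !mxadjE !shift_iso.
Qed.

Lemma sum_inv_m : \sum_(i < m) ((Num.sqrt m%:R)^-1 : R) ^+ 2 = 1.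
Proof.
rewrite sumr_const card_ord exprVn sqr_sqrtr ?ler0n // -[_ *+ m]mulr_natr mulVf //.
by rewrite pnatr_eq0 -lt0n.
Qed.

Lemma nsq_Phi (j : 'I_k) : nsq (@Phi R m n j) = 1.
Proof.
rewrite Phi_tens nsq_tens_dvec ?sum_inv_m //; last exact: shiftmx_isometry.
by rewrite mxadj1 mulmx1.
Qed.

(** The partial transpose preserves the trace product, and distinct [Phi] have disjoint supports in
    the second factor. *)
Lemma Phi_dot (j l : 'I_k) :
  rtr (ptrans (proj (@Phi R m n j)) *m ptrans (proj (@Phi R m n l))) = (j == l)%:R.
Proof.
rewrite rtr_ptrans_mul ptransK -/(qf _ _) qf_proj.
have [->|jl] := eqVneq j l; first by rewrite nsqE0 nsq_Phi (nc_real (1 : R)) expr1n.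
rewrite mxE big1 ?(nc_real (0 : R)) ?expr0n // => a _.
rewrite mxadjE !mxE; case: eqP => [h1|_]; last by rewrite rmorph0 mul0r.
case: eqP => [h2|_]; last by rewrite mulr0.
case/eqP: jl; apply: val_inj => /=; move: h2; rewrite h1 => /addnI /eqP.
by rewrite eqn_pmul2r // => /eqP.
Qed.

(** m |Phi_j><Phi_j|^Gamma swaps C^m with the j-th block of m basis vectors of C^n. As the blocks
    are disjoint, the sum still has norm at most 1, and (1 - S)/2 tests all mixtures of the Phi_j at
    once. *)
Definition Sblock : 'M[C]_(m * n) :=
  \sum_(j < k) ((m%:R : R)%:C)%C *: ptrans (proj (@Phi R m n j)).

Lemma Sblock_bound (x : 'cV[C]_(m * n)) : `|qf Sblock x| <= nsq x.
Proof.
pose F := tens 1%:M (iso n (k * m)) : 'M[C]_(m * n, m * (k * m)).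
have hF : mxadj F *m F = 1%:M.
  by apply: tens_isometry; [rewrite mxadj1 mulmx1 | apply: iso_isometry].
have [hc _] := nsq_compress x hF; apply: le_trans hc.
pose Fj j := tens 1%:M (shiftmx m n j) : 'M[C]_(m * n, m * m).
(* The blocks split the norm orthogonally, [shiftmx m n j] being the j-th group of m columns of
   [iso n (k * m)]. *)
have -> : nsq (mxadj F *m x) = \sum_(j < k) nsq (mxadj (Fj j) *m x).
  rewrite /nsq sum_tidx exchange_big /= sum_tidx; apply: eq_bigr => j _.
  rewrite sum_tidx exchange_big /=; apply: eq_bigr => i _; apply: eq_bigr => i' _.
  congr nc; rewrite !mxE; apply: eq_bigr => a _; rewrite !mxadjE -(tidxK a) !tensE.
  by rewrite shift_iso.
rewrite /Sblock /qf mulmx_suml rtr_sum; apply: le_trans (ler_norm_sum _ _ _) _.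
apply: ler_sum => j _; rewrite -scalemxAl rtrZ -/(qf _ x) Phi_tens PT_tens.
have -> : cnj 1%:M = 1%:M :> 'M[C]_m by rewrite /cnj map_mx1.
rewrite -[X in qf (X *m _ *m _)]mxadjK -qf_mul -/(Fj j) qf_PT_dvec.
set z := mxadj _ *m x; clearbody z.
have hh : (Num.sqrt m%:R)^-1 * (Num.sqrt m%:R)^-1 = m%:R^-1 :> R.
  by rewrite -invfM -expr2 sqr_sqrtr ?ler0n.
rewrite (eq_bigr (fun i => m%:R^-1 * \sum_k0 complex.Re (Num.conj (z (tidx i k0) 0) * z (tidx k0 i) 0))); last first.
  by move=> i _; rewrite mulr_sumr; apply: eq_bigr => i' _; rewrite hh.
rewrite -mulr_sumr mulrA mulfV ?mul1r; last by rewrite pnatr_eq0 -lt0n.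
apply: le_trans (ler_norm_sum _ _ _) _.
apply: (@le_trans _ _ (\sum_i \sum_i' (nc (z (tidx i i') 0) + nc (z (tidx i' i) 0)) / 2)).
  apply: ler_sum => i _; apply: le_trans (ler_norm_sum _ _ _) _; apply: ler_sum => i' _.
  have := Re_cross (z (tidx i i') 0) (z (tidx i' i) 0).
  by rewrite normrM ger0_norm // ler_pdivlMr // mulrC.
rewrite /nsq sum_tidx.
rewrite (eq_bigr (fun i => (\sum_i' nc (z (tidx i i') 0)) / 2 + (\sum_i' nc (z (tidx i' i) 0)) / 2)); last first.
  by move=> i _; rewrite -mulr_suml big_split mulrDl.
rewrite big_split /= -!mulr_suml [X in _ + X / 2]exchange_big /=; lra.
Qed.

Lemma Sblock_effect : effect ((2^-1 : R)%:C%C *: (1%:M - Sblock)).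
Proof.
have hS : mxadj Sblock = Sblock.
  rewrite mxadj_sum; apply: eq_bigr => j _.
  by rewrite mxadjZ conj_real mxadj_ptrans mxadj_proj.
split.
  apply: psdZ; first by rewrite invr_ge0.
  apply/psdP; split=> [|x]; first by rewrite mxadjB mxadj1 hS.
  by rewrite qfB qf1 subr_ge0; have := Sblock_bound x; rewrite ler_norml => /andP[].
have -> : 1%:M - (2^-1 : R)%:C%C *: (1%:M - Sblock) = (2^-1 : R)%:C%C *: (1%:M + Sblock).
  move: Sblock => S0; apply/matrixP => a b; rewrite !mxE fmorphV rmorph_nat.
  by field.
apply: psdZ; first by rewrite invr_ge0.
apply/psdP; split=> [|x]; first by rewrite mxadjD mxadj1 hS.
rewrite qfD qf1; have := Sblock_bound x; rewrite ler_norml => /andP[h _]; lra.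
Qed.

Lemma rtr_half_S (W : 'M[C]_(m * n)) :
  rtr (W *m ((2^-1 : R)%:C%C *: (1%:M - Sblock))) = (rtr W - rtr (W *m Sblock)) / 2.
Proof. by rewrite -scalemxAr rtrZ mulmxBr mulmx1 rtrB mulrC. Qed.

End Phi.

(** tr (W' S) = m for the rotated W', whatever the weights, so the test operator (1 - S)/2 has the
    value (1 - m)/2 on it. *)
Lemma Phi_neg_backward m n (W : 'M[C]_(m * n)) s (U : 'M[C]_m) (V : 'M[C]_n) k (p : 'I_k -> R) :
  (2 <= m <= n)%N -> inD W -> spectrum W s -> unitary U -> unitary V -> (1 <= k <= n %/ m)%N ->
  \sum_(j < k) p j = 1 ->
  tensmx U V *m W *m mxadj (tensmx U V) = \sum_(j < k) ((p j)%:C)%C *: ptrans (proj (@Phi R m n j)) ->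
  (m%:R - 1) / 2 <= negativity s.
Proof.
move=> /andP[m2 mn] hD hs /unitaryP [U1 U2] /unitaryP [V1 V2] /andP[k1 kd] p1 hW.
have m0 := ltnW m2; have kmn : (k * m <= n)%N by rewrite -leq_divRL.
pose F := tens U V; have hF : mxadj F *m F = 1%:M by apply: tens_isometry.
have hT := Sblock_effect m0 kmn; set T0 := _ *: _ in hT.
have [hT' _] := effect_compress hF hT.
apply: le_trans (negativity_ge (inD_herm hD) hs (inD_rtr hD) hT').
have -> : rtr (W *m (mxadj F *m T0 *m F)) = rtr (tensmx U V *m W *m mxadj (tensmx U V) *m T0).
  by rewrite -[tensmx U V]/F [RHS]rtrC !mulmxA [RHS]rtrC !mulmxA [RHS]rtrC !mulmxA rtrC !mulmxA.
rewrite hW rtr_half_S.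
have -> : rtr (\sum_(j < k) ((p j)%:C)%C *: ptrans (proj (@Phi R m n j))) = 1.
  rewrite rtr_sum -p1; apply: eq_bigr => j _.
  by rewrite rtrZ rtr_ptrans rtr_proj nsq_Phi // mulr1.
have -> : rtr ((\sum_(j < k) ((p j)%:C)%C *: ptrans (proj (@Phi R m n j))) *m Sblock m n k) = m%:R.
  rewrite mulmx_suml rtr_sum (eq_bigr (fun j => p j * m%:R)); first by rewrite -mulr_suml p1 mul1r.
  move=> j _; rewrite -scalemxAl rtrZ /Sblock mulmx_sumr rtr_sum (bigD1 j) //= big1 ?addr0.
    by rewrite -scalemxAr rtrZ Phi_dot // eqxx mulr1.
  by move=> l lj; rewrite -scalemxAr rtrZ Phi_dot // eq_sym (negPf lj) mulr0.
lra.
Qed.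

End Attain.

(** * Bounds over the witnesses, and explicit families that fill the ranges *)

Section Families.
Variable R : realType.
Local Notation C := R[i].

Lemma is_inf_range (P : R -> Prop) a b : a < b -> (forall y, P y -> a <= y) ->
  (forall x, a < x < b -> P x) -> is_inf P a.
Proof.
move=> ab hl hP; split=> // e e0.
exists (a + Num.min (e / 2) ((b - a) / 2)).
have h1 : 0 < Num.min (e / 2) ((b - a) / 2) by rewrite lt_min !divr_gt0 // subr_gt0.
have h2 : Num.min (e / 2) ((b - a) / 2) <= e / 2 by rewrite ge_min lexx.
have h3 : Num.min (e / 2) ((b - a) / 2) <= (b - a) / 2 by rewrite ge_min lexx orbT.
move: (Num.min _ _) h1 h2 h3 => d h1 h2 h3.
by split; [apply: hP; apply/andP; split|]; lra.
Qed.

Lemma is_sup_range (P : R -> Prop) a b : a < b -> (forall y, P y -> y <= b) ->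
  (forall x, a < x < b -> P x) -> is_sup P b.
Proof.
move=> ab hl hP; split=> // e e0.
exists (b - Num.min (e / 2) ((b - a) / 2)).
have h1 : 0 < Num.min (e / 2) ((b - a) / 2) by rewrite lt_min !divr_gt0 // subr_gt0.
have h2 : Num.min (e / 2) ((b - a) / 2) <= e / 2 by rewrite ge_min lexx.
have h3 : Num.min (e / 2) ((b - a) / 2) <= (b - a) / 2 by rewrite ge_min lexx orbT.
move: (Num.min _ _) h1 h2 h3 => d h1 h2 h3.
by split; [apply: hP; apply/andP; split|]; lra.
Qed.

Lemma is_sup_max (P : R -> Prop) b : (forall y, P y -> y <= b) -> P b -> is_sup P b.
Proof. by move=> h1 h2; split=> // e e0; exists b; split=> //; lra. Qed.

Lemma is_inf_min (P : R -> Prop) b : (forall y, P y -> b <= y) -> P b -> is_inf P b.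
Proof. by move=> h1 h2; split=> // e e0; exists b; split=> //; lra. Qed.

Lemma lam_eigvec p (W : 'M[C]_p) s (i : 'I_p) : mxadj W = W -> spectrum W s ->
  exists x, nsq x = 1 /\ qf W x = s`_i.
Proof.
move=> hW hs; have [U hU] := spectrum_eig hW hs.
by exists (col i U); rewrite (nsq_col i (proj1 hU)) (qf_eig i hU).
Qed.

Lemma lamN_le p (W : 'M[C]_p) s x : mxadj W = W -> spectrum W s -> (0 < p)%N ->
  nsq x = 1 -> lam s p <= qf W x.
Proof.
move=> hW hs p0 hx; have [t [t01 ht]] := effect_spectrum hW hs (effect_proj hx).
rewrite -/(qf W x) => ->; rewrite rtr_proj hx in ht.
rewrite -[lam s p]mulr1 ht mulr_sumr; apply: ler_sum => i _.
apply: ler_wpM2r; first by case/andP: (t01 i).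
by apply: (spectrum_le hs); apply/andP; split; [rewrite -ltnS (prednK p0) | rewrite (prednK p0)].
Qed.

Lemma lam1_ge p (W : 'M[C]_p) s x : mxadj W = W -> spectrum W s -> (0 < p)%N ->
  nsq x = 1 -> qf W x <= lam s 1.
Proof.
move=> hW hs p0 hx; have := fan_spectrum (k := 1) hW hs (effect_proj hx).
by rewrite rtr_proj hx big_nat1 => /(_ erefl p0).
Qed.

Lemma neg_qf p (W T : 'M[C]_p) : psd T -> rtr (W *m T) < 0 -> exists x, qf W x < 0.
Proof.
move=> hT; have [d [U hU]] := herm_eig (psd_herm hT).
rewrite rtrC (rtr_eig _ hU) => h.
have [i hi] : exists i, qf W (col i U) < 0.
  apply/existsP; rewrite -[X in is_true X]negbK negb_exists; apply/negP => /forallP h1.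
  move: h; rewrite ltNge sumr_ge0 // => i _.
  by rewrite mulr_ge0 ?(eig_psd_ge0 i hU hT) // leNgt.
by exists (col i U).
Qed.

(** [E] is a graph on the Schmidt indices and [T] the sum over its edges of the projectors on (|ik>
    - |ki>)/sqrt 2. Each edge costs trace 1 and contributes -c_i c_k; double sums count it twice,
    hence the halves. *)
Lemma PT_pairs m n (psi : 'cV[C]_(m * n)) (c : seq R) (E : rel 'I_(size c)) :
  symmetric E -> irreflexive E -> schmidt_coeffs psi c ->
  exists T : 'M[C]_(m * n), [/\ effect T, rtr T = (\sum_(i < size c) \sum_(k < size c) (E i k)%:R) / 2 &
    rtr (ptrans (proj psi) *m T) = - (\sum_(i < size c) \sum_(k < size c) c`_i * c`_k * (E i k)%:R) / 2].
Proof.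
move=> hsym hirr /schmidt_tens [u [v [hu hv ->]]].
pose al i k : R := (E i k)%:R / 2; pose be i k : R := - (E i k)%:R / 2.
have hn i k : `|be i k| = al i k.
  by rewrite /be /al mulNr normrN ger0_norm // divr_ge0 // ler0n.
have [T [h1 h2 h3]] : exists T : 'M[C]_(m * n), [/\ effect T,
   rtr T = \sum_i \sum_k (al i k + (i == k)%:R * be i k) &
    forall a, rtr (ptrans (proj (tens u v *m dvec a)) *m T) =
      \sum_i \sum_k a i * a k * ((i == k)%:R * al i k + be i k)].
  apply: PT_attain => // i k; rewrite ?hn //; rewrite /al /be 1?hsym //.
  by case: (E k i) => /=; lra.
exists T; split=> //.
  rewrite h2 mulr_suml; apply: eq_bigr => i _; rewrite mulr_suml; apply: eq_bigr => k _.
  by have [->|_] := eqVneq i k; rewrite /al /be ?hirr /=; lra.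
rewrite h3 mulNr mulr_suml -sumrN; apply: eq_bigr => i _; rewrite mulr_suml -sumrN.
apply: eq_bigr => k _.
by have [->|_] := eqVneq i k; rewrite /al /be ?hirr /=; field.
Qed.

Lemma inD_pure m n (psi : 'cV[C]_(m * n)) (c : seq R) : (2 <= size c)%N ->
  unit_vec psi -> schmidt_coeffs psi c -> inD (ptrans (proj psi)).
Proof.
move=> c2 /unit_vecP hpsi hc.
have hc0 i : (i < size c)%N -> 0 < c`_i by move=> hi; apply: (all_nthP 0 (proj1 hc)).
pose i0 := Ordinal (ltnW c2); pose i1 := Ordinal c2.
pose E : rel 'I_(size c) := fun i k => ((i == i0) && (k == i1)) || ((i == i1) && (k == i0)).
have hsym : symmetric E by move=> i k; rewrite /E orbC ![(k == _) && _]andbC.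
have hirr : irreflexive E.
  move=> i; rewrite /E -!(inj_eq val_inj) /=; by case: (val i) => [|[|]].
have [T [h1 h2 h3]] := PT_pairs hsym hirr hc.
have [x hx] : exists x, qf (ptrans (proj psi)) x < 0.
  apply: (neg_qf (proj1 h1)); rewrite h3 mulNr oppr_lt0 divr_gt0 //.
  have hge (i k : 'I_(size c)) : 0 <= c`_i * c`_k * (E i k)%:R.
    by rewrite mulr_ge0 ?ler0n // mulr_ge0 // ltW // hc0.
  rewrite (bigD1 i0) //; apply: ltr_wpDr; first by apply: sumr_ge0 => i _; apply: sumr_ge0.
  rewrite (bigD1 i1) //; apply: ltr_wpDr; first by apply: sumr_ge0.
  by rewrite /E !eqxx mulr1; apply: mulr_gt0; apply: hc0; apply: ltn_ord.
apply: (inD_intro (P := 0) (Q := proj psi)) hx; rewrite ?add0r //.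
- exact: psd0.
- exact: psd_proj.
- by rewrite rtr_ptrans rtr_proj.
Qed.

Lemma rtr_projl p (M : 'M[C]_p) x : rtr (proj x *m M) = qf M x.
Proof. exact: rtrC. Qed.

Lemma nsq_delta p a : nsq (delta_mx a 0 : 'cV[C]_p) = 1.
Proof.
rewrite /nsq (bigD1 a) //= big1 ?addr0 => [|b ba]; rewrite !mxE.
  by rewrite !eqxx (nc_real (1 : R)) expr1n.
by rewrite (negPf ba) (nc_real (0 : R)) expr0n.
Qed.

Lemma qf_scalevec p (M : 'M[C]_p) (h : R) x : qf M ((h%:C)%C *: x) = h ^+ 2 * qf M x.
Proof.
rewrite !qfE mxadjZ conj_real -!scalemxAl -scalemxAr !mxE !ReZ; ring.
Qed.

(** [psi] is (|00> + |11>)/sqrt 2, whose partial transpose is half a swap on two qubits; [g] is the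
    singlet and [f] is |00>. Orthogonality of [g] and [f] lets each part of a mixture be evaluated
    separately. *)
Lemma base_witness m n : (2 <= m <= n)%N ->
  exists psi g f : 'cV[C]_(m * n), [/\ nsq psi = 1, nsq g = 1, nsq f = 1,
    qf (ptrans (proj psi)) g = - 2^-1 /\ qf (ptrans (proj psi)) f = 2^-1 &
    [/\ qf (proj g) f = 0, qf (proj f) g = 0 &
      forall T, effect T -> rtr (ptrans (proj psi) *m T) <= 2^-1 * rtr T]].
Proof.
move=> /andP[m2 mn]; pose h : R := Num.sqrt 2 / 2.
have hh : h ^+ 2 = 2^-1 by apply: half_sq.
have hu := @iso_isometry R m 2 m2; have hv := @iso_isometry R n 2 (leq_trans m2 mn).
pose u := iso R m 2; pose v := iso R n 2.
pose F := tens (cnj u) v.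
have hF : mxadj F *m F = 1%:M by apply: tens_isometry => //; apply: cnj_isometry.
pose a (i : 'I_2) := h.
pose x0 : 'I_2 := ord0; pose x1 : 'I_2 := lift ord0 ord0.
pose g0 : 'cV[C]_(2 * 2) := (h%:C)%C *: (delta_mx (tidx x0 x1) 0 + ((-1 : R)%:C)%C *: delta_mx (tidx x1 x0) 0).
(* The zero second term puts |00> into the form that [qf_delta2] evaluates. *)
pose f0 : 'cV[C]_(2 * 2) := delta_mx (tidx x0 x0) 0 + ((0 : R)%:C)%C *: delta_mx (tidx x0 x1) 0.
have ng0 : nsq g0 = 1.
  by rewrite nsqZ nc_real hh nsq_delta2 ?tidx_eq // sqrrN expr1n; field.
have nf0 : nsq f0 = 1 by rewrite nsq_delta2 ?tidx_eq // expr0n addr0.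
have hPT x : qf (ptrans (proj (tens u v *m dvec a))) (F *m x) = qf (ptrans (proj (dvec a))) x.
  by rewrite qf_mul PT_tens -/F !mulmxA hF mul1mx -mulmxA hF mulmx1.
have hherm : mxadj (ptrans (proj (dvec a))) = ptrans (proj (dvec a)).
  by rewrite mxadj_ptrans mxadj_proj.
have hdot (x y : 'cV[C]_(2 * 2)) : qf (proj (F *m x)) (F *m y) = nc ((mxadj x *m y) 0 0).
  by rewrite qf_proj mxadjM -mulmxA [mxadj F *m _]mulmxA hF mul1mx.
have hgf : (mxadj g0 *m f0) 0 0 = 0.
  have -> : f0 = delta_mx (tidx x0 x0) 0 by rewrite /f0 rmorph0 scale0r addr0.
  rewrite -colE mxE mxadjE /g0 !mxE !tidx_eq /=; rewrite mulr0 addr0 mulr0 rmorph0 //.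
exists (tens u v *m dvec a), (F *m g0), (F *m f0); split.
- by rewrite nsq_tens_dvec // !big_ord_recl big_ord0 /a hh; field.
- by rewrite nsq_isometry.
- by rewrite nsq_isometry.
- rewrite !hPT qf_scalevec !qf_delta2 // hh !PT_dvec /a -!expr2 hh.
  by rewrite /= ?(mulr0, mulr1, mul0r, mul1r, subr0, addr0, oppr0); split; field.
split.
- by rewrite hdot hgf (nc_real (0 : R)) expr0n.
- by rewrite hdot -[g0]mxadjK -mxadjM mxadjE hgf rmorph0 (nc_real (0 : R)) expr0n.
- move=> T hT; apply: PT_upper => // [|i k]; first by rewrite invr_ge0.
  by rewrite /a -expr2 hh ger0_norm ?invr_ge0.
Qed.

Section Dim.
Variables (m n : nat).
Hypothesis hmn : (2 <= m <= n)%N.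
Local Notation N := (m * n)%N.

Lemma dim_ge4 : (4 <= N)%N.
Proof. by case/andP: hmn => h1 h2; apply: (leq_mul h1 (leq_trans h1 h2)). Qed.

Lemma dim_gt0 : (0 < N)%N. Proof. exact: leq_trans dim_ge4. Qed.

Lemma N1_ge3 : 3 <= N%:R - 1 :> R.
Proof. by have : 4 <= N%:R :> R; [rewrite (ler_nat R 4) dim_ge4 | lra]. Qed.

Lemma inv_N1 : 0 < ((N%:R - 1)^-1 : R) <= 3^-1.
Proof.
have h := N1_ge3; have h0 : 0 < N%:R - 1 :> R by lra.
by rewrite invr_gt0 h0 /= lef_pV2 ?posrE.
Qed.

Lemma D_spectrum (W : 'M[C]_N) : inD W -> exists s, spectrum W s.
Proof. by move=> hD; apply: spectrum_exists; apply: inD_herm. Qed.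

Lemma D_lamN_lt0 (W : 'M[C]_N) s : inD W -> spectrum W s -> lam s N < 0.
Proof.
move=> hD; have [P [Q [_ _ _ _ [_ [_ hl]]]]] := inD_dec hD.
have := dim_gt0; move: W hD hl => W _; rewrite /lam; move: W.
by case: N => // p W hl _ hs; apply: (spectrum_neg hs hl).
Qed.

Lemma sum_split_last (s : seq R) (f : R -> R) :
  \sum_(i < N) f s`_i = \sum_(i < N.-1) f s`_i + f (lam s N).
Proof.
by rewrite /lam; have := dim_gt0; case: N => // p _; rewrite big_ord_recr.
Qed.

Lemma D_lamN_ge (P Q : 'M[C]_N) s : psd P -> psd Q -> spectrum (P + ptrans Q) s ->
  - (2^-1 * rtr Q) <= lam s N.
Proof.
move=> hP hQ hs; have hW : mxadj (P + ptrans Q) = P + ptrans Q.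
  by rewrite mxadjD mxadj_ptrans (psd_herm hP) (psd_herm hQ).
have hN : (N.-1 < N)%N by rewrite ltn_predL dim_gt0.
have [x [hx hq]] := lam_eigvec (Ordinal hN) hW hs.
rewrite /lam -hq; apply: D_lower (effect_proj hx) _ => // psi.
by apply: PT_lower1; [case/andP: hmn | apply: effect_proj | rewrite rtr_proj hx].
Qed.

Lemma inD_lamN_ge (W : 'M[C]_N) s : inD W -> spectrum W s -> - 2^-1 <= lam s N.
Proof.
move=> hD hs; have [P [Q [hP hQ hW htr _]]] := inD_dec hD.
rewrite hW in hs; apply: le_trans (D_lamN_ge hP hQ hs).
have := psd_trace_ge0 hP; lra.
Qed.

(** With l < 0 the last eigenvalue, the other N - 1 sum to 1 - l > 1; Cauchy-Schwarz bounds their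
    squares below by (1 - l)^2 / (N - 1). *)
Lemma trsq_gt (W : 'M[C]_N) : inD W -> (N%:R - 1)^-1 < trsq W.
Proof.
move=> hD; have [s hs] := D_spectrum hD; have hW := inD_herm hD.
have l0 := D_lamN_lt0 hD hs; set l := lam s N in l0.
have h1 : \sum_(i < N.-1) s`_i = 1 - l.
  by have := spectrum_sum hW hs; rewrite (sum_split_last s id) /= -/l (inD_rtr hD); lra.
have h2 : \sum_(i < N.-1) s`_i ^+ 2 = trsq W - l ^+ 2.
  have := spectrum_sqr hW hs; rewrite (sum_split_last s (fun x => x ^+ 2)) /= -/l; lra.
have h3 := sum_sqr_diff (fun i : 'I_N.-1 => s`_i).
have h4 : 0 <= \sum_(i < N.-1) \sum_(k < N.-1) (s`_i - s`_k) ^+ 2.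
  by apply: sumr_ge0 => i _; apply: sumr_ge0 => k _; apply: sqr_ge0.
have h5 : \sum_(i < N.-1) \sum_(k < N.-1) s`_i * s`_k = (1 - l) ^+ 2.
  rewrite -h1 expr2 mulr_suml; apply: eq_bigr => i _; by rewrite mulr_sumr.
have hN : N.-1%:R = N%:R - 1 :> R by rewrite -subn1 natrB // dim_gt0.
rewrite h3 h2 h5 hN in h4; have h6 := N1_ge3.
have h0 : 0 < N%:R - 1 :> R by lra.
rewrite -(ltr_pM2l h0) mulfV ?gt_eqF //.
have e1 : (N%:R - 1) * trsq W = (N%:R - 1) * (trsq W - l ^+ 2) + (N%:R - 1) * l ^+ 2 by ring.
have e2 : 0 <= (N%:R - 1) * l ^+ 2 by rewrite mulr_ge0 ?sqr_ge0 // ltW.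
have e3 : (1 - l) ^+ 2 = 1 - 2 * l + l ^+ 2 by ring.
have e4 : 2 * (N%:R - 1) * (trsq W - l ^+ 2) = 2 * ((N%:R - 1) * (trsq W - l ^+ 2)) by ring.
have e5 := sqr_ge0 l; rewrite e4 in h4; rewrite e1; lra.
Qed.

(** Below, the average of the first N - 1 eigenvalues exceeds 1 / (N - 1). Above, lambda_1^2 +
    lambda_N^2 <= tr (W^2) <= 1 with lambda_N nonzero. *)
Lemma lam1_bounds (W : 'M[C]_N) s : inD W -> spectrum W s -> (N%:R - 1)^-1 < lam s 1 < 1.
Proof.
move=> hD hs; have hW := inD_herm hD.
have l0 := D_lamN_lt0 hD hs; set l := lam s N in l0.
have h0 : 0 < N%:R - 1 :> R by have := N1_ge3; lra.
apply/andP; split.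
  have h1 : \sum_(i < N.-1) s`_i = 1 - l.
    by have := spectrum_sum hW hs; rewrite (sum_split_last s id) /= -/l (inD_rtr hD); lra.
  have h2 : \sum_(i < N.-1) s`_i <= (N%:R - 1) * lam s 1.
    have hN : N.-1%:R = N%:R - 1 :> R by rewrite -subn1 natrB // dim_gt0.
    rewrite -hN -[N.-1 in leRHS]card_ord -sum1_card natr_sum mulr_suml; apply: ler_sum => i _.
    rewrite mul1r; apply: (spectrum_le hs); apply: leq_trans (ltn_ord i) (leq_pred _).
  by rewrite -(ltr_pM2l h0) mulfV ?gt_eqF //; lra.
have := spectrum_sqr hW hs; have [h3 _] := trsq_le1 hD.
rewrite (sum_split_last s (fun x => x ^+ 2)) /= -/l => h4.
have h5 : lam s 1 ^+ 2 <= \sum_(i < N.-1) s`_i ^+ 2.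
  have hN : (0 < N.-1)%N by rewrite -ltnS prednK ?dim_gt0 // (leq_trans _ dim_ge4).
  by rewrite (bigD1 (Ordinal hN)) //= lerDl sumr_ge0 // => i _; apply: sqr_ge0.
have h8 : 0 < l ^+ 2 by rewrite expr2 nmulr_rgt0.
have h6 : lam s 1 ^+ 2 < 1 by lra.
by move: h6; rewrite ltNge => /negP h6; rewrite ltNge; apply/negP => h7; apply: h6; rewrite expr_ge1 // (le_trans ler01).
Qed.

Lemma negativity_le (P Q : 'M[C]_N) s : psd P -> psd Q -> rtr (P + ptrans Q) = 1 ->
  spectrum (P + ptrans Q) s -> negativity s <= (m%:R - 1) / 2 * rtr Q.
Proof.
move=> hP hQ ht hs; have hW : mxadj (P + ptrans Q) = P + ptrans Q.
  by rewrite mxadjD mxadj_ptrans (psd_herm hP) (psd_herm hQ).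
have [T [hT hTW]] := neg_effect hW hs ht.
rewrite -lerN2 -hTW; apply: D_lower => // psi.
by apply: PT_lowerN => //; case/andP: hmn.
Qed.

Lemma negativity_bounds (W : 'M[C]_N) s : inD W -> spectrum W s ->
  0 < negativity s <= (m%:R - 1) / 2.
Proof.
move=> hD hs; have hW := inD_herm hD; apply/andP; split.
  rewrite (negativityE hW hs (inD_rtr hD)) oppr_gt0 (sum_split_last s (fun x => Num.min x 0)) /=.
  have h : \sum_(i < N.-1) Num.min s`_i 0 <= 0 by apply: sumr_le0 => i _; rewrite ge_min lexx orbT.
  have h2 : Num.min (lam s N) 0 < 0 by rewrite gt_min (D_lamN_lt0 hD hs).
  lra.
have [P [Q [hP hQ hE htr _]]] := inD_dec hD.
have h1 := inD_rtr hD; rewrite hE in hs h1; apply: le_trans (negativity_le hP hQ h1 hs) _.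
have h2 := psd_trace_ge0 hP; rewrite -[leRHS]mulr1 ler_wpM2l //; last by lra.
by rewrite divr_ge0 // subr_ge0 ler1n (leq_trans _ (proj1 (andP hmn))).
Qed.

(* [(1 - t)/(N - 1) (1 - |g><g|) + t |psi><psi|^Gamma], where [g] is the negative
   eigenvector of the two-qubit maximally entangled [psi]. *)
Lemma family1 (t : R) : 0 < t <= 1 -> exists W : 'M[C]_N, exists s,
  [/\ inD W, spectrum W s, lam s N = - (t / 2),
     lam s 1 = (1 - t) * (N%:R - 1)^-1 + t / 2 &
     trsq W = (1 - t) ^+ 2 * (N%:R - 1)^-1 + 3 * t * (1 - t) * (N%:R - 1)^-1 + t ^+ 2].
Proof.
move=> /andP[t0 t1]; have [psi [g [f [npsi ng nf [hg hf] [hgf _ hU]]]]] := base_witness hmn.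
have /andP[c0 c1] := inv_N1; have hN := N1_ge3; set c := (N%:R - 1)^-1 in c0 c1 *.
have cN : c * (N%:R - 1) = 1 by rewrite mulVf // gt_eqF //; lra.
pose A := 1%:M - proj g.
have hA : psd A by case: (effect_proj ng).
pose P := (((1 - t) * c)%:C)%C *: A; pose Q := (t%:C)%C *: proj psi.
have hP : psd P by apply: psdZ => //; rewrite mulr_ge0 // ?subr_ge0 // ltW.
have hQ : psd Q by apply: psdZ (psd_proj _); apply: ltW.
pose W := P + ptrans Q.
have WT T : rtr (W *m T) = (1 - t) * c * rtr (A *m T) + t * rtr (ptrans (proj psi) *m T).
  by rewrite /W mulmxDl rtrD /P -scalemxAl rtrZ /Q ptransZ -scalemxAl rtrZ.
have hAq x : qf A x = nsq x - qf (proj g) x by rewrite /A qfB qf1.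
have hWq x : qf W x = (1 - t) * c * qf A x + t * qf (ptrans (proj psi)) x.
  by rewrite /qf WT.
have hgg : qf (proj g) g = 1 by rewrite qf_proj nsqE0 ng (nc_real (1 : R)) expr1n.
have hAg : qf A g = 0 by rewrite hAq ng hgg subrr.
have hAf : qf A f = 1 by rewrite hAq nf hgf subr0.
have trA : rtr A = N%:R - 1 by rewrite /A rtrB rtr1 rtr_proj ng.
have hWg : qf W g = - (t / 2) by rewrite hWq hAg hg mulr0 add0r; field.
have hWf : qf W f = (1 - t) * c + t / 2 by rewrite hWq hAf hf mulr1.
have trW : rtr W = 1.
  rewrite -[W]mulmx1 WT !mulmx1 trA rtr_ptrans rtr_proj npsi mulr1 -mulrA cN; ring.
have hD : inD W.
  by apply: (inD_intro (x := g) hP hQ) => //; rewrite hWg oppr_lt0 divr_gt0.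
have hW := inD_herm hD; have [s hs] := D_spectrum hD.
exists W, s; split=> //.
(* [g] is killed by [A] and gives -t/2; the bound with [rtr Q = t] shows that no eigenvalue lies
   below. *)
- apply/eqP; rewrite eq_le; apply/andP; split.
    by rewrite -hWg; apply: lamN_le => //; apply: dim_gt0.
  have := D_lamN_ge hP hQ hs; rewrite /Q rtrZ rtr_proj npsi mulr1 mulrC //.
- apply/eqP; rewrite eq_le; apply/andP; split; last first.
    by rewrite -hWf; apply: lam1_ge => //; apply: dim_gt0.
  have [x [nx hx]] := lam_eigvec (Ordinal dim_gt0) hW hs.
  have -> : lam s 1 = qf W x by rewrite hx.
  rewrite hWq; apply: lerD.
    rewrite -[leRHS]mulr1 ler_wpM2l //; first by rewrite mulr_ge0 // ?subr_ge0 // ltW.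
    by rewrite hAq nx qf_proj gerBl nc_ge0.
  have := hU _ (effect_proj nx); rewrite rtr_proj nx mulr1 -/(qf _ x) => h.
  by rewrite ler_wpM2l // ltW.
rewrite /trsq -/(rtr _) WT [rtr (A *m W)]rtrC [rtr (_ *m W)]rtrC !WT.
have gg : proj g *m proj g = proj g.
  by rewrite /proj mulmxA -[_ *m mxadj g *m g]mulmxA nsqE ng mulmx1.
have hAA : rtr (A *m A) = N%:R - 1.
  by rewrite {1}/A mulmxBl mul1mx /A mulmxBr mulmx1 gg subrr subr0 -/A.
have hAB : rtr (A *m ptrans (proj psi)) = 1 + 2^-1.
  by rewrite /A mulmxBl mul1mx rtrB rtr_ptrans rtr_proj npsi rtr_projl hg opprK.
have hBB : rtr (ptrans (proj psi) *m ptrans (proj psi)) = 1.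
  by rewrite rtr_ptrans_mul ptransK -/(qf _ _) qf_proj nsqE0 npsi (nc_real (1 : R)) expr1n.
rewrite hAA [rtr (ptrans _ *m A)]rtrC hAB hBB.
have -> : (1 - t) * c * ((1 - t) * c * (N%:R - 1) + t * (1 + 2^-1)) +
  t * ((1 - t) * c * (1 + 2^-1) + t * 1) =
  (1 - t) ^+ 2 * c * (c * (N%:R - 1)) + 3 * t * (1 - t) * c + t ^+ 2 by field.
by rewrite cN mulr1.
Qed.

(** Mixing with the projector on [f], where the partial transpose has its top value 1/2, makes
    lambda_1 fill [1/2, 1); in [family1] it stops at 1/2. *)
Lemma family2 (t : R) : 0 < t <= 1 -> exists W : 'M[C]_N, exists s,
  [/\ inD W, spectrum W s & lam s 1 = 1 - t / 2].
Proof.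
move=> /andP[t0 t1]; have [psi [g [f [npsi ng nf [hg hf] [_ hfg hU]]]]] := base_witness hmn.
pose P := ((1 - t)%:C)%C *: proj f; pose Q := (t%:C)%C *: proj psi.
have hP : psd P by apply: psdZ (psd_proj _); rewrite subr_ge0.
have hQ : psd Q by apply: psdZ (psd_proj _); apply: ltW.
pose W := P + ptrans Q.
have hWq x : qf W x = (1 - t) * qf (proj f) x + t * qf (ptrans (proj psi)) x.
  by rewrite /W qfD /P qfZ /Q ptransZ qfZ.
have hff : qf (proj f) f = 1 by rewrite qf_proj nsqE0 nf (nc_real (1 : R)) expr1n.
have hWg : qf W g = - (t / 2) by rewrite hWq hfg hg mulr0 add0r; field.
have hWf : qf W f = 1 - t / 2 by rewrite hWq hff hf mulr1; field.
have trW : rtr W = 1.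
  by rewrite /W rtrD /P rtrZ rtr_proj nf /Q ptransZ rtrZ rtr_ptrans rtr_proj npsi; ring.
have hD : inD W.
  by apply: (inD_intro (x := g) hP hQ) => //; rewrite hWg oppr_lt0 divr_gt0.
have hW := inD_herm hD; have [s hs] := D_spectrum hD.
exists W, s; split=> //.
apply/eqP; rewrite eq_le; apply/andP; split; last first.
  by rewrite -hWf; apply: lam1_ge => //; apply: dim_gt0.
have [x [nx hx]] := lam_eigvec (Ordinal dim_gt0) hW hs.
  have -> : lam s 1 = qf W x by rewrite hx.
have -> : 1 - t / 2 = (1 - t) * 1 + t * (2^-1 * 1) by field.
rewrite hWq; apply: lerD.
  rewrite ler_wpM2l ?subr_ge0 // -nx.
  by have /andP[] := effectP x (effect_proj nf).
have h := hU _ (effect_proj nx); rewrite rtr_proj nx -/(qf _ x) in h.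
by apply: ler_wpM2l => //; apply: ltW.
Qed.

(* [t |Phi_1><Phi_1|^Gamma + (1 - t) |00><00|] *)
Lemma family3 (x : R) : 0 < x <= (m%:R - 1) / 2 -> exists W : 'M[C]_N, exists s,
  [/\ inD W, spectrum W s & negativity s = x].
Proof.
move=> /andP[x0 x1]; have /andP[m2 mn] := hmn; have m0 := ltnW m2.
have mR : 0 < (m%:R - 1) / 2 :> R by rewrite divr_gt0 // subr_gt0 ltr1n.
pose t := x / ((m%:R - 1) / 2).
have t0 : 0 < t by rewrite divr_gt0.
have t1 : t <= 1 by rewrite ler_pdivrMr // mul1r.
have tx : t * ((m%:R - 1) / 2) = x by rewrite /t mulfVK // gt_eqF.
have kmn : (1 * m <= n)%N by rewrite mul1n.
pose Phi0 := Phi R m n (ord0 : 'I_1).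
have nPhi : nsq Phi0 = 1 by apply: (nsq_Phi R m0 kmn).
pose e := kron (delta_mx (Ordinal m0) 0) (delta_mx (Ordinal (leq_trans m0 mn)) 0) : 'cV[C]_N.
have e_mx : e = delta_mx (tidx (Ordinal m0) (Ordinal (leq_trans m0 mn))) 0.
  apply/matrixP => a b; rewrite -(tidxK a) ord1 !mxE !idx1_tidx !idx2_tidx !andbT tidx_eq.
  by rewrite -natrM mulnb.
have ne : nsq e = 1 by rewrite e_mx nsq_delta.
have heP : ptrans (proj e) = proj e.
  by rewrite kron_ptrans; congr (proj (kron _ _)); apply/matrixP => i j; rewrite !mxE rmorph_nat.
have hPe : qf (ptrans (proj Phi0)) e = m%:R^-1.
  rewrite /qf rtr_ptrans_mul heP rtrC -/(qf _ _) /qf rtrC -/(qf (proj Phi0) e) qf_proj e_mx -colE mxE mxadjE nc_conj.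
  by rewrite mxE ifT ?idx1_tidx ?idx2_tidx // nc_real exprVn sqr_sqrtr ?ler0n.
pose P := ((1 - t)%:C)%C *: proj e; pose Q := (t%:C)%C *: proj Phi0.
have hP : psd P by apply: psdZ (psd_proj _); rewrite subr_ge0.
have hQ : psd Q by apply: psdZ (psd_proj _); apply: ltW.
pose W := P + ptrans Q.
have trW : rtr W = 1.
  by rewrite /W rtrD /P rtrZ rtr_proj ne /Q ptransZ rtrZ rtr_ptrans rtr_proj nPhi; ring.
have hT := Sblock_effect R m0 kmn; set T := _ *: _ in hT.
(* |00> is fixed by the swap, so (1 - S)/2 does not see the product part, and only -t (m - 1)/2
   remains. *)
have hS : rtr (W *m Sblock R m n 1) = t * m%:R + (1 - t).
  rewrite /Sblock big_ord1 -scalemxAr rtrZ /W mulmxDl rtrD /P -scalemxAl rtrZ.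
  rewrite [rtr (proj e *m _)]rtrC -/(qf _ e) hPe /Q ptransZ -scalemxAl rtrZ.
  rewrite (Phi_dot R m0 kmn ord0 ord0) eqxx mulr1; field.
  by rewrite pnatr_eq0 -lt0n.
have hWT : rtr (W *m T) = - x.
  by rewrite rtr_half_S hS trW -tx; field.
have [y hy] : exists y, qf W y < 0 by apply: (neg_qf (proj1 hT)); rewrite hWT oppr_lt0.
have hD : inD W by apply: (inD_intro hP hQ) hy.
have hW := inD_herm hD; have [s hs] := D_spectrum hD.
exists W, s; split=> //; apply/eqP; rewrite eq_le; apply/andP; split.
  have := negativity_le hP hQ trW hs; rewrite /Q rtrZ rtr_proj nPhi mulr1.
  by rewrite mulrC tx.
by have := negativity_ge hW hs trW hT; rewrite hWT opprK.
Qed.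

End Dim.
End Families.

(** * Sums of the smallest eigenvalues *)

Section PartialSums.
Variable R : realType.
Local Notation C := R[i].

Lemma top_bottom p (W : 'M[C]_p) s k : mxadj W = W -> spectrum W s -> (k <= p)%N ->
  \sum_(k <= i < p) s`_i = rtr W - \sum_(0 <= i < k) s`_i.
Proof.
move=> hW hs kp; rewrite -(spectrum_sum hW hs) -(big_mkord xpredT (fun i => s`_i)).
apply/eqP; rewrite eq_sym subr_eq [X in _ == X]addrC; apply/eqP; exact: big_cat_nat.
Qed.

Lemma sum_last1 p (s : seq R) : (0 < p)%N -> \sum_(p - 1 <= i < p) s`_i = s`_p.-1.
Proof. by case: p => // p _; rewrite subSS subn0 big_nat1. Qed.

Lemma sum_last2 p (s : seq R) : (1 < p)%N -> \sum_(p - 2 <= i < p) s`_i = s`_p.-2 + s`_p.-1.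
Proof.
case: p => [|[|p]] // _; rewrite !subSS subn0 big_nat_recr /=; last exact: leqnSn.
by rewrite big_nat1.
Qed.

Lemma sum_last3 p (s : seq R) : (2 < p)%N ->
  \sum_(p - 3 <= i < p) s`_i = s`_p.-1.-2 + s`_p.-2 + s`_p.-1.
Proof.
case: p => [|[|[|p]]] // _; rewrite !subSS subn0 big_nat_recr /=.
  by rewrite big_nat_recr /=; [rewrite big_nat1 | exact: leqnSn].
by apply: leqW; exact: leqnSn.
Qed.

(** Ky Fan's inequality for the complement [1 - T], of trace p - k. *)
Lemma fan_bottom p (W T : 'M[C]_p) s k : mxadj W = W -> spectrum W s -> effect T ->
  rtr T = k%:R -> (k < p)%N -> \sum_(p - k <= i < p) s`_i <= rtr (W *m T).
Proof.
move=> hW hs hT hk kp.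
have h1 : rtr (1%:M - T) = (p - k)%:R by rewrite rtrB rtr1 hk natrB // ltnW.
have := fan_spectrum hW hs (effectC hT) h1; rewrite subn_gt0 kp leq_subr => /(_ isT).
by rewrite mulmxBr mulmx1 rtrB (top_bottom hW hs) ?leq_subr //; lra.
Qed.

Lemma sqrt2_inv : (2 + 2 * Num.sqrt 2)^-1 = (Num.sqrt 2 - 1) / 2 :> R.
Proof.
have [q [-> q0 q2]] := @sqrt2_spec R.
have hq : 2 + 2 * q != 0 by apply: lt0r_neq0; lra.
apply: (mulfI hq); rewrite mulfV //.
by transitivity (q ^+ 2 - 1); [rewrite q2; ring | field].
Qed.

Lemma invsqrt_sq k : (0 < k)%N -> ((Num.sqrt k%:R)^-1 : R) ^+ 2 = k%:R^-1.
Proof. by move=> k0; rewrite exprVn sqr_sqrtr ?ler0n. Qed.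

Lemma ket_kron m n s (i : 'I_s) : (s <= m)%N -> (s <= n)%N ->
  @ket R m n i i = kron (col i (iso R m s)) (col i (iso R n s)).
Proof. by move=> sm sn; apply/matrixP => a b; rewrite !mxE -natrM mulnb. Qed.

Section Dim2.
Variable n : nat.
Hypothesis hn : (2 <= 2 <= n)%N.
Local Notation N := (2 * n)%N.

(** The test operator of the tail has trace N - 2, its complement trace 2; [PT_upper2] applies to
    the complement. *)
Lemma bottom_sum_ge (W : 'M[C]_N) s : inD W -> spectrum W s ->
  - (2 + 2 * Num.sqrt 2)^-1 <= \sum_(2 <= i < N) s`_i.
Proof.
move=> hD hs; have hW := inD_herm hD; have N2 : (2 <= N)%N := ltnW (ltnW (dim_ge4 hn)).
have [T [hT hT1 <-]] := bottom_effect hW hs N2.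
have q0 : 0 <= Num.sqrt 2 :> R by apply: sqrtr_ge0.
apply: inD_lower => // [|psi]; first by rewrite invr_ge0 addr_ge0 // mulr_ge0.
have hT2 : rtr (1%:M - T) <= 2 by rewrite rtrB rtr1 hT1 natrB //; lra.
have := PT_upper2 (proj2 (andP hn)) psi erefl (effectC hT) hT2.
rewrite mulmxBr mulmx1 rtrB rtr_ptrans rtr_proj; move: (_^-1) => a; lra.
Qed.

(** The negativity bound (m - 1)/2 is 1/2 for m = 2 and holds for test operators of any trace, hence
    for every tail. *)
Lemma bottom_sum_ge_half (W : 'M[C]_N) s k : inD W -> spectrum W s -> (k <= N)%N ->
  - 2^-1 <= \sum_(k <= i < N) s`_i.
Proof.
move=> hD hs kN; have [T [hT _ <-]] := bottom_effect (inD_herm hD) hs kN.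
apply: inD_lower => // [|psi]; first by rewrite invr_ge0.
have := PT_lowerN (proj2 (andP hn)) psi hT.
by have -> : (2%:R - 1) / 2 = 2^-1 :> R by field.
Qed.

Lemma angle_exists : exists x1 x2 : R, 0 < x1 /\ 0 < x2 /\ x1 ^+ 2 + x2 ^+ 2 = 1 /\
  x1 ^+ 2 + x1 * x2 = 1 + (2 + 2 * Num.sqrt 2)^-1.
Proof.
rewrite sqrt2_inv; have [q [-> q0 q2]] := @sqrt2_spec R.
have q3 : q < 2 by rewrite -(ltr_pXn2r (n := 2)) ?nnegrE // q2 -natrX ltr_nat.
(* These are cos (pi/8) and sin (pi/8). *)
exists (Num.sqrt ((2 + q) / 4)), (Num.sqrt ((2 - q) / 4)).
have h1 : 0 < (2 + q) / 4 by rewrite divr_gt0 //; lra.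
have h2 : 0 < (2 - q) / 4 by rewrite divr_gt0 //; lra.
rewrite !sqrtr_gt0 !sqr_sqrtr ?ltW //; do 2 split=> //; split; first by field.
rewrite -sqrtrM ?ltW //.
have -> : (2 + q) / 4 * ((2 - q) / 4) = (q / 4) ^+ 2.
  transitivity ((4 - q ^+ 2) / 16); first by field.
  by rewrite expr_div_n q2; field.
by rewrite sqrtr_sqr ger0_norm ?divr_ge0 //; field.
Qed.

Lemma lamN_le_effect p (W T : 'M[C]_p) s : mxadj W = W -> spectrum W s -> (1 < p)%N ->
  effect T -> rtr T = 1 -> s`_p.-1 <= rtr (W *m T).
Proof.
move=> hW hs p1 hT hT1; have := fan_bottom (k := 1) hW hs hT hT1 p1.
by rewrite sum_last1 // ltnW.
Qed.

Lemma top_sums_pure (psi : 'cV[C]_N) (x1 x2 : R) s : unit_vec psi ->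
  schmidt_coeffs psi [:: x1; x2] -> spectrum (ptrans (proj psi)) s ->
  x1 ^+ 2 + x1 * x2 <= \sum_(0 <= i < 2) s`_i /\
  x1 ^+ 2 + x2 ^+ 2 + x1 * x2 <= \sum_(0 <= i < 3) s`_i.
Proof.
move=> hpsi hc hs; have N4 := dim_ge4 hn.
have hD : inD (ptrans (proj psi)) := inD_pure (isT : (2 <= size [:: x1; x2])%N) hpsi hc.
have hW := inD_herm hD.
have [u [v [hu hv hE]]] := schmidt_tens hc.
pose be (i k : 'I_2) : R := if i == k then 0 else 2^-1.
have hb i k : be i k = be k i by rewrite /be eq_sym.
split.
  (* |00><00| plus the projector on the symmetric vector (|01> + |10>)/sqrt 2. *)
  pose al (i k : 'I_2) : R := if i == k then (i == ord0)%:R else 2^-1.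
  have ha i k : al i k = al k i by rewrite /al eq_sym; case: eqP => [->|].
  have [||T [hT h1 h2]] := PT_attain hu hv ha hb.
  - move=> i k; rewrite /al /be; case: eqP => _; first by rewrite normr0 ler0n.
    by rewrite ger0_norm ?invr_ge0.
  - move=> i k; rewrite /al /be; case: eqP => _.
      by rewrite normr0 addr0 lern1 leq_b1.
    by rewrite ger0_norm ?invr_ge0 //; lra.
  have := fan_spectrum (k := 2) hW hs hT.
  rewrite hE h2 h1 !big_ord_recl !big_ord0 /al /be /= => h.
  apply: le_trans (h _ _); rewrite ?(leq_trans _ N4) //; lra.
(* The same with |11><11| added, which makes the trace 3. *)
pose al (i k : 'I_2) : R := if i == k then 1 else 2^-1.
have ha i k : al i k = al k i by rewrite /al eq_sym.
have [||T [hT h1 h2]] := PT_attain hu hv ha hb.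
- move=> i k; rewrite /al /be; case: eqP => _; first by rewrite normr0.
  by rewrite ger0_norm ?invr_ge0.
- move=> i k; rewrite /al /be; case: eqP => _.
    by rewrite normr0 addr0.
  by rewrite ger0_norm ?invr_ge0 //; lra.
have := fan_spectrum (k := 3) hW hs hT.
rewrite hE h2 h1 !big_ord_recl !big_ord0 /al /be /= => h.
apply: le_trans (h _ _); rewrite ?(leq_trans _ N4) //; lra.
Qed.

Lemma angle_attains (x1 x2 : R) : 0 < x1 -> 0 < x2 -> x1 ^+ 2 + x2 ^+ 2 = 1 ->
  x1 ^+ 2 + x1 * x2 = 1 + (2 + 2 * Num.sqrt 2)^-1 ->
  let W := ptrans (proj ((x1%:C)%C *: @ket R 2 n 0 0 + (x2%:C)%C *: @ket R 2 n 1 1)) in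
  inD W /\ exists s, spectrum W s /\ \sum_(2 <= i < N) s`_i = - (2 + 2 * Num.sqrt 2)^-1.
Proof.
move=> p1 p2 h1 h2 W; pose c := [:: x1; x2].
have n2 := proj2 (andP hn).
have hu := @iso_isometry R 2 2 (leqnn 2); have hv := @iso_isometry R n 2 n2.
have hpsi : (x1%:C)%C *: @ket R 2 n 0 0 + (x2%:C)%C *: @ket R 2 n 1 1 =
    \sum_(k < size c) (c`_k)%:C%C *: kron (col k (iso R 2 (size c))) (col k (iso R n (size c))).
  rewrite /c /= !big_ord_recl big_ord0 addr0; congr (_ *: _ + _ *: _).
    exact: (@ket_kron 2 n 2 ord0).
  exact: (@ket_kron 2 n 2 (lift ord0 ord0)).
have hc : schmidt_coeffs ((x1%:C)%C *: @ket R 2 n 0 0 + (x2%:C)%C *: @ket R 2 n 1 1) c.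
  by split; [rewrite /= p1 p2 | exists (iso R 2 (size c)), (iso R n (size c))].
have hun : unit_vec ((x1%:C)%C *: @ket R 2 n 0 0 + (x2%:C)%C *: @ket R 2 n 1 1).
  apply/unit_vecP; rewrite hpsi -(tens_dvec _ _ (fun k : 'I_(size c) => c`_k)) nsq_tens_dvec //.
  by rewrite /c /= !big_ord_recl big_ord0 addr0.
have hD : inD W := inD_pure (isT : (2 <= size c)%N) hun hc.
split=> //; have [s hs] := D_spectrum hD; exists s; split=> //.
apply/eqP; rewrite eq_le (bottom_sum_ge hD hs) andbT.
rewrite (top_bottom (inD_herm hD) hs) ?(leq_trans _ (dim_ge4 hn)) // (inD_rtr hD).
have [h3 _] := top_sums_pure hun hc hs; lra.
Qed.

Lemma bottom_sum_attains (psi : 'cV[C]_N) k : (4 <= k <= N)%N -> unit_vec psi ->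
  schmidt_coeffs psi [:: (Num.sqrt 2)^-1; (Num.sqrt 2)^-1] ->
  inD (ptrans (proj psi)) /\
  exists s, spectrum (ptrans (proj psi)) s /\ \sum_(k.-1 <= i < N) s`_i = - 2^-1.
Proof.
move=> /andP[k4 kN] hun hc; set W := ptrans _; set h := (Num.sqrt 2)^-1 in hc.
have hh : h ^+ 2 = 2^-1 by apply: (@invsqrt_sq 2).
have N4 := dim_ge4 hn.
have hD : inD W := inD_pure (isT : (2 <= size [:: h; h])%N) hun hc.
split=> //; have [s hs] := D_spectrum hD; exists s; split=> //; have hW := inD_herm hD.
have k1N : (k.-1 <= N)%N by apply: leq_trans (leq_pred _) kN.
apply/eqP; rewrite eq_le (bottom_sum_ge_half hD hs k1N) andbT.
have [_ h3] := top_sums_pure hun hc hs; rewrite -expr2 hh in h3.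
have h4 : \sum_(3 <= i < N) s`_i <= - 2^-1.
  by rewrite (top_bottom hW hs) ?(leq_trans _ N4) // (inD_rtr hD); lra.
have k3 : (3 <= k.-1)%N by rewrite -ltnS (ltn_predK k4).
move: h4; rewrite (big_cat_nat (n := k.-1)) //= => h4.
(* The last eigenvalue is at most -1/2 while the last two sum to at least -1/2, so all the others
   are nonnegative. Starting the tail later only drops nonnegative terms. *)
suff : 0 <= \sum_(3 <= i < k.-1) s`_i by lra.
have hlast : s`_N.-1 <= - 2^-1.
  pose E : rel 'I_(size [:: h; h]) := fun i k => i != k.
  have hsym : symmetric E by move=> i j; rewrite /E eq_sym.
  have hirr : irreflexive E by move=> i; rewrite /E eqxx.
  have [T [hT hT1 hT2]] := PT_pairs hsym hirr hc.
  have := lamN_le_effect hW hs (ltnW (ltnW N4)) hT; rewrite hT2 hT1.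
  rewrite /= !big_ord_recl !big_ord0 /E /= -!expr2 hh => h5.
  by apply: le_trans (h5 _) _; lra.
have h2 : - 2^-1 <= s`_N.-2 + s`_N.-1.
  have := bottom_sum_ge_half hD hs (leq_subr 2 N).
  by rewrite sum_last2 // (leq_trans _ N4).
rewrite big_nat; apply: sumr_ge0 => i /andP[_ ik].
apply: (@le_trans _ _ s`_N.-2); first by lra.
apply: (spectrum_le hs); apply/andP; split.
  have hN : (0 < N.-1)%N by rewrite -ltnS (ltn_predK N4) (leq_trans _ N4).
  by rewrite -ltnS (ltn_predK hN); apply: leq_trans ik _; rewrite -!subn1 leq_sub2r.
by apply: leq_ltn_trans (leq_pred _) _; rewrite ltn_predL (leq_trans _ N4).
Qed.

End Dim2.

Section Dim3.
Variables (m n : nat).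
Hypotheses (m3 : (3 <= m)%N) (mn : (m <= n)%N).
Local Notation N := (m * n)%N.

Lemma dim_ge9 : (9 <= N)%N.
Proof. exact: (leq_mul m3 (leq_trans m3 mn)). Qed.

Lemma lam_last2 (s : seq R) : lam s N + lam s N.-1 = \sum_(N - 2 <= i < N) s`_i.
Proof. by rewrite sum_last2 ?(leq_trans _ dim_ge9) // addrC. Qed.

Lemma lam_last3 (s : seq R) : lam s N + lam s N.-1 + lam s N.-2 = \sum_(N - 3 <= i < N) s`_i.
Proof. by rewrite sum_last3 ?(leq_trans _ dim_ge9) // /lam -addrA addrC [X in X + _]addrC. Qed.

Lemma lam2_ge (W : 'M[C]_N) s : inD W -> spectrum W s ->
  - (Num.sqrt 2 / 2) <= lam s N + lam s N.-1.
Proof.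
move=> hD hs; rewrite lam_last2.
have [T [hT hT1 <-]] := bottom_effect (inD_herm hD) hs (leq_subr 2 N).
apply: inD_lower => // [|psi]; first by rewrite divr_ge0 // sqrtr_ge0.
by apply: PT_lower2 => //; rewrite hT1 subKn // (leq_trans _ dim_ge9).
Qed.

Lemma lam3_ge (W : 'M[C]_N) s : inD W -> spectrum W s ->
  - 1 <= lam s N + lam s N.-1 + lam s N.-2.
Proof.
move=> hD hs; rewrite lam_last3.
have [T [hT hT1 <-]] := bottom_effect (inD_herm hD) hs (leq_subr 3 N).
apply: inD_lower => // psi; rewrite mul1r.
by apply: PT_lower3 => //; rewrite hT1 subKn // (leq_trans _ dim_ge9).
Qed.

Lemma lam2_attains (psi : 'cV[C]_N) : unit_vec psi ->
  schmidt_coeffs psi [:: Num.sqrt 2 / 2; 2^-1; 2^-1] ->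
  inD (ptrans (proj psi)) /\ exists s, spectrum (ptrans (proj psi)) s /\
    lam s N + lam s N.-1 = - (Num.sqrt 2 / 2).
Proof.
set h := Num.sqrt 2 / 2; move=> hun hc; set W := ptrans _.
have hD : inD W := inD_pure (isT : (2 <= size [:: h; 2^-1; 2^-1])%N) hun hc.
split=> //; have [s hs] := spectrum_exists (inD_herm hD); exists s; split=> //.
apply/eqP; rewrite eq_le (lam2_ge hD hs) andbT lam_last2.
(* The star with centre 0: two edges, each contributing -sqrt 2 / 4. *)
pose E : rel 'I_(size [:: h; 2^-1; 2^-1]) := fun i k => (i == ord0) (+) (k == ord0).
have hsym : symmetric E by move=> i j; rewrite /E addbC.
have hirr : irreflexive E by move=> i; rewrite /E addbb.
have [T [hT hT1 hT2]] := PT_pairs hsym hirr hc.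
have := fan_bottom (k := 2) (inD_herm hD) hs hT; rewrite hT2 hT1.
rewrite /= !big_ord_recl !big_ord0 /E /= => h5.
by apply: le_trans (h5 _ (leq_trans _ dim_ge9)) _ => //; lra.
Qed.

Lemma lam3_attains (psi : 'cV[C]_N) : unit_vec psi ->
  schmidt_coeffs psi [:: (Num.sqrt 3)^-1; (Num.sqrt 3)^-1; (Num.sqrt 3)^-1] ->
  inD (ptrans (proj psi)) /\ exists s, spectrum (ptrans (proj psi)) s /\
    lam s N + lam s N.-1 + lam s N.-2 = - 1.
Proof.
set h := (Num.sqrt 3)^-1; move=> hun hc; set W := ptrans _.
have hh : h ^+ 2 = 3^-1 by apply: (@invsqrt_sq 3).
have hD : inD W := inD_pure (isT : (2 <= size [:: h; h; h])%N) hun hc.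
split=> //; have [s hs] := spectrum_exists (inD_herm hD); exists s; split=> //.
apply/eqP; rewrite eq_le (lam3_ge hD hs) andbT lam_last3.
(* The triangle: three edges, each contributing -1/3. *)
pose E : rel 'I_(size [:: h; h; h]) := fun i k => i != k.
have hsym : symmetric E by move=> i j; rewrite /E eq_sym.
have hirr : irreflexive E by move=> i; rewrite /E eqxx.
have [T [hT hT1 hT2]] := PT_pairs hsym hirr hc.
have := fan_bottom (k := 3) (inD_herm hD) hs hT; rewrite hT2 hT1.
rewrite /= !big_ord_recl !big_ord0 /E /= -!expr2 hh => h5.
by apply: le_trans (h5 _ (leq_trans _ dim_ge9)) _ => //; lra.
Qed.

End Dim3.
End PartialSums.

(** * Full ranges of values, and characterizations of tr (W^2) = 1 and of the eigenvalue -1/2 *)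

Section Parts.
Variable R : realType.
Local Notation C := R[i].
Variables (m n : nat).
Hypothesis hmn : (2 <= m <= n)%N.
Local Notation N := (m * n)%N.

Lemma trsq_attains (x : R) : (N%:R - 1)^-1 < x <= 1 -> valsW m n (@trsq R N) x.
Proof.
move=> /andP[x0 x1]; set c := (N%:R - 1)^-1 in x0.
(* tr (W^2) along [family1], minus x: it runs from 1 / (N - 1) - x < 0 at t = 0 to 1 - x >= 0 at t =
   1. A root exists by the intermediate value theorem, and it is not 0. *)
pose p : {poly R} := (1 - 'X) ^+ 2 * c%:P + 3%:P * 'X * (1 - 'X) * c%:P + 'X ^+ 2 - x%:P.
have pE t : p.[t] = (1 - t) ^+ 2 * c + 3 * t * (1 - t) * c + t ^+ 2 - x.
  by rewrite /p !(hornerE, horner_exp).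
have [|t /andP[t0 t1] /rootP] := @poly_ivt R p 0 1 ler01.
  by rewrite !pE; apply/andP; split; lra.
rewrite pE => ht; have t0' : 0 < t.
  rewrite lt0r t0 andbT; apply/eqP => te; move: ht; rewrite te; lra.
have [|W [s [hD _ _ _ hW]]] := @family1 R m n hmn t; first by rewrite t0' t1.
by exists W; split=> //; rewrite hW -/c; lra.
Qed.

Lemma trsq_eq1 (W : 'M[C]_N) : inD W ->
  (trsq W = 1 <-> exists psi : 'cV[C]_N,
     unit_vec psi /\ entangled psi /\ W = ptrans (proj psi)).
Proof.
move=> hD; split=> [/(proj2 (trsq_le1 hD)) [psi [h1 h2 h3]]|[psi [/unit_vecP h1 [_ ->]]]].
  by exists psi.
have -> : trsq (ptrans (proj psi)) = rtr (ptrans (proj psi) *m ptrans (proj psi)) by [].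
by rewrite rtr_ptrans_mul ptransK rtr_projl qf_proj nsqE0 h1 (nc_real (1 : R)) expr1n.
Qed.

Lemma lamN_attains (x : R) : - 2^-1 <= x < 0 -> valsS m n (fun s : seq R => lam s N) x.
Proof.
move=> /andP[x0 x1]; have [|W [s [hD hs hl _ _]]] := @family1 R m n hmn (- (2 * x)).
  by apply/andP; split; lra.
by exists W, s; split=> //; split=> //; rewrite hl; field.
Qed.

Lemma lamN_eq (W : 'M[C]_N) s : inD W -> spectrum W s ->
  (lam s N = - 2^-1 <-> exists psi : 'cV[C]_N, unit_vec psi /\
     schmidt_coeffs psi [:: Num.sqrt 2 / 2; Num.sqrt 2 / 2] /\ W = ptrans (proj psi)).
Proof.
move=> hD hs; have hW := inD_herm hD; have N4 := dim_ge4 hmn; split=> [hl|[psi [hun [hc hE]]]].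
  have hN : (N.-1 < N)%N by rewrite ltn_predL (leq_trans _ N4).
  have [x [nx hx]] := lam_eigvec (Ordinal hN) hW hs.
  have {hl}hx : rtr (W *m proj x) = - 2^-1 by rewrite -/(qf W x) hx -hl.
  have [|psi|d [U [hWd hU d1 d0 [hM hK]]]] := inD_lower_eq hD (effect_proj nx) _ _ hx.
  - by rewrite invr_gt0.
  - by apply: PT_lower1; [case/andP: hmn | apply: effect_proj | rewrite rtr_proj nx].
  have [g [hg hge]] := PT_extremal hmn nx.
  have hcol i : d i != 0 -> exists c, nc c = 1 /\ col i U = c *: g.
    move=> /hK hi; apply: hge; first exact: nsq_col.
    move: hi; rewrite qfD -scalemx1 qfZ qf1 nsq_col // mulr1 => /eqP.
    by rewrite addr_eq0 => /eqP.
  have [i0 hi0] : exists i, d i != 0.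
    apply/existsP; rewrite -[X in is_true X]negbK negb_exists; apply/negP => /forallP h.
    move: d1; rewrite big1 => [/eqP|i _]; first by rewrite eq_sym oner_eq0.
    by have := h i; rewrite negbK => /eqP.
  exists g; split; last split=> //.
    have [c [nc1 hc]] := hcol i0 hi0; apply/unit_vecP.
    by rewrite -(nsq_col i0 hU) hc nsqZ nc1 mul1r.
  rewrite hWd (eq_bigr (fun i => ((d i)%:C)%C *: ptrans (proj g))).
    by rewrite -scaler_suml -rmorph_sum d1 scale1r.
  (* The weighted eigenvectors differ from [g] by a phase, which the projector does not see. *)
  move=> i _; have [->|/hcol [c [nc1 ->]]] := eqVneq (d i) 0; first by rewrite !scale0r.
  congr (_ *: ptrans _); rewrite /proj mxadjZ -scalemxAl -scalemxAr scalerA mulrC ncE nc1.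
  by rewrite scale1r.
apply/eqP; rewrite eq_le (inD_lamN_ge hmn hD hs) andbT.
pose h : R := Num.sqrt 2 / 2; have hh : h ^+ 2 = 2^-1 := half_sq R.
pose E : rel 'I_(size [:: h; h]) := fun i k => i != k.
have hsym : symmetric E by move=> i j; rewrite /E eq_sym.
have hirr : irreflexive E by move=> i; rewrite /E eqxx.
have [T [hT hT1 hT2]] := PT_pairs hsym hirr hc; rewrite -hE in hT2.
have := lamN_le_effect hW hs (ltnW (ltnW N4)) hT; rewrite hT2 hT1.
rewrite /= !big_ord_recl !big_ord0 /E /= -!expr2 -/h hh => h5.
by apply: le_trans (h5 _) _; lra.
Qed.

Lemma lam1_attains (x : R) : (N%:R - 1)^-1 < x < 1 -> valsS m n (fun s : seq R => lam s 1) x.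
Proof.
move=> /andP[x0 x1]; have /andP[c0 c1] := @inv_N1 R m n hmn; set c := (N%:R - 1)^-1 in x0 c0 c1.
(* [family1] reaches the values up to 1/2, [family2] those above. *)
have [xh|xh] := leP x 2^-1; last first.
  have [|W [s [hD hs hl]]] := @family2 R m n hmn (2 * (1 - x)).
    by apply/andP; split; lra.
  by exists W, s; split=> //; split=> //; rewrite hl; field.
have d0 : 0 < 2^-1 - c by lra.
pose t := (x - c) / (2^-1 - c).
have ht : t * (2^-1 - c) = x - c by rewrite /t mulfVK // gt_eqF.
have t0 : 0 < t by rewrite divr_gt0 // subr_gt0.
have t1 : t <= 1 by rewrite ler_pdivrMr // mul1r lerD2r.
have [|W [s [hD hs _ hl _]]] := @family1 R m n hmn t; first by rewrite t0 t1.
exists W, s; split=> //; split=> //; rewrite hl -/c.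
have -> : (1 - t) * c + t / 2 = c + t * (2^-1 - c) by field.
by rewrite ht addrC subrK.
Qed.

Lemma negativity_attains (x : R) : 0 < x <= (m%:R - 1) / 2 -> valsS m n (@negativity R) x.
Proof. by move=> /(family3 hmn) [W [s [hD hs hx]]]; exists W, s. Qed.

Lemma half_m_gt0 : 0 < (m%:R - 1) / 2 :> R.
Proof. by rewrite divr_gt0 // subr_gt0 ltr1n; case/andP: hmn. Qed.

End Parts.

Unset Implicit Arguments.
Set Strict Implicit.

Theorem theorem1 (R : realType) (m n : nat) (hm : (2 <= m)%N) (hmn : (m <= n)%N) :
  let N := (m * n)%N in
  let inv_mn1 : R := ((m * n)%:R - 1)^-1 in
  let half : R := 2^-1 in
  let PT (psi : 'cV[R[i]]_(m * n)) := ptrans (proj psi) in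
  (* (i) tr(W^2) *)
  ((forall x : R, inv_mn1 < x <= 1 -> valsW m n (@trsq R N) x) /\
   is_inf (valsW m n (@trsq R N)) inv_mn1 /\ ~ valsW m n (@trsq R N) inv_mn1 /\
   is_sup (valsW m n (@trsq R N)) 1 /\ valsW m n (@trsq R N) 1) /\
  (* (ii) *)
  (forall W : 'M[R[i]]_(m * n), inD W ->
     (trsq W = 1 <->
      exists psi : 'cV[R[i]]_(m * n), unit_vec psi /\ entangled psi /\ W = PT psi)) /\
  (* (iii) smallest eigenvalue *)
  ((forall x : R, - half <= x < 0 -> valsS m n (fun s : seq R => lam s N) x) /\
   is_inf (valsS m n (fun s : seq R => lam s N)) (- half) /\
   valsS m n (fun s : seq R => lam s N) (- half) /\
   is_sup (valsS m n (fun s : seq R => lam s N)) 0 /\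
   ~ valsS m n (fun s : seq R => lam s N) 0) /\
  (* (iv) *)
  (forall (W : 'M[R[i]]_(m * n)) (s : seq R), inD W -> spectrum W s ->
     (lam s N = - half <->
      exists psi : 'cV[R[i]]_(m * n), unit_vec psi /\
        schmidt_coeffs psi [:: Num.sqrt 2 / 2; Num.sqrt 2 / 2] /\ W = PT psi)) /\
  (* (v) largest eigenvalue *)
  ((forall x : R, inv_mn1 < x < 1 -> valsS m n (fun s : seq R => lam s 1) x) /\
   is_inf (valsS m n (fun s : seq R => lam s 1)) inv_mn1 /\
   ~ valsS m n (fun s : seq R => lam s 1) inv_mn1 /\
   is_sup (valsS m n (fun s : seq R => lam s 1)) 1 /\
   ~ valsS m n (fun s : seq R => lam s 1) 1) /\
  (* (vi) negativity *)
  ((forall (W : 'M[R[i]]_(m * n)) (s : seq R), inD W -> spectrum W s ->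
      0 < negativity s <= (m%:R - 1) / 2) /\
   (forall x : R, 0 < x <= (m%:R - 1) / 2 -> valsS m n (@negativity R) x) /\
   is_sup (valsS m n (@negativity R)) ((m%:R - 1) / 2) /\
   valsS m n (@negativity R) ((m%:R - 1) / 2) /\
   is_inf (valsS m n (@negativity R)) 0 /\
   ~ valsS m n (@negativity R) 0) /\
  (* (vii) maximal negativity *)
  (forall (W : 'M[R[i]]_(m * n)) (s : seq R), inD W -> spectrum W s ->
     (negativity s = (m%:R - 1) / 2 <->
      exists (U : 'M[R[i]]_m) (V : 'M[R[i]]_n) (k : nat),
        unitary U /\ unitary V /\ (1 <= k <= n %/ m)%N /\
        exists p : 'I_k -> R,
          (forall j, 0 <= p j) /\ \sum_(j < k) p j = 1 /\
          tensmx U V *m W *m mxadj (tensmx U V) =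
            \sum_(j < k) ((p j)%:C)%C *: PT (@Phi R m n j))) /\
  (* (viii) m = 2 *)
  (m = 2%N ->
     let a : R := (2 + 2 * Num.sqrt 2)^-1 in
     ((forall (W : 'M[R[i]]_(m * n)) (s : seq R), inD W -> spectrum W s ->
         - a <= \sum_(2 <= i < N) s`_i) /\
      (exists x1 x2 : R, 0 < x1 /\ 0 < x2 /\ x1 ^+ 2 + x2 ^+ 2 = 1 /\
                         x1 ^+ 2 + x1 * x2 = 1 + a) /\
      (forall x1 x2 : R, 0 < x1 -> 0 < x2 -> x1 ^+ 2 + x2 ^+ 2 = 1 ->
         x1 ^+ 2 + x1 * x2 = 1 + a ->
         let W := PT ((x1%:C)%C *: @ket R m n 0 0 + (x2%:C)%C *: @ket R m n 1 1) in
         inD W /\ exists s, spectrum W s /\ \sum_(2 <= i < N) s`_i = - a)) /\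
     (forall k : nat, (4 <= k <= N)%N ->
       (forall (W : 'M[R[i]]_(m * n)) (s : seq R), inD W -> spectrum W s ->
          - half <= \sum_(k.-1 <= i < N) s`_i) /\
       (exists psi : 'cV[R[i]]_(m * n), unit_vec psi /\
          schmidt_coeffs psi [:: (Num.sqrt 2)^-1; (Num.sqrt 2)^-1]) /\
       (forall psi : 'cV[R[i]]_(m * n), unit_vec psi ->
          schmidt_coeffs psi [:: (Num.sqrt 2)^-1; (Num.sqrt 2)^-1] ->
          inD (PT psi) /\
          exists s, spectrum (PT psi) s /\ \sum_(k.-1 <= i < N) s`_i = - half))) /\
  (* (ix) 3 <= m *)
  ((3 <= m)%N ->
     ((forall (W : 'M[R[i]]_(m * n)) (s : seq R), inD W -> spectrum W s ->
         - (Num.sqrt 2 / 2) <= lam s N + lam s N.-1) /\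
      (exists psi : 'cV[R[i]]_(m * n), unit_vec psi /\
         schmidt_coeffs psi [:: Num.sqrt 2 / 2; half; half]) /\
      (forall psi : 'cV[R[i]]_(m * n), unit_vec psi ->
         schmidt_coeffs psi [:: Num.sqrt 2 / 2; half; half] ->
         inD (PT psi) /\
         exists s, spectrum (PT psi) s /\
           lam s N + lam s N.-1 = - (Num.sqrt 2 / 2))) /\
     ((forall (W : 'M[R[i]]_(m * n)) (s : seq R), inD W -> spectrum W s ->
         - 1 <= lam s N + lam s N.-1 + lam s N.-2) /\
      (exists psi : 'cV[R[i]]_(m * n), unit_vec psi /\
         schmidt_coeffs psi [:: (Num.sqrt 3)^-1; (Num.sqrt 3)^-1; (Num.sqrt 3)^-1]) /\
      (forall psi : 'cV[R[i]]_(m * n), unit_vec psi ->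
         schmidt_coeffs psi [:: (Num.sqrt 3)^-1; (Num.sqrt 3)^-1; (Num.sqrt 3)^-1] ->
         inD (PT psi) /\
         exists s, spectrum (PT psi) s /\
           lam s N + lam s N.-1 + lam s N.-2 = - 1))).
Proof.
move=> N inv_mn1 half PT.
have h2 : (2 <= m <= n)%N by rewrite hm.
have /andP[c0 c1] := @inv_N1 R m n h2; rewrite -/inv_mn1 in c0 c1.
have mR := @half_m_gt0 R m n h2.
have half0 : 0 < half by rewrite invr_gt0.
have h10 : valsS m n (fun s : seq R => lam s N) (- half).
  by apply: (lamN_attains h2); apply/andP; split; [exact: lexx | rewrite oppr_lt0].
have h1 : valsW m n (@trsq R N) 1 by apply: (trsq_attains h2); rewrite lexx andbT -/inv_mn1; lra.
have h6 : valsS m n (@negativity R) ((m%:R - 1) / 2).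
  by apply: (negativity_attains h2); rewrite mR lexx.
split.
  split; first exact: trsq_attains.
  split.
    apply: (is_inf_range (b := 1)) => [|y [W [hD <-]]|x /andP[x0 x1]]; first by lra.
      exact/ltW/(trsq_gt h2 hD).
    by apply: (trsq_attains h2); rewrite x0 ltW.
  split; first by move=> [W [hD hW]]; have := trsq_gt h2 hD; rewrite hW ltxx.
  split=> //; apply: is_sup_max => // y [W [hD <-]].
  exact: (proj1 (trsq_le1 hD)).
split; first by move=> W hD; apply: trsq_eq1.
split.
  split; first exact: lamN_attains.
  split; first by apply: is_inf_min => // y [W [s [hD [hs <-]]]]; apply: (inD_lamN_ge h2 hD hs).
  split=> //; split.
    apply: (is_sup_range (a := - half)) => [|y [W [s [hD [hs <-]]]]|x /andP[x0 x1]].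
    - by rewrite oppr_lt0.
    - exact/ltW/(D_lamN_lt0 h2 hD hs).
    - by apply: (lamN_attains h2); rewrite ltW.
  by move=> [W [s [hD [hs h]]]]; have := D_lamN_lt0 h2 hD hs; rewrite -/N h ltxx.
split; first by move=> W s hD hs; apply: lamN_eq.
split.
  split; first exact: lam1_attains.
  split.
    apply: (is_inf_range (b := 1)) => [|y [W [s [hD [hs <-]]]]|x hx]; first by lra.
      by have /andP[h _] := lam1_bounds h2 hD hs; apply: ltW.
    exact: (lam1_attains h2).
  split; first by move=> [W [s [hD [hs h]]]]; have := lam1_bounds h2 hD hs; rewrite h ltxx.
  split.
    apply: (is_sup_range (a := inv_mn1)) => [|y [W [s [hD [hs <-]]]]|x hx]; first by lra.
      by have /andP[_ h] := lam1_bounds h2 hD hs; apply: ltW.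
    exact: (lam1_attains h2).
  by move=> [W [s [hD [hs h]]]]; have := lam1_bounds h2 hD hs; rewrite h ltxx andbF.
split.
  split; first by move=> W s hD hs; apply: (negativity_bounds h2 hD hs).
  split; first exact: negativity_attains.
  split.
    apply: is_sup_max => // y [W [s [hD [hs <-]]]].
    by have /andP[] := negativity_bounds h2 hD hs.
  split=> //; split.
    apply: (is_inf_range (b := (m%:R - 1) / 2)) => // [y [W [s [hD [hs <-]]]]|x /andP[x0 x1]].
      by have /andP[h _] := negativity_bounds h2 hD hs; apply: ltW.
    by apply: (negativity_attains h2); rewrite x0 ltW.
  by move=> [W [s [hD [hs h]]]]; have := negativity_bounds h2 hD hs; rewrite h ltxx.
split.
  move=> W s hD hs; split=> [|[U [V [k [hU [hV [hk [p [_ [p1 hW]]]]]]]]]].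
    exact: Phi_neg_forward.
  apply/eqP; rewrite eq_le; have /andP[_ ->] /= := negativity_bounds h2 hD hs.
  exact: (Phi_neg_backward h2 hD hs hU hV hk p1 hW).
split.
  move=> m2; subst m => a; split.
    split; first by move=> W s hD hs; apply: (bottom_sum_ge h2 hD hs).
    split; first exact: angle_exists.
    by move=> x1 x2 p1 p2 e1 e2; apply: (angle_attains h2 p1 p2 e1 e2).
  (* Eigenvalues are counted from 1 and list entries from 0: the tail from the k-th starts at
     [k.-1]. *)
  move=> k hk; split.
    move=> W s hD hs; apply: (bottom_sum_ge_half h2 hD hs).
    by apply: leq_trans (leq_pred _) _; case/andP: hk.
  split; last by move=> psi hun hc; apply: (bottom_sum_attains h2 hk hun hc).
  apply: schmidt_exists => //; first by rewrite /= invr_gt0 sqrtr_gt0 ltr0n.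
  rewrite /= !big_ord_recl big_ord0 /= (@invsqrt_sq R 2) //; lra.
move=> m3; split; split.
- by move=> W s hD hs; apply: (lam2_ge m3 hmn hD hs).
- split; last by move=> psi hun hc; apply: (lam2_attains m3 hmn hun hc).
  apply: schmidt_exists; rewrite ?m3 ?hmn //.
    by rewrite /= divr_gt0 ?sqrtr_gt0 // invr_gt0 ltr0n.
  rewrite /= !big_ord_recl big_ord0 /= half_sq /half; lra.
- by move=> W s hD hs; apply: (lam3_ge m3 hmn hD hs).
- split; last by move=> psi hun hc; apply: (lam3_attains m3 hmn hun hc).
  apply: schmidt_exists; rewrite ?m3 ?hmn //; first by rewrite /= invr_gt0 sqrtr_gt0 ltr0n.
  rewrite /= !big_ord_recl big_ord0 /= (@invsqrt_sq R 3) //; lra.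
Qed.
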